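(* Let $2\leq s<\infty$ be an integer and let $\{3,4,3\}$ denote the 24-cell. Then $2^{\{3,4,3\},\mathcal{G}(s)}$ is a regular $5$-polytope of type $\{4,3,4,3\}$ with automorphism group $D_s^{12}\rtimes[3,4,3]$ of order $1152\cdot(2s)^{12}$. Moreover, the group $G(2^{\{3,4,3\},\mathcal{G}(s)})=\langle\rho_0,\rho_1,\rho_2,\rho_3,\rho_4\rangle$ is the quotient of the Coxeter group $[4,3,4,3]$ by the relations $$(\rho_0\beta^{-i}\rho_0\beta^i)^2=id\ \text{ for } i\in\{3,4\},\quad\text{and}\quad(\rho_0\beta^6\rho_0\beta^6)^s=id,$$ where $\beta=\rho_1\rho_2\rho_3\rho_4$, and its toroidal residue is the cubic toroid $\{4,3,4\}_{(4,0,0)}$.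
   Context: C-groups and polytopes: a C-group of rank $m$ is a group $G$ with generating involutions $\rho_0,\dots,\rho_{m-1}$ satisfying $\langle\rho_i\mid i\in I\rangle\cap\langle\rho_j\mid j\in J\rangle=\langle\rho_k\mid k\in I\cap J\rangle$ for all $I,J\subseteq\{0,\dots,m-1\}$; it is a string C-group if $(\rho_i\rho_j)^2=id$ whenever $|i-j|\geq 2$. Abstract regular polytopes $\mathcal{P}$ of rank $m$ are in one-to-one correspondence with string C-groups $G(\mathcal{P})$ of rank $m$: the $i$-faces are the right cosets of $\langle\rho_j\mid j\neq i\rangle$, and vertices are the $0$-faces. The Schläfli type is $\{p_1,\dots,p_{m-1}\}$, $p_i$ being the order of $\rho_{i-1}\rho_i$, and $[p_1,\dots,p_{m-1}]$ denotes the corresponding Coxeter group with linear diagram. Construction of $2^{\mathcal{P},\mathcal{G}(s)}$: let $\mathcal{P}$ be a centrally symmetric regular $n$-polytope with group $G(\mathcal{P})=\langle\tau_0,\dots,\tau_{n-1}\rangle$, i.e. $G(\mathcal{P})$ has a proper central involution $\alpha$ fixing no vertex. Let $F_0$ be the base vertex, stabilized by $\langle\tau_1,\dots,\tau_{n-1}\rangle$. Let $W$ be the Coxeter group generated by involutions $\sigma_F$, one for each vertex $F$ of $\mathcal{P}$, with defining relations $\sigma_F^2=id$, $(\sigma_F\sigma_{F\alpha})^s=id$, and $(\sigma_F\sigma_{F'})^2=id$ for $F'\notin\{F,F\alpha\}$; so $W\cong D_s^{q}$, where $q$ is half the number of vertices and $D_s$ is the dihedral group of order $2s$. The group $G(\mathcal{P})$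 acts on $W$ by $\tau^{-1}\sigma_F\tau=\sigma_{F\tau}$. Then $2^{\mathcal{P},\mathcal{G}(s)}$ is the regular $(n+1)$-polytope with group $G(2^{\mathcal{P},\mathcal{G}(s)}):=W\rtimes G(\mathcal{P})=\langle\rho_0,\dots,\rho_n\rangle$, where $\rho_0:=\sigma_{F_0}$ and $\rho_i:=\tau_{i-1}$ for $1\leq i\leq n$. For the 24-cell, $G(\mathcal{P})=[3,4,3]$ has order $1152$, there are $24$ vertices, and $\alpha=(\tau_0\tau_1\tau_2\tau_3)^6$. The toroidal residue is the rank $4$ regular polytope with group $\langle\rho_0,\rho_1,\rho_2,\rho_3\rangle$ (the facet). The cubic toroid $\{4,3,4\}_{(4,0,0)}$ is the regular $4$-polytope whose group is the quotient of the Coxeter group $[4,3,4]=\langle\rho_0,\rho_1,\rho_2,\rho_3\rangle$ by the relation $(\rho_0\rho_1\rho_2\rho_3\rho_2\rho_1)^4=id$. *)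

(* Defs.v *)
From HB Require Import structures.
From mathcomp Require Import all_boot all_fingroup all_solvable.
From mathcomp Require Import all_classical.

Set Implicit Arguments.
Unset Strict Implicit.
Unset Printing Implicit Defensive.

(* [fingroup] also has a function named [repr]. *)
Local Notation repr := generic_quotient.repr.

Local Open Scope quotient_scope.
Local Open Scope classical_set_scope.
Local Open Scope card_scope.
Local Open Scope group_scope.

(* Groups are [groupType]s, which may be infinite. *)

Section Groups.
Variable G : groupType.

Definition subgroup (H : set G) :=
  H 1 /\ forall x y, H x -> H y -> H (x * y^-1).

Definition generated (S : set G) : set G := smallest subgroup S.

Definition normal_subgroup (N : set G) :=
  subgroup N /\ forall x g, N x -> N (x ^ g).

Definition normal_closure (S : set G) : set G := smallest normal_subgroup S.

Definition has_order (x : G) (p : nat) :=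
  [/\ (0 < p)%N, x ^+ p = 1 & forall k, (0 < k < p)%N -> x ^+ k <> 1].

Definition right_coset (H : set G) (g : G) : set G := [set h * g | h in H].

Definition right_cosets (H : set G) : set (set G) := range (right_coset H).

Lemma right_coset_mul_subproof (H : set G) (A : right_cosets H) g :
  right_coset (val A) g \in right_cosets H.
Proof.
case: A => A /= /set_mem [x _ <-]; apply/mem_set; exists (x * g) => //.
apply/seteqP; split=> y /=.
  by move=> [h Hh <-]; exists (h * x); [exists h | rewrite mulgA].
by move=> [z [h Hh <-] <-]; exists h; rewrite ?mulgA.
Qed.

Definition right_coset_mul (H : set G) (A : right_cosets H) (g : G) : right_cosets H :=
  exist (fun B => B \in right_cosets H) _ (right_coset_mul_subproof A g).

Lemma right_coset_base_subproof (H : set G) : right_coset H 1 \in right_cosets H.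
Proof. by apply/mem_set; exists 1. Qed.

Definition right_coset_base (H : set G) : right_cosets H :=
  exist (fun B => B \in right_cosets H) _ (right_coset_base_subproof H).

End Groups.

(* Coxeter group with Coxeter matrix [m].  Since the generators are
   involutions, words in the generators modulo the congruence generated by the
   defining relations already form a group.  The diagonal of [m] is irrelevant,
   and [m i j = 0] encodes the absence of a relation between [i] and [j]. *)

Section Coxeter.
Variables (I : choiceType) (m : I -> I -> nat).

Inductive cox_eq : seq I -> seq I -> Prop :=
| cox_refl u : cox_eq u u
| cox_sym u v : cox_eq u v -> cox_eq v u
| cox_trans u v w : cox_eq u v -> cox_eq v w -> cox_eq u w
| cox_cat u v u' v' : cox_eq u v -> cox_eq u' v' -> cox_eq (u ++ u') (v ++ v')
| cox_invol i : cox_eq [:: i; i] [::]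
| cox_order i j : cox_eq (flatten (nseq (m i j) [:: i; j])) [::].

Definition cox_rel (u v : seq I) : bool := `[< cox_eq u v >].

Lemma cox_rel_refl : reflexive cox_rel.
Proof. by move=> u; apply/asboolP; exact: cox_refl. Qed.

Lemma cox_rel_sym : symmetric cox_rel.
Proof. by move=> u v; apply/asboolP/asboolP; exact: cox_sym. Qed.

Lemma cox_rel_trans : transitive cox_rel.
Proof.
by move=> v u w /asboolP uv /asboolP vw; apply/asboolP; exact: cox_trans uv vw.
Qed.

Canonical cox_equiv := EquivRel cox_rel cox_rel_refl cox_rel_sym cox_rel_trans.

Definition coxeter := {eq_quot cox_rel}.

HB.instance Definition _ := Choice.on coxeter.
HB.instance Definition _ := EqQuotient.on coxeter.

Definition cox_word (u : seq I) : coxeter := \pi_coxeter u.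

Lemma cox_wordP u v : cox_word u = cox_word v <-> cox_eq u v.
Proof.
by split=> [/eqP|uv]; [rewrite /cox_word eqmodE => /asboolP|];
  last by apply/eqP; rewrite /cox_word eqmodE; apply/asboolP.
Qed.

Lemma cox_word_repr (x : coxeter) : cox_word (repr x) = x.
Proof. exact: reprK. Qed.

Definition cox_gen (i : I) : coxeter := cox_word [:: i].
Definition cox_one : coxeter := cox_word [::].
Definition cox_mul (x y : coxeter) := cox_word (repr x ++ repr y).
Definition cox_inv (x : coxeter) := cox_word (rev (repr x)).

Lemma cox_mul_word u v : cox_mul (cox_word u) (cox_word v) = cox_word (u ++ v).
Proof.
by apply/cox_wordP/cox_cat; apply/cox_wordP; rewrite cox_word_repr.
Qed.

Lemma cox_mulA : associative cox_mul.
Proof.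
move=> x y z; rewrite -(cox_word_repr x) -(cox_word_repr y) -(cox_word_repr z).
by rewrite !cox_mul_word catA.
Qed.

Lemma cox_mul1 : left_id cox_one cox_mul.
Proof. by move=> x; rewrite -(cox_word_repr x) cox_mul_word. Qed.

Lemma cox_1mul : right_id cox_one cox_mul.
Proof. by move=> x; rewrite -(cox_word_repr x) cox_mul_word cats0. Qed.

Lemma cox_eq_rev u : cox_eq (rev u ++ u) [::].
Proof.
elim: u => [|i u IH]; first exact: cox_refl.
rewrite rev_cons -cats1 -catA /=; apply: cox_trans IH.
apply: cox_cat (cox_refl _) _.
exact: (cox_cat (cox_invol i) (cox_refl u)).
Qed.

Lemma cox_mulV : left_inverse cox_one cox_inv cox_mul.
Proof.
move=> x; rewrite -{2}(cox_word_repr x) cox_mul_word.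
exact/cox_wordP/cox_eq_rev.
Qed.

Lemma cox_Vmul : right_inverse cox_one cox_inv cox_mul.
Proof.
move=> x; rewrite -{1}(cox_word_repr x) cox_mul_word.
by apply/cox_wordP; have := cox_eq_rev (rev (repr x)); rewrite revK.
Qed.

HB.instance Definition _ := isGroup.Build coxeter
  cox_mulA cox_mul1 cox_1mul cox_mulV cox_Vmul.

Lemma cox_wordM u v : cox_word (u ++ v) = cox_word u * cox_word v.
Proof. by rewrite -cox_mul_word. Qed.

Lemma cox_gen2 i : cox_gen i * cox_gen i = 1.
Proof. by rewrite -cox_wordM; apply/cox_wordP; exact: cox_invol. Qed.

Lemma cox_genM i j : (cox_gen i * cox_gen j) ^+ (m i j) = 1.
Proof.
transitivity (cox_word (flatten (nseq (m i j) [:: i; j])));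
  last by apply/cox_wordP; exact: cox_order.
elim: (m i j) => [|k IH]; first by rewrite expg0.
by rewrite expgS IH /cox_gen -!cox_wordM.
Qed.

Lemma cox_ind (P : coxeter -> Prop) :
  P 1 -> (forall i x, P x -> P (cox_gen i * x)) -> forall x, P x.
Proof.
move=> P1 PM x; rewrite -(cox_word_repr x); elim: (repr x) => [//|i u IH].
by rewrite -cat1s cox_wordM; exact: PM.
Qed.

Section Map.
Variables (f : I -> I) (fm : forall i j, m (f i) (f j) = m i j).

Definition cox_map (x : coxeter) : coxeter := cox_word (map f (repr x)).

Lemma cox_eq_map u v : cox_eq u v -> cox_eq (map f u) (map f v).
Proof.
elim=> {u v} [u|u v _|u v w _ IH1 _|u v u' v' _ IH1 _ IH2|i|i j].
- exact: cox_refl.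
- exact: cox_sym.
- exact: cox_trans.
- by rewrite !map_cat; exact: cox_cat.
- exact: cox_invol.
- by rewrite map_flatten map_nseq /= -fm; exact: cox_order.
Qed.

Lemma cox_map_word u : cox_map (cox_word u) = cox_word (map f u).
Proof. by apply/cox_wordP/cox_eq_map/cox_wordP; rewrite cox_word_repr. Qed.

End Map.

End Coxeter.

(* [p_1, ..., p_k] is [string_coxeter [:: p_1; ...; p_k]]; its generators are
   [string_gen p 0], ..., [string_gen p k]. *)

Definition string_matrix (p : seq nat) (i j : 'I_(size p).+1) : nat :=
  if j == i then 1%N
  else if j == i.+1 :> nat then nth 0%N p i
  else if i == j.+1 :> nat then nth 0%N p j
  else 2%N.

Definition string_coxeter (p : seq nat) : groupType :=
  coxeter (@string_matrix p).

Definition string_gen (p : seq nat) (k : nat) : string_coxeter p :=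
  cox_gen (@string_matrix p) (inord k).

(* The group generated by [rho] is, with [rho i] the image of the i-th
   generator, the quotient of the Coxeter group [p] by the relations [r = 1],
   for [r] in [R]. *)
Definition is_quotient_by (p : seq nat) (R : set (string_coxeter p))
    (G : groupType) (rho : 'I_(size p).+1 -> G) :=
  exists f : {multiplicative string_coxeter p -> G},
    (forall i, f (cox_gen (@string_matrix p) i) = rho i) /\
    [set x | f x = 1] = normal_closure R.

Section StringCGroups.
Variables (n : nat) (G : groupType) (rho : 'I_n -> G).

Definition parabolic (J : set 'I_n) : set G := generated (rho @` J).

(* The subgroup generated by [rho] is a string C-group. *)
Definition string_C_group :=
  [/\ forall i, has_order (rho i) 2,
      forall i j : 'I_n, (i.+1 < j)%N || (j.+1 < i)%N ->
        (rho i * rho j) ^+ 2 = 1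
    & forall J K, parabolic J `&` parabolic K = parabolic (J `&` K)].

Definition has_schlafli_type (p : seq nat) :=
  n = (size p).+1 /\
  forall i j : 'I_n, j = i.+1 :> nat -> has_order (rho i * rho j) (nth 0%N p i).

(* Faces, including the two improper ones.  The index [k : 'I_n.+2] stands for
   the rank [k - 1]: for k = 0 and k = n + 1 (ranks -1 and n) no generator is
   omitted, so when [rho] generates [G] there is one face, the coset [G]. *)
Definition face_stabilizer (k : 'I_n.+2) : set G :=
  parabolic [set j : 'I_n | j.+1 <> k].

Definition face := {k : 'I_n.+2 & right_cosets (face_stabilizer k)}.

Definition face_le (F F' : face) : Prop :=
  (tag F <= tag F')%N /\ (val (tagged F) `&` val (tagged F')) !=set0.

Definition face_mul (F : face) (g : G) : face :=
  Tagged (fun k => right_cosets (face_stabilizer k)) (right_coset_mul (tagged F) g).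

End StringCGroups.

Section AbstractPolytopes.
Variables (T : Type) (le : T -> T -> Prop).

Let lt x y := le x y /\ x <> y.

Definition is_chain (C : set T) := forall x y, C x -> C y -> le x y \/ le y x.

Definition is_flag (C : set T) :=
  is_chain C /\ forall D, is_chain D -> C `<=` D -> D = C.

Definition adjacent_flags (C D : set T) :=
  exists x y, C `\` D = [set x] /\ D `\` C = [set y].

Definition covers x y := lt x y /\ forall z, ~ (lt x z /\ lt z y).

Definition poset_automorphism (f : T -> T) :=
  bijective f /\ forall x y, le (f x) (f y) <-> le x y.

(* In the fourth clause, the ranks of x and y differ by 2 exactly when some h
   satisfies covers x h and covers h y. *)
Definition abstract_polytope (n : nat) :=
  [/\ [/\ forall x, le x x, forall x y, le x y -> le y x -> x = y
        & forall x y z, le x y -> le y z -> le x z],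
      (exists x, forall y, le x y) /\ (exists x, forall y, le y x),
      forall C, is_flag C -> C #= `I_n.+2,
      forall x h y, covers x h -> covers h y ->
        exists! h', [/\ h' <> h, lt x h' & lt h' y]
    & forall C D, is_flag C -> is_flag D ->
        exists k (E : nat -> set T),
          [/\ E 0%N = C, E k = D,
              forall i, (i < k)%N -> adjacent_flags (E i) (E i.+1)
            & forall i, (i <= k)%N -> is_flag (E i) /\ C `&` D `<=` E i]].

Definition regular_polytope (n : nat) :=
  abstract_polytope n /\
  forall C D, is_flag C -> is_flag D ->
    exists2 f, poset_automorphism f & f @` C = D.

End AbstractPolytopes.

Section SemidirectProduct.
Variables G W : groupType.

Record group_action := GroupAction {
  gact :> W -> G -> W;
  gact1 : forall w, gact w 1 = w;
  gactM : forall w g h, gact w (g * h) = gact (gact w g) h;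
  gact_mul : forall v w g, gact (v * w) g = gact v g * gact w g }.

(* The pair (g, w) stands for the product g w, so that w ^ g = a w g. *)
Definition semidirect (a : group_action) : Type := (G * W)%type.

Variable a : group_action.

Definition sd_one : semidirect a := (1, 1).
Definition sd_mul (x y : semidirect a) : semidirect a :=
  (x.1 * y.1, a x.2 y.1 * y.2).
Definition sd_inv (x : semidirect a) : semidirect a :=
  (x.1^-1, a (x.2^-1) (x.1^-1)).

Lemma gact_one g : a 1 g = 1.
Proof. by apply: (mulgI (a 1 g)); rewrite -gact_mul !mulg1. Qed.

Lemma sd_mulA : associative sd_mul.
Proof.
by move=> [g u] [h v] [k w]; rewrite /sd_mul /= gact_mul gactM !mulgA.
Qed.

Lemma sd_mul1 : left_id sd_one sd_mul.
Proof. by move=> [g u]; rewrite /sd_mul /= gact_one !mul1g. Qed.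

Lemma sd_1mul : right_id sd_one sd_mul.
Proof. by move=> [g u]; rewrite /sd_mul /= gact1 !mulg1. Qed.

Lemma sd_mulV : left_inverse sd_one sd_inv sd_mul.
Proof.
move=> [g u]; rewrite /sd_mul /sd_inv /= -gactM mulVg gact1.
by rewrite mulVg.
Qed.

Lemma sd_Vmul : right_inverse sd_one sd_inv sd_mul.
Proof.
move=> [g u]; rewrite /sd_mul /sd_inv /= -gact_mul !mulgV.
by rewrite gact_one.
Qed.

HB.instance Definition _ := Choice.copy (semidirect a) (G * W)%type.
HB.instance Definition _ := isGroup.Build (semidirect a)
  sd_mulA sd_mul1 sd_1mul sd_mulV sd_Vmul.

Definition sd_inl (g : G) : semidirect a := (g, 1).
Definition sd_inr (w : W) : semidirect a := (1, w).

End SemidirectProduct.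

(* The construction 2^{P,G(s)}, for the group G of a regular polytope with
   distinguished generators [tau] and central involution [alpha]; only the
   centrality of [alpha] is needed to form the semidirect product. *)

Section CubicConstruction.
Variables (n : nat) (G : groupType) (tau : 'I_n.+1 -> G) (alpha : G).
Hypothesis alpha_central : forall g, commute alpha g.
Variable s : nat.

Definition vertex_stabilizer : set G := parabolic tau [set j | j <> ord0].

Definition vertex : choiceType := right_cosets vertex_stabilizer.

Definition vertex_mul (F : vertex) (g : G) : vertex := right_coset_mul F g.

Definition vertex_matrix (F F' : vertex) : nat :=
  if F' == F then 1%N else if F' == vertex_mul F alpha then s else 2%N.

Definition vertex_coxeter : groupType := coxeter vertex_matrix.

Lemma vertex_mul1 F : vertex_mul F 1 = F.
Proof.
apply: val_inj; rewrite /= /right_coset; apply/seteqP; split=> x /=.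
  by move=> [y Fy <-]; rewrite mulg1.
by move=> Fx; exists x; rewrite ?mulg1.
Qed.

Lemma vertex_mulM F g h : vertex_mul F (g * h) = vertex_mul (vertex_mul F g) h.
Proof.
apply: val_inj; rewrite /= /right_coset; apply/seteqP; split=> x /=.
  by move=> [y Fy <-]; exists (y * g); [exists y | rewrite mulgA].
by move=> [_ [y Fy <-] <-]; exists y; rewrite ?mulgA.
Qed.

Lemma vertex_mul_eq F F' g :
  (vertex_mul F g == vertex_mul F' g) = (F == F').
Proof.
apply/eqP/eqP=> [|->//] /(congr1 (vertex_mul^~ g^-1)).
by rewrite -!vertex_mulM mulgV !vertex_mul1.
Qed.

Lemma vertex_matrix_mul g F F' :
  vertex_matrix (vertex_mul F g) (vertex_mul F' g) = vertex_matrix F F'.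
Proof.
rewrite /vertex_matrix vertex_mul_eq -vertex_mulM -alpha_central vertex_mulM.
by rewrite vertex_mul_eq.
Qed.

Definition vertex_act (w : vertex_coxeter) (g : G) : vertex_coxeter :=
  cox_map (vertex_mul^~ g) w.

Lemma vertex_act_word u g :
  vertex_act (cox_word vertex_matrix u) g =
  cox_word vertex_matrix (map (vertex_mul^~ g) u).
Proof. exact: (cox_map_word (vertex_matrix_mul g)). Qed.

Lemma vertex_act1 w : vertex_act w 1 = w.
Proof.
rewrite -(cox_word_repr w) vertex_act_word; congr cox_word.
by apply: map_id_in => F _; exact: vertex_mul1.
Qed.

Lemma vertex_actM w g h : vertex_act w (g * h) = vertex_act (vertex_act w g) h.
Proof.
rewrite -(cox_word_repr w) !vertex_act_word; congr cox_word.
by rewrite -map_comp; apply: eq_map => F; exact: vertex_mulM.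
Qed.

Lemma vertex_act_mul v w g :
  vertex_act (v * w) g = vertex_act v g * vertex_act w g.
Proof.
rewrite -(cox_word_repr v) -(cox_word_repr w) -cox_wordM !vertex_act_word.
by rewrite map_cat cox_wordM.
Qed.

Definition vertex_action : group_action G vertex_coxeter :=
  GroupAction vertex_act1 vertex_actM vertex_act_mul.

Definition cubic_group : groupType := semidirect vertex_action.

Definition base_vertex : vertex := right_coset_base vertex_stabilizer.

Definition cubic_gen (i : 'I_n.+2) : cubic_group :=
  if unlift ord0 i is Some j then sd_inl vertex_action (tau j)
  else sd_inr vertex_action (cox_gen vertex_matrix base_vertex).

End CubicConstruction.

(* Conjugation by h = abcd maps a -> b -> cbabc -> badcbcdab -> cbc -> dcbabcd
   -> a, whence h^6 commutes with a and b. *)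

Lemma F4_coxeter_element (G : groupType) (a b c d : G) :
  a * a = 1 -> b * b = 1 -> c * c = 1 -> d * d = 1 ->
  (a * b) ^+ 3 = 1 -> (b * c) ^+ 4 = 1 -> (c * d) ^+ 3 = 1 ->
  (a * c) ^+ 2 = 1 -> (a * d) ^+ 2 = 1 -> (b * d) ^+ 2 = 1 ->
  commute ((a * b * c * d) ^+ 6) a /\ commute ((a * b * c * d) ^+ 6) b.
Proof.
move=> a2 b2 c2 d2 ab3 bc4 cd3 ac2 ad2 bd2.
have K (y : G) : y * y = 1 -> forall x, y * (y * x) = x.
  by move=> y2 x; rewrite mulgA y2 mul1g.
have V (y : G) : y * y = 1 -> y^-1 = y.
  by move=> y2; apply: (mulgI y); rewrite mulgV y2.
have C (y z : G) : y * y = 1 -> z * z = 1 -> (y * z) ^+ 2 = 1 ->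
    forall x, z * (y * x) = y * (z * x).
  move=> y2 z2 /V; rewrite invgM (V y) // (V z) // => e x.
  by rewrite !mulgA e.
have B (y z : G) : y * y = 1 -> z * z = 1 -> (y * z) ^+ 3 = 1 ->
    forall x, z * (y * (z * x)) = y * (z * (y * x)).
  move=> y2 z2 e x; rewrite !mulgA; congr (_ * x).
  move: e; rewrite !expgS expg0 mulg1 -!mulgA => e.
  by apply: (mulgI (y * (z * y))); rewrite -!mulgA e (K y) // (K z).
have aa := K _ a2; have bb := K _ b2; have cc := K _ c2; have dd := K _ d2.
have ca := C _ _ a2 c2 ac2; have da := C _ _ a2 d2 ad2.
have db := C _ _ b2 d2 bd2.
have bab := B _ _ a2 b2 ab3; have dcd := B _ _ c2 d2 cd3.
have cbcb x : c * (b * (c * (b * x))) = b * (c * (b * (c * x))).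
  rewrite !mulgA; congr (_ * x).
  move: bc4; rewrite !expgS expg0 mulg1 -!mulgA => e.
  by apply: (mulgI (b * (c * (b * c)))); rewrite -!mulgA e cc bb cc.
have cbacba x : c * (b * (a * (c * (b * (a * x))))) =
    b * (c * (b * (a * (c * (b * x))))).
  by rewrite -ca -bab cbcb ca.
set h := a * b * c * d.
have hE x : h * x = a * (b * (c * (d * x))) by rewrite /h !mulgA.
have ha x : h * (a * x) = b * (h * x).
  by rewrite !hE da ca -bab.
have hc x : h * (c * x) = d * (h * x).
  by rewrite !hE -dcd -db -da.
have hb x : h * (b * x) = c * (b * (a * (b * (c * (h * x))))).
  by rewrite !hE db ca bab aa ca cbcb cc.
have h2 x : h * (c * (b * (a * (b * (c * x))))) =
    b * (a * (d * (c * (b * (c * (d * (a * (b * (h * x))))))))).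
  rewrite hc hb ha hb hc; move: (h * x) => {}x.
  by do !rewrite !(aa, bb, cc, dd, ca, da, db, bab, dcd, cbcb, cbacba).
have hd x : h * (d * x) =
    a * (b * (c * (d * (c * (b * (a * (h * x))))))).
  by rewrite !hE aa bb cc dd.
have h3 x : h * (b * (a * (d * (c * (b * (c * (d * (a * (b * x)))))))))
    = c * (b * (c * (h * x))).
  rewrite hb ha hd hc hb hc hd ha hb; move: (h * x) => {}x.
  by do !rewrite !(aa, bb, cc, dd, ca, da, db, bab, dcd, cbcb, cbacba).
have h5 x : h * (d * (c * (b * (a * (b * (c * (d * x))))))) = a * (h * x).
  by rewrite !hE dd cc bb aa.
clearbody h.
have E x : h ^+ 6 * (a * x) = a * (h ^+ 6 * x).
  by rewrite !expgS expg0 mulg1 -!mulgA ha hb h2 h3 hc hb hc h5.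
have E' x : h ^+ 6 * (b * x) = b * (h ^+ 6 * x).
  by rewrite !expgS expg0 mulg1 -!mulgA hb h2 h3 hc hb hc h5 ha.
by split; [have := E 1 | have := E' 1]; rewrite !mulg1.
Qed.

Section Cell24.

Let t := string_gen [:: 3; 4; 3].

Definition cell24_gen (i : 'I_4) : string_coxeter [:: 3; 4; 3] :=
  cox_gen (@string_matrix [:: 3; 4; 3]) i.

Definition cell24_alpha : string_coxeter [:: 3; 4; 3] :=
  (t 0 * t 1 * t 2 * t 3) ^+ 6.

Lemma cell24_alpha_central g : commute cell24_alpha g.
Proof.
have t2 k : t k * t k = 1 by exact: cox_gen2.
have tM i j k : string_matrix (inord i : 'I_(size [:: 3; 4; 3]).+1) (inord j) = k ->
  (t i * t j) ^+ k = 1 by move=> <-; exact: cox_genM.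
have mE i j : (i < 4)%N -> (j < 4)%N ->
    string_matrix (inord i : 'I_(size [:: 3; 4; 3]).+1) (inord j) =
    if j == i then 1%N else if j == i.+1 then nth 0%N [:: 3; 4; 3] i
    else if i == j.+1 then nth 0%N [:: 3; 4; 3] j else 2%N.
  by move=> i4 j4; rewrite /string_matrix -val_eqE /= !inordK.
have [c0 c1] : commute cell24_alpha (t 0) /\ commute cell24_alpha (t 1).
  by apply: F4_coxeter_element; rewrite ?t2 //; apply: tM; rewrite mE.
have tV k : t k = (t k)^-1 by apply: (mulgI (t k)); rewrite mulgV t2.
have [c3 c2] : commute cell24_alpha (t 3) /\ commute cell24_alpha (t 2).
  suff: commute cell24_alpha^-1 (t 3) /\ commute cell24_alpha^-1 (t 2).
    move=> [e e']; rewrite -[cell24_alpha]invgK.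
    by split; apply/commute_sym/commuteV/commute_sym.
  have -> : cell24_alpha^-1 = (t 3 * t 2 * t 1 * t 0) ^+ 6.
    by rewrite -expVgn !invgM -!tV !mulgA.
  by apply: F4_coxeter_element; rewrite ?t2 //; apply: tM; rewrite mE.
elim/cox_ind: g => [|i x IH]; first exact: commute1.
apply: commuteM IH.
have -> : cox_gen (@string_matrix [:: 3; 4; 3]) i = t i.
  by rewrite /t /string_gen inord_val.
by case: i => -[|[|[|[|]]]].
Qed.

End Cell24.

(* The regular 4-polytope {4,3,4}_(4,0,0), given by its distinguished
   generators [rho]. *)
Definition is_cubic_toroid_400 (G : groupType) (rho : 'I_4 -> G) :=
  let r := string_gen [:: 4; 3; 4] in
  string_C_group rho /\
  @is_quotient_by [:: 4; 3; 4]
    [set (r 0%N * r 1%N * r 2%N * r 3%N * r 2%N * r 1%N) ^+ 4] G rho.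

(* D_s^12, for s >= 2; the library indexes dihedral groups by their order. *)
Definition dihedral_power12 (s : nat) : groupType :=
  {ffun 'I_12 -> 'D_(s.*2)%type}.

(* The group G(2^{{3,4,3},G(s)}) = W >< [3,4,3], its generators, and W. *)
Definition cell24_cubic_group (s : nat) : groupType :=
  cubic_group cell24_gen cell24_alpha_central s.

Definition cell24_cubic_gen (s : nat) : 'I_5 -> cell24_cubic_group s :=
  cubic_gen cell24_gen cell24_alpha_central s.

Definition cell24_W (s : nat) : groupType :=
  vertex_coxeter cell24_gen cell24_alpha s.

(* Main.v *)
From HB Require Import structures.
From Stdlib Require Import NArith Lia.
From mathcomp Require Import all_boot all_fingroup all_solvable ssralg ssrint ring.
From mathcomp Require Import all_classical.
Require Import Defs.

Set Implicit Arguments.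
Unset Strict Implicit.
Unset Printing Implicit Defensive.

Local Open Scope classical_set_scope.
Local Open Scope card_scope.
Local Open Scope group_scope.

(** Let [T] be the Coxeter group [3,4,3] of the 24-cell and [W] the Coxeter group with
    one generator [sigma F] for each of the 24 vertices, so that the group in question
    is the semidirect product [G] of [W] by [T].

    In the diagram of [W] only opposite vertices are joined. Hence [W] is a direct
    product of twelve dihedral groups ([matching_iso]), and the subgroup generated by
    the vertices in a set [S] consists of the elements whose support, read off from
    their dihedral components, lies in [S] ([generated_supp]).

    What is needed about [T] comes from its reflection representation. A rewriting
    system whose rules follow from the braid relations brings every word to one of
    1152 irreducible words ([normal_form]), and a finite check on these words shows
    that each of them moves every fundamental weight whose index occurs in it
    ([normal_moves]). So the representation is faithful, and the parabolic subgroups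
    are the pointwise stabilizers of sets of fundamental weights ([parabolic_stab]);
    the intersection property of [T] is then evident. In the same way the vertices of
    a face of the 24-cell are cut out by coordinates, whence the vertex sets of two
    faces of the base flag meet in the vertex set of such a face ([face_verticesI]). The order 1152
    follows because the irreducible words can be recovered from their images of a
    regular vector ([decode_normal]).

    A parabolic subgroup of [G] is the semidirect product of a parabolic subgroup of
    [T] and, if it contains [rho 0], of the subgroup of [W] generated by the vertices
    of a face ([cubic_parabolic]). The facts above about [T], about supports and about
    vertex sets thus give the intersection property of [G] ([cubic_C_group]).

    Every string C-group is the automorphism group of the regular polytope formed by
    the cosets of its maximal parabolic subgroups ([face_regular],
    [face_automorphismP]). The stabilizer of a face is the product of two commuting
    subgroups, one fixing all faces below it and one fixing all faces above it; so
    flags can be recombined at a common face ([gface_glue]), every chain lies in a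
    flag [gflag g], and the group acts simply transitively on flags.

    For the presentation, a homomorphism from [G] to a group [Q] is the same as a
    homomorphism [k] from [T] and an involution [q0] of [Q] that commutes with the
    image of the vertex stabilizer and satisfies the relations between [q0] and its
    conjugates [q0 ^ k g] ([twist]). The relation for [g] depends only on the double
    coset of [g] by the vertex stabilizer ([twist_double_coset]). There are five
    double cosets, represented by the identity, by [tau 0] and by the powers 3, 4 and
    6 of the Coxeter element; the second relation is [(rho 0 * rho 1) ^+ 4 = 1], and
    the last three are the given relators. With [Q] the quotient of [4,3,4,3] by a
    normal subgroup that contains the relators, this bounds the kernel
    ([cubic_quotient], [quotient_by_cover]).

    Finally, no two vertices of an octahedral facet of the 24-cell are opposite.
    Therefore the subgroup generated by [rho 0], ..., [rho 3] is isomorphic to the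
    group of the same construction for the octahedron in which all the generators
    [sigma F] commute ([facet_hom_inj]). Now there are three double cosets, and if [w]
    is the involution [rho 1 * rho 2 * rho 3 * rho 2 * rho 1], which represents the
    last one, then [(rho 0 * rho 0 ^ w) ^+ 2] is the relator [(rho 0 * w) ^+ 4] of the
    toroid ([octa_presentation]). *)

(** * Bijections and homomorphisms *)

Lemma inj_surj_bij (A B : Type) (f : A -> B) :
  injective f -> (forall y, exists x, f x = y) -> bijective f.
Proof.
move=> fI fS; pose g y := projT1 (cid (fS y)).
have gK : cancel g f by move=> y; exact: (projT2 (cid (fS y))).
by exists g => // x; apply: fI; rewrite gK.
Qed.

Lemma nth_bij (A : eqType) (B : Type) (f : A -> B) (s : seq A) N x0 :
  uniq s -> size s = N -> {in s &, injective f} ->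
  (forall y, exists2 x, x \in s & f x = y) ->
  bijective (fun k : 'I_N => f (nth x0 s k)).
Proof.
move=> us sN fI fS; apply: inj_surj_bij => [k l e|y]; last first.
  have [x xs <-] := fS y; have kN : (index x s < N)%N by rewrite -sN index_mem.
  by exists (Ordinal kN); rewrite nth_index.
have lt_s (i : 'I_N) : (i < size s)%N by rewrite sN.
apply/val_inj/eqP; rewrite /= -(nth_uniq x0 (lt_s k) (lt_s l) us).
by apply/eqP; apply: fI e; exact: mem_nth.
Qed.

Lemma card_bij_fin (A : Type) (F : finType) (f : F -> A) :
  bijective f -> [set: A] #= `I_#|F|.
Proof.
move=> [g fK gK].
have -> : [set: A] = (f \o enum_val) @` [set: 'I_#|F|].
  by apply/seteqP; split=> // x _; exists (enum_rank (g x)) => //=; rewrite enum_rankK.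
apply: (@card_eq_trans _ 'I_#|F| _ _ setT); last by rewrite card_eq_sym; exact: card_II.
apply: inj_card_eq => i j _ _ /= /(can_inj fK); exact: enum_val_inj.
Qed.

(** A multiplicative map between groups preserves the unit, hence inherits the
    theory of monoid morphisms. *)
Section Homs.
Variables (G H : groupType) (f : {multiplicative G -> H}).

Lemma hom1 : f 1 = 1.
Proof. by apply: (mulgI (f 1)); rewrite -gmulfM !mulg1. Qed.

Definition umagma_hom : UMagmaMorphism.type G H :=
  HB.pack (Multiplicative.sort f)
    (Multiplicative_isUMagmaMorphism.Build _ _ (Multiplicative.sort f) hom1).

Lemma homV : {morph f : x / x^-1}. Proof. exact: (gmulfV umagma_hom). Qed.

Lemma homX k : {morph f : x / x ^+ k}. Proof. exact: (gmulfXn umagma_hom). Qed.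

Lemma homJ : {morph f : x y / x ^ y}. Proof. exact: (gmulfJ umagma_hom). Qed.

Lemma hom_prod I r (E : I -> G) :
  f (\prod_(i <- r) E i) = \prod_(i <- r) f (E i).
Proof. exact: (gmulf_prod umagma_hom). Qed.

Lemma hom_inj : (forall x, f x = 1 -> x = 1) -> injective f.
Proof. exact: (gmulf_inj (f := umagma_hom)). Qed.

End Homs.

Section Involutions.
Variable G : groupType.
Implicit Types x y z : G.

Lemma involV x : x * x = 1 -> x^-1 = x.
Proof. by move=> x2; apply: (mulgI x); rewrite mulgV x2. Qed.

Lemma involJ x y : x * x = 1 -> (x ^ y) * (x ^ y) = 1.
Proof. by move=> x2; rewrite -conjMg x2 conj1g. Qed.

Lemma commute_invol x y : x * x = 1 -> y * y = 1 ->
  (x * y) ^+ 2 = 1 <-> commute x y.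
Proof.
move=> x2 y2; rewrite /commute; split=> [e|e].
  by rewrite -[LHS](involV (x := x * y)) ?invgM ?(involV x2) ?(involV y2).
by rewrite expg2 {2}e mulgA -(mulgA x) y2 mulg1.
Qed.

Lemma has_order2 x : x <> 1 -> x * x = 1 -> has_order x 2.
Proof. by move=> x1 x2; split=> // -[|[|k]] //; rewrite expg1. Qed.

Lemma has_order_morph (H : groupType) (f : {multiplicative G -> H}) x p :
  injective f -> has_order x p -> has_order (f x) p.
Proof.
move=> fI [p0 xp xk]; split=> // [|k kp]; first by rewrite -homX xp hom1.
by rewrite -homX -(hom1 f) => /fI; exact: xk.
Qed.

End Involutions.

(** * Generated and parabolic subgroups *)

Section Generated.
Variable G : groupType.
Implicit Types S H : set G.

Lemma subgroupM H x y : subgroup H -> H x -> H y -> H (x * y).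
Proof.
move=> [H1 HM] Hx Hy; rewrite -[y]invgK; apply: (HM _ _) => //.
by rewrite -[y^-1]mul1g; exact: HM.
Qed.

Lemma subgroupV H x : subgroup H -> H x -> H x^-1.
Proof. by move=> [H1 HM] Hx; rewrite -[x^-1]mul1g; exact: HM. Qed.

Lemma generated_subgroup S : subgroup (generated S).
Proof.
split=> [H [[] //]|x y Hx Hy H [sH SH]].
by apply: subgroupM => //; [exact: Hx | apply: subgroupV => //; exact: Hy].
Qed.

Lemma sub_generated S : S `<=` generated S.
Proof. exact: sub_smallest. Qed.

Lemma generated_sub S H : subgroup H -> S `<=` H -> generated S `<=` H.
Proof. by move=> sH SH x; apply; split. Qed.

End Generated.

Section Parabolic.
Variables (n : nat) (G : groupType) (rho : 'I_n -> G).
Implicit Types J K : set 'I_n.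

Lemma parabolic_subgroup J : subgroup (parabolic rho J).
Proof. exact: generated_subgroup. Qed.

Lemma parabolic1 J : parabolic rho J 1.
Proof. by case: (parabolic_subgroup J). Qed.

Lemma parabolicM J x y :
  parabolic rho J x -> parabolic rho J y -> parabolic rho J (x * y).
Proof. by apply: subgroupM; exact: parabolic_subgroup. Qed.

Lemma parabolicV J x : parabolic rho J x -> parabolic rho J x^-1.
Proof. by apply: subgroupV; exact: parabolic_subgroup. Qed.

Lemma parabolic_gen J i : J i -> parabolic rho J (rho i).
Proof. by move=> Ji; apply: sub_generated; exists i. Qed.

Lemma parabolic_sub J (H : set G) :
  subgroup H -> (forall i, J i -> H (rho i)) -> parabolic rho J `<=` H.
Proof. by move=> sH JH; apply: generated_sub => // _ [i Ji <-]; exact: JH. Qed.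

Lemma parabolicS J K : J `<=` K -> parabolic rho J `<=` parabolic rho K.
Proof.
move=> JK; apply: parabolic_sub => [|i /JK]; first exact: parabolic_subgroup.
exact: parabolic_gen.
Qed.

Hypothesis rho2 : forall i, rho i * rho i = 1.

Lemma parabolicP J x : parabolic rho J x <->
  exists2 u : seq 'I_n, (forall i, i \in u -> J i) & x = \prod_(i <- u) rho i.
Proof.
split=> [|[u Ju ->]]; last first.
  elim: u Ju => [|i u IH] Ju; rewrite ?big_nil ?big_cons; first exact: parabolic1.
  apply: parabolicM; first by apply: parabolic_gen; apply: Ju; exact: mem_head.
  by apply: IH => j ju; apply: Ju; rewrite in_cons ju orbT.
move: x; apply: parabolic_sub => [|i Ji]; last first.
  by exists [:: i] => [j|]; rewrite ?big_seq1 ?inE => // /eqP->.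
split=> [|_ _ [u Ju ->] [v Jv ->]]; first by exists [::]; rewrite ?big_nil.
exists (u ++ rev v) => [i|].
  by rewrite mem_cat mem_rev => /orP[]; [exact: Ju | exact: Jv].
rewrite big_cat /=; congr (_ * _); elim: v {Jv} => [|i v IH].
  by rewrite big_nil invg1.
by rewrite big_cons rev_cons -cats1 big_cat big_seq1 invgM IH involV.
Qed.

Lemma parabolic_ind J (P : G -> Prop) : P 1 ->
  (forall i x, J i -> parabolic rho J x -> P x -> P (rho i * x)) ->
  forall x, parabolic rho J x -> P x.
Proof.
move=> P1 PM x /parabolicP[u Ju ->]; elim: u Ju => [|i u IH] Ju.
  by rewrite big_nil.
have Ju' j : j \in u -> J j by move=> ju; apply: Ju; rewrite in_cons ju orbT.
rewrite big_cons; apply: PM; [| |exact: IH]; first by apply: Ju; exact: mem_head.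
by apply/parabolicP; exists u.
Qed.

Lemma parabolic0 x : parabolic rho set0 x <-> x = 1.
Proof.
split=> [|->]; last exact: parabolic1.
by move: x; apply: parabolic_ind.
Qed.

End Parabolic.

Lemma parabolic_comp m n (G : groupType) (rho : 'I_n -> G) (e : 'I_m -> 'I_n) J :
  parabolic (rho \o e) J = parabolic rho (e @` J).
Proof. by rewrite /parabolic image_comp. Qed.

Lemma string_C_group_widen m n (le_mn : (m <= n)%N) (G : groupType)
    (rho : 'I_n -> G) :
  string_C_group rho -> string_C_group (rho \o widen_ord le_mn).
Proof.
case=> ord comm int; split=> [i|i j ij|J K]; [exact: ord | exact: comm |].
rewrite (parabolic_comp rho _ J) (parabolic_comp rho _ K) int.
rewrite (parabolic_comp rho); congr parabolic; apply/seteqP; split=> i /=.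
  move=> [[j Jj <-] [k Kk kj]]; exists j => //; split=> //.
  by have <- : k = j by apply/val_inj; exact: (congr1 val kj).
by move=> [j [Jj Kj] <-]; split; exists j.
Qed.

(** * Homomorphisms from Coxeter groups *)

Section CoxeterLift.
Variables (I : choiceType) (m : I -> I -> nat) (Q : groupType) (q : I -> Q).
Hypothesis q2 : forall i, q i * q i = 1.
Hypothesis qM : forall i j, (q i * q j) ^+ m i j = 1.

Definition cox_lift_fun (x : coxeter m) : Q :=
  \prod_(i <- generic_quotient.repr x) q i.

Lemma cox_lift_word u : cox_lift_fun (cox_word m u) = \prod_(i <- u) q i.
Proof.
rewrite /cox_lift_fun.
have /cox_wordP : cox_word m (generic_quotient.repr (cox_word m u)) = cox_word m u.
  exact: cox_word_repr.
move: (generic_quotient.repr _) => v uv.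
elim: uv => {u v} [//|u v _ -> //|u v w _ -> _ -> //|u v u' v' _ IH _ IH'|i|i j].
- by rewrite !big_cat IH IH'.
- by rewrite big_cons big_seq1 big_nil.
rewrite big_nil -[RHS](qM i j); elim: (m i j) => [|k IH]; first by rewrite big_nil.
by rewrite /= !big_cons IH expgS mulgA.
Qed.

Lemma cox_lift_mul : {morph cox_lift_fun : x y / x * y}.
Proof.
move=> x y; rewrite -(cox_word_repr x) -(cox_word_repr y) -cox_wordM.
by rewrite !cox_lift_word big_cat.
Qed.

HB.instance Definition _ :=
  isMultiplicative.Build (coxeter m) Q cox_lift_fun cox_lift_mul.

Definition cox_lift : {multiplicative coxeter m -> Q} := cox_lift_fun.

Lemma cox_lift_gen i : cox_lift (cox_gen m i) = q i.
Proof. by rewrite /= cox_lift_word big_seq1. Qed.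

End CoxeterLift.

Lemma cox_hom_eq (I : choiceType) (m : I -> I -> nat) (Q : groupType)
    (f g : {multiplicative coxeter m -> Q}) :
  (forall i, f (cox_gen m i) = g (cox_gen m i)) -> f =1 g.
Proof.
move=> fg; elim/cox_ind=> [|i x IH]; first by rewrite !hom1.
by rewrite !gmulfM IH fg.
Qed.

Section CoxeterAction.
Variables (I : choiceType) (m : I -> I -> nat) (X : Type) (f : X -> I -> X).
Hypothesis f2 : forall x i, f (f x i) i = x.
Hypothesis fM : forall i j x, iter (m i j) (fun y => f (f y i) j) x = x.

Definition cox_act (x : X) (g : coxeter m) : X :=
  foldl f x (generic_quotient.repr g).

Lemma cox_act_word x u : cox_act x (cox_word m u) = foldl f x u.
Proof.
rewrite /cox_act.
have /cox_wordP : cox_word m (generic_quotient.repr (cox_word m u)) = cox_word m u.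
  exact: cox_word_repr.
move: (generic_quotient.repr _) => v uv; elim: uv x => {u v}
  [//|u v _ IH|u v w _ IH _ IH'|u v u' v' _ IH _ IH'|i|i j] x.
- by rewrite IH.
- by rewrite IH IH'.
- by rewrite !foldl_cat IH IH'.
- by rewrite /= f2.
rewrite /= -[RHS](fM i j); elim: (m i j) x => [//|k IH] x.
by rewrite iterSr -IH.
Qed.

Lemma cox_act1 x : cox_act x 1 = x.
Proof. exact: (cox_act_word x [::]). Qed.

Lemma cox_actM x g h : cox_act x (g * h) = cox_act (cox_act x g) h.
Proof.
rewrite -(cox_word_repr g) -(cox_word_repr h) -cox_wordM !cox_act_word.
by rewrite foldl_cat.
Qed.

Lemma cox_act_gen x i : cox_act x (cox_gen m i) = f x i.
Proof. exact: (cox_act_word x [:: i]). Qed.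

End CoxeterAction.

(** * Quotient groups *)

Section Quotient.
Local Open Scope quotient_scope.
Variables (G : groupType) (N : set G).
Hypothesis nN : normal_subgroup N.

Let sN : subgroup N := nN.1.

Let N1 : N 1. Proof. by case: sN. Qed.

Definition quo_rel (x y : G) : bool := `[< N (x * y^-1) >].

Let quo_refl : reflexive quo_rel.
Proof. by move=> x; apply/asboolP; rewrite mulgV. Qed.

Let quo_sym : symmetric quo_rel.
Proof.
by move=> x y; apply/asboolP/asboolP=> /(subgroupV sN); rewrite invgM invgK.
Qed.

Let quo_trans : transitive quo_rel.
Proof.
move=> y x z /asboolP xy /asboolP yz; apply/asboolP.
by have := subgroupM sN xy yz; rewrite mulgA mulgVK.
Qed.

Canonical quo_equiv := EquivRel quo_rel quo_refl quo_sym quo_trans.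

Definition quo := {eq_quot quo_rel}.

HB.instance Definition _ := Choice.on quo.
HB.instance Definition _ := EqQuotient.on quo.

Definition quo_pi_fun (x : G) : quo := \pi_quo x.

Lemma quo_pi_eq x y : quo_pi_fun x = quo_pi_fun y <-> N (x * y^-1).
Proof.
by split=> [/eqP|xy]; [rewrite /quo_pi_fun eqmodE => /asboolP|];
  last by apply/eqP; rewrite /quo_pi_fun eqmodE; apply/asboolP.
Qed.

Lemma quo_pi_repr (x : quo) : quo_pi_fun (generic_quotient.repr x) = x.
Proof. exact: reprK. Qed.

Definition quo_mul (x y : quo) : quo :=
  quo_pi_fun (generic_quotient.repr x * generic_quotient.repr y).
Definition quo_inv (x : quo) : quo := quo_pi_fun (generic_quotient.repr x)^-1.

Lemma quo_pi_mul x y : quo_mul (quo_pi_fun x) (quo_pi_fun y) = quo_pi_fun (x * y).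
Proof.
have /quo_pi_eq Nx := quo_pi_repr (quo_pi_fun x).
have /quo_pi_eq Ny := quo_pi_repr (quo_pi_fun y).
apply/quo_pi_eq; set x' := _ (quo_pi_fun x) in Nx *; set y' := _ (quo_pi_fun y) in Ny *.
have -> : x' * y' * (x * y)^-1 = (x' * x^-1) * (y' * y^-1) ^ x^-1.
  by rewrite conjgE invgM invgK !mulgA mulgVK.
by apply: subgroupM => //; exact: nN.2.
Qed.

Lemma quo_pi_inv x : quo_inv (quo_pi_fun x) = quo_pi_fun x^-1.
Proof.
have /quo_pi_eq Nx := quo_pi_repr (quo_pi_fun x).
apply/quo_pi_eq; rewrite invgK; set x' := _ (quo_pi_fun x) in Nx *.
have -> : x'^-1 * x = ((x' * x^-1)^-1) ^ x.
  by rewrite conjgE invgM invgK mulgA mulKg.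
by apply: nN.2; exact: subgroupV.
Qed.

Let quo_mulA : associative quo_mul.
Proof.
move=> x y z; rewrite -(quo_pi_repr x) -(quo_pi_repr y) -(quo_pi_repr z).
by rewrite !quo_pi_mul mulgA.
Qed.

Let quo_mul1 : left_id (quo_pi_fun 1) quo_mul.
Proof. by move=> x; rewrite -(quo_pi_repr x) quo_pi_mul mul1g. Qed.

Let quo_1mul : right_id (quo_pi_fun 1) quo_mul.
Proof. by move=> x; rewrite -(quo_pi_repr x) quo_pi_mul mulg1. Qed.

Let quo_mulV : left_inverse (quo_pi_fun 1) quo_inv quo_mul.
Proof. by move=> x; rewrite -(quo_pi_repr x) quo_pi_inv quo_pi_mul mulVg. Qed.

Let quo_Vmul : right_inverse (quo_pi_fun 1) quo_inv quo_mul.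
Proof. by move=> x; rewrite -(quo_pi_repr x) quo_pi_inv quo_pi_mul mulgV. Qed.

HB.instance Definition _ := isGroup.Build quo
  quo_mulA quo_mul1 quo_1mul quo_mulV quo_Vmul.

HB.instance Definition _ := isMultiplicative.Build G quo quo_pi_fun
  (fun x y => esym (quo_pi_mul x y)).

Definition quo_pi : {multiplicative G -> quo} := quo_pi_fun.

Lemma quo_pi1 x : quo_pi x = 1 <-> N x.
Proof. by rewrite -[x in N x]mulg1 -[X in _ * X]invg1; exact: quo_pi_eq. Qed.

End Quotient.

Lemma kernel_normal (G H : groupType) (f : {multiplicative G -> H}) :
  normal_subgroup [set x | f x = 1].
Proof.
split; first split=> /= [|x y fx fy]; first exact: hom1.
  by rewrite gmulfM homV fx fy invg1 mulg1.
by move=> x g /= fx; rewrite homJ fx conj1g.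
Qed.

(** * Regular polytopes from string C-groups *)

Section Cosets.
Variables (G : groupType) (H : set G).
Hypothesis sH : subgroup H.

Lemma right_cosetP g x : right_coset H g x <-> H (x * g^-1).
Proof.
split=> [[h Hh <-]|Hx]; first by rewrite mulgK.
by exists (x * g^-1) => //; rewrite mulgVK.
Qed.

Lemma right_coset_eq g h : right_coset H g = right_coset H h <-> H (g * h^-1).
Proof.
split=> [e|gh].
  by apply/right_cosetP; rewrite -e; apply/right_cosetP; rewrite mulgV; case: sH.
apply/seteqP; split=> x /right_cosetP Hx; apply/right_cosetP.
  by have := subgroupM sH Hx gh; rewrite mulgA mulgVK.
by have := subgroupM sH Hx (subgroupV sH gh); rewrite invgM invgK mulgA mulgVK.
Qed.

Lemma right_coset1M g : right_coset (right_coset H 1) g = right_coset H g.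
Proof.
apply/seteqP; split=> x.
  by move=> [_ [h Hh <-] <-]; exists h; rewrite ?mulg1.
by move=> [h Hh <-]; exists h => //; exists h; rewrite ?mulg1.
Qed.

Lemma val_coset g :
  val (right_coset_mul (right_coset_base H) g) = right_coset H g.
Proof. exact: right_coset1M. Qed.

Lemma cosetP (A : right_cosets H) :
  exists g, A = right_coset_mul (right_coset_base H) g.
Proof.
case: A => A HA; case/set_mem: (HA) => g _ e; exists g.
by apply: val_inj; rewrite val_coset /= e.
Qed.

Lemma coset_eq g h :
  right_coset_mul (right_coset_base H) g = right_coset_mul (right_coset_base H) h
  <-> H (g * h^-1).
Proof.
rewrite -right_coset_eq -!val_coset; split=> [->//|].
exact: val_inj.
Qed.

Lemma coset_mulM (A : right_cosets H) g h :
  right_coset_mul A (g * h) = right_coset_mul (right_coset_mul A g) h.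
Proof.
have [k ->] := cosetP A; apply: val_inj => /=; rewrite !right_coset1M.
apply/seteqP; split=> x.
  by move=> [y Hy <-]; exists (y * g); [exists y | rewrite mulgA].
by move=> [_ [y Hy <-] <-]; exists y; rewrite // mulgA.
Qed.

End Cosets.

Section Polytope.
Variables (n : nat) (G : groupType) (rho : 'I_n -> G).
Hypothesis rhoC : string_C_group rho.
Hypothesis rhoT : parabolic rho setT = setT.

Let ord i : has_order (rho i) 2. Proof. by case: rhoC. Qed.

Let rho2 i : rho i * rho i = 1. Proof. by case: (ord i). Qed.

Let rhoI J K : parabolic rho J `&` parabolic rho K = parabolic rho (J `&` K).
Proof. by case: rhoC => _ _. Qed.

Let rhoCom (i j : 'I_n) : (i.+1 < j)%N || (j.+1 < i)%N -> commute (rho i) (rho j).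
Proof. by case: rhoC => _ c _ /c /commute_invol; apply. Qed.

(** When two sets of generators commute, their parabolic subgroups multiply to a
    parabolic subgroup; for a string diagram this applies on both sides of an
    omitted node, and it is the algebraic reason why faces can be glued. *)
Lemma parabolicU (J K : set 'I_n) x :
  (forall i j, J i -> K j -> commute (rho i) (rho j)) ->
  parabolic rho (J `|` K) x ->
  exists a b, [/\ parabolic rho J a, parabolic rho K b, x = a * b & commute a b].
Proof.
move=> JK.
have comm a b : parabolic rho J a -> parabolic rho K b -> commute a b.
  move=> Ja; move: b; apply: parabolic_ind => // [|j b Kj _ ab].
    exact: commute1.
  apply: commuteM => //; apply: commute_sym; move: a Ja {ab}.
  apply: parabolic_ind => // [|i a Ji _ ja]; first exact: commute1.
  by apply: commuteM => //; apply/commute_sym/JK.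
move: x; apply: parabolic_ind => // [|i _ [Ji|Ki] _ [a [b [Ja Kb -> _]]]].
- by exists 1, 1; split; rewrite ?mulg1 //; exact: parabolic1.
- exists (rho i * a), b; have Ja' := parabolicM (parabolic_gen (rho := rho) Ji) Ja.
  by split; rewrite ?mulgA //; exact: comm.
- exists a, (rho i * b); have Kb' := parabolicM (parabolic_gen (rho := rho) Ki) Kb.
  split=> //; last exact: comm.
  by rewrite !mulgA (comm _ _ Ja (parabolic_gen (rho := rho) Ki)).
Qed.

Local Notation stab := (face_stabilizer rho).
Local Notation le := (@face_le n G rho).
Local Notation lt F F' := (le F F' /\ F <> F').

Let stab_sub k : subgroup (stab k). Proof. exact: parabolic_subgroup. Qed.

(** Flags are labelled by group elements: [gface k g] is the face of rank [k - 1] of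
    the image under [g] of the base flag, and [gflag g] is that image. *)
Definition gface (k : 'I_n.+2) (g : G) : face rho :=
  Tagged (fun k => right_cosets (stab k))
    (right_coset_mul (right_coset_base (stab k)) g).

Definition gflag (g : G) : set (face rho) := range (gface^~ g).

Lemma gfaceP F : exists g, F = gface (tag F) g.
Proof. by case: F => k A; have [g ->] := cosetP A; exists g. Qed.

Lemma gface_eq k g h : gface k g = gface k h <-> stab k (g * h^-1).
Proof.
split=> [/(congr1 (fun F : face rho => val (tagged F)))|/(coset_eq (stab_sub k)) gh].
  by rewrite /= !right_coset1M => /right_coset_eq; apply.
by rewrite /gface gh.
Qed.

Lemma gface_tag k l g h : gface k g = gface l h -> k = l.
Proof. exact: (congr1 (@tag _ _)). Qed.

Lemma gface_leP k l g h : le (gface k g) (gface l h) <->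
  (k <= l)%N /\ exists x, gface k x = gface k g /\ gface l x = gface l h.
Proof.
rewrite /face_le !val_coset /=; split=> -[kl [x]].
  move=> [/right_cosetP xg /right_cosetP xh]; split=> //; exists x.
  by split; apply/gface_eq.
move=> [/gface_eq xg /gface_eq xh]; split=> //; exists x.
by split; apply/right_cosetP.
Qed.

Lemma gface_le (k l : 'I_n.+2) g : (k <= l)%N -> le (gface k g) (gface l g).
Proof. by move=> kl; apply/gface_leP; split=> //; exists g. Qed.

Lemma face_leP F F' : le F F' <->
  (tag F <= tag F')%N /\ exists x, F = gface (tag F) x /\ F' = gface (tag F') x.
Proof.
have [g eF] := gfaceP F; have [g' eF'] := gfaceP F'.
rewrite {1}eF {1}eF' gface_leP -eF -eF'.
by split=> -[kl [x [e e']]]; split=> //; exists x.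
Qed.

Lemma face_le_eq F F' : le F F' -> (tag F' <= tag F)%N -> F = F'.
Proof.
move=> /face_leP[FF' [x [e e']]] F'F.
have t : tag F = tag F' by apply/val_inj/eqP; rewrite eqn_leq FF' F'F.
by rewrite e e' t.
Qed.

Lemma face_lt_tag F F' : lt F F' -> (tag F < tag F')%N.
Proof.
move=> [FF' ne]; rewrite ltnNge; apply/negP => F'F.
by apply: ne; exact: face_le_eq.
Qed.

Lemma gface_lt (k l : 'I_n.+2) g : (k < l)%N -> lt (gface k g) (gface l g).
Proof.
move=> kl; split; first exact/gface_le/ltnW.
by move=> /gface_tag e; rewrite e ltnn in kl.
Qed.

Lemma lt_gface F F' g : F = gface (tag F) g -> F' = gface (tag F') g ->
  (tag F < tag F')%N -> lt F F'.
Proof. by move=> e e' t; rewrite e e'; exact: gface_lt. Qed.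

(** These are the improper faces, of ranks -1 and [n]. *)
Lemma gface_improper k g h : (k = ord0 \/ k = ord_max) -> gface k g = gface k h.
Proof.
move=> kE; apply/gface_eq.
suff -> : stab k = parabolic rho setT by rewrite rhoT.
congr parabolic; apply/seteqP; split=> // j _ /=.
by case: kE => -> //= [] e; have := ltn_ord j; rewrite e ltnn.
Qed.

(** Two flags with a common face can be cut there and recombined: the stabilizer
    of that face is the product of the subgroups fixing everything below it and
    everything above it. *)
Lemma gface_glue l g h : gface l g = gface l h -> exists z,
  (forall k : 'I_n.+2, (k <= l)%N -> gface k z = gface k g) /\
  (forall k : 'I_n.+2, (l <= k)%N -> gface k z = gface k h).
Proof.
move=> /esym /gface_eq.
have -> : stab l =
    parabolic rho ([set j | (j.+1 < l)%N] `|` [set j | (l < j.+1)%N]).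
  congr parabolic; apply/seteqP; split=> j /=.
    by move=> /eqP; rewrite neq_ltn => /orP.
  by move=> [] /[swap] ->; rewrite ltnn.
move=> /parabolicU[i j /= il lj|a [b [Aa Bb e ab]]].
  by apply: rhoCom; rewrite (leq_trans il (lj : (l <= j)%N)).
exists (b * g); split=> k kl; apply/gface_eq.
  rewrite mulgK; apply: parabolicS Bb => j /= lj jk.
  by rewrite jk ltnNge kl in lj.
have -> : b * g * h^-1 = a^-1.
  have -> : h = a * b * g by rewrite -e mulgVK.
  by rewrite !invgM !mulgA mulgK mulgV mul1g.
apply: parabolicV; apply: parabolicS Aa => j /= jl jk.
by rewrite jk ltnNge kl in jl.
Qed.

Lemma gface_chain3 F1 F2 F3 : le F1 F2 -> le F2 F3 ->
  exists g, [/\ F1 = gface (tag F1) g, F2 = gface (tag F2) g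
    & F3 = gface (tag F3) g].
Proof.
move=> /face_leP[t12 [x [e1 e2]]] /face_leP[t23 [y [e2' e3]]].
have [z [lo hi]] := gface_glue (etrans (esym e2) e2').
by exists z; split; [rewrite lo | rewrite lo | rewrite hi].
Qed.

Lemma face_le_trans F1 F2 F3 : le F1 F2 -> le F2 F3 -> le F1 F3.
Proof.
move=> l12 l23; have [g [-> _ ->]] := gface_chain3 l12 l23.
by apply: gface_le; exact: leq_trans l12.1 l23.1.
Qed.

(** A chain is built up rank by rank; at every step the flag constructed so far
    is glued, at the last face [gface l g] of the chain, to one through the next
    face. *)
Lemma chain_sub_gflag C : is_chain le C -> exists g, C `<=` gflag g.
Proof.
move=> chC.
suff /(_ n.+1) [g [l [_ CP _]]] m : exists g (l : 'I_n.+2), [/\ (l < m.+1)%N,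
    forall F, C F -> (tag F < m.+1)%N -> (tag F <= l)%N /\ F = gface (tag F) g
  & forall F, C F -> (l <= tag F)%N -> le (gface l g) F].
  exists g => F CF; have [_ eF] := CP F CF (ltn_ord _).
  by exists (tag F).
elim: m => [|m [g [l [lm CP Cl]]]].
  exists 1, ord0; split=> // F CF.
    rewrite ltnS leqn0 => /eqP F0; rewrite F0; split=> //.
    have F0' : tag F = ord0 by exact: val_inj.
    have [h eF] := gfaceP F; rewrite {1}eF.
    by apply: gface_improper; left.
  move=> _; have [h ->] := gfaceP F.
  rewrite (@gface_improper ord0 1 h); last by left.
  exact: gface_le.
have [[F [CF Fm]]|noF] := pselect (exists F, C F /\ tag F = m.+1 :> nat); last first.
  exists g, l; split=> // [|F CF]; first exact: ltnW.
  rewrite ltnS leq_eqVlt => /orP[/eqP Fm|]; last exact: CP.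
  by case: noF; exists F.
have lF : (l <= tag F)%N by rewrite Fm ltnW.
have /face_leP[_ [x [e eF]]] := Cl F CF lF.
have [z [lo hi]] := gface_glue e.
have FF' F' : C F' -> (tag F <= tag F')%N -> le F F'.
  move=> CF' t; have [//|F'F] := chC _ _ CF CF'.
  by rewrite (face_le_eq F'F t); apply/face_leP; split=> //; have [h] := gfaceP F; exists h.
exists z, (tag F); rewrite Fm; split=> // F' CF'; last first.
  by move=> FF; rewrite (hi _ lF) -eF; apply: FF' => //; rewrite Fm.
rewrite ltnS => F'm; split=> //; case: (ltnP (tag F') m.+1) => [F'm'|mF'].
  by have [F'l eF'] := CP _ CF' F'm'; rewrite lo.
have <- : F = F' by apply: face_le_eq; rewrite ?Fm //; apply: FF'; rewrite ?Fm.
by rewrite hi.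
Qed.

Lemma gflag_chain g : is_chain le (gflag g).
Proof.
move=> _ _ [k _ <-] [l _ <-].
by case/orP: (leq_total k l) => kl; [left | right]; exact: gface_le.
Qed.

Lemma gflagP C : is_flag le C <-> exists g, C = gflag g.
Proof.
split=> [[chC maxC]|[g ->]].
  by have [g Cg] := chain_sub_gflag chC; exists g; rewrite (maxC _ (@gflag_chain g)).
split=> [|D chD gD]; first exact: gflag_chain.
have [h Dh] := chain_sub_gflag chD.
apply/seteqP; split=> // F /Dh[k _ <-].
have [l _ e] : gflag h (gface k g) by apply/Dh/gD; exists k.
by exists k => //; rewrite -e (gface_tag e).
Qed.

Lemma gflag_card g : gflag g #= `I_n.+2.
Proof.
apply: (@card_eq_trans _ 'I_n.+2 _ _ setT); last by rewrite card_eq_sym; exact: card_II.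
by apply: inj_card_eq => k l _ _; exact: gface_tag.
Qed.

Lemma gface_rho (k : 'I_n.+2) (m : 'I_n) g :
  m.+1 <> k -> gface k (rho m * g) = gface k g.
Proof. by move=> mk; apply/gface_eq; rewrite mulgK; exact: parabolic_gen. Qed.

Lemma gface_rho_neq (k : 'I_n.+2) (m : 'I_n) g :
  m.+1 = k -> gface k (rho m * g) <> gface k g.
Proof.
move=> mk /gface_eq; rewrite mulgK => Hm.
have : (stab k `&` parabolic rho [set m]) (rho m).
  by split=> //; exact: parabolic_gen.
rewrite rhoI (_ : _ `&` _ = set0).
  by move/(parabolic0 rho2); case: (ord m) => _ _ /(_ 1%N isT).
by apply/seteqP; split=> // j /= [jk jm]; apply: jk; rewrite jm.
Qed.

(** By the intersection property, the joint stabilizer of the faces of ranks [m - 1]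
    and [m + 1] of a flag is generated by [rho m] and by a subgroup that commutes with
    [rho m] and fixes the face between them. *)
Lemma gface_between (m : 'I_n) (i j l : 'I_n.+2) g h :
  i = m :> nat -> j = m.+1 :> nat -> l = m.+2 :> nat ->
  lt (gface i g) h -> lt h (gface l g) ->
  h = gface j g \/ h = gface j (rho m * g).
Proof.
move=> im jm lm ih hl; have [z [/= ei eh el]] := gface_chain3 ih.1 hl.1.
have hj : tag h = j.
  apply/val_inj/eqP; have := face_lt_tag ih; have := face_lt_tag hl.
  by rewrite /= im jm lm eqn_leq ltnS => -> ->.
rewrite eh hj; have : (stab i `&` stab l) (z * g^-1).
  by split; apply/gface_eq.
rewrite rhoI; set J := _ `&` _.
have sub : J `<=` [set m] `|` [set j' : 'I_n | (j'.+1 < m)%N \/ (m.+1 < j')%N].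
  move=> j' /= [j'i j'l].
  case: (ltngtP j' m) => [jm'|mj'|/val_inj ->]; [right|right|by left].
    by left; rewrite ltn_neqAle jm' andbT; apply/eqP => e; apply: j'i; rewrite im.
  right; rewrite ltn_neqAle mj' andbT; apply/eqP => e; apply: j'l.
  by rewrite lm e.
move=> /(parabolicS sub) {J sub}.
move=> /parabolicU [_ k -> /= mk|a [b [Aa Bb e ab]]].
  by apply: rhoCom; case: mk => ->; rewrite ?orbT.
have {e} ez : z = b * (a * g) by rewrite mulgA -ab -e mulgVK.
have -> : gface j z = gface j (a * g).
  apply/gface_eq; rewrite ez mulgK; apply: parabolicS Bb => k /= + kj.
  by rewrite jm in kj; case: kj => ->; case; rewrite ltnNge leqnSn.
have [->|->] : a = 1 \/ a = rho m; [|by left; rewrite mul1g|by right].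
move: a Aa {ez ab}; apply: parabolic_ind => // [|_ a -> _ [->|->]]; first by left.
  by right; rewrite mulg1.
by left; rewrite rho2.
Qed.

Lemma covers_tag F F' : covers le F F' -> tag F' = (tag F).+1 :> nat.
Proof.
move=> [FF' between]; apply/eqP; rewrite eqn_leq (face_lt_tag FF') andbT leqNgt.
apply/negP => t; have /face_leP[_ [g [e e']]] := FF'.1.
have k_lt : ((tag F).+1 < n.+2)%N by exact: ltn_trans t (ltn_ord _).
apply: (between (gface (Ordinal k_lt) g)).
by split; apply: (@lt_gface _ _ g).
Qed.

Lemma face_diamond F1 F2 F3 : covers le F1 F2 -> covers le F2 F3 ->
  exists! F', [/\ F' <> F2, lt F1 F' & lt F' F3].
Proof.
move=> c12 c23; have [g [e1 e2 e3]] := gface_chain3 c12.1.1 c23.1.1.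
have t2 := covers_tag c12; have t3 := covers_tag c23.
have m_lt : (tag F1 < n)%N by have := ltn_ord (tag F3); rewrite t3 t2 !ltnS.
pose m := Ordinal m_lt; exists (gface (tag F2) (rho m * g)); split.
  have mv : m.+1 = tag F2 by rewrite t2.
  have e1' : F1 = gface (tag F1) (rho m * g).
    by rewrite gface_rho //= => /eqP; rewrite eqn_leq ltnn.
  have e3' : F3 = gface (tag F3) (rho m * g).
    by rewrite gface_rho //= t3 t2 => /eqP; rewrite eqn_leq ltnn andbF.
  split; first by rewrite {2}e2; exact: gface_rho_neq.
    by apply: (lt_gface e1' erefl); rewrite /= t2.
  by apply: (lt_gface erefl e3'); rewrite /= t3.
move=> F' [ne]; rewrite e1 e3 => l1 l3.
have [] := @gface_between m _ (tag F2) _ _ _ _ _ _ l1 l3; rewrite ?t3 ?t2 //.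
by rewrite -e2.
Qed.

Lemma stab_bigcap (A : set 'I_n.+2) x : (forall k, A k -> stab k x) ->
  parabolic rho [set m : 'I_n | forall k, A k -> m.+1 <> k] x.
Proof.
move=> Ax.
suff : forall s : seq 'I_n.+2,
    parabolic rho [set m : 'I_n | forall k, k \in s -> A k -> m.+1 <> k] x.
  move/(_ (enum 'I_n.+2)); apply: parabolicS => m /= + k Ak; apply => //.
  exact: mem_enum.
elim=> [|k s IH].
  by rewrite (_ : [set _ | _] = setT) ?rhoT //; apply/seteqP.
have [Ak|nAk] := pselect (A k); last first.
  apply: parabolicS IH => m /= IH k'; rewrite in_cons => /orP[/eqP-> //|].
  exact: IH.
have : (parabolic rho [set m : 'I_n | forall k, k \in s -> A k -> m.+1 <> k]
  `&` stab k) x by split=> //; exact: Ax.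
rewrite rhoI; apply: parabolicS => m /= [ms mk] k'.
by rewrite in_cons => /orP[/eqP-> _ //|]; exact: ms.
Qed.

Lemma gflag_adjacent m g : adjacent_flags (gflag g) (gflag (rho m * g)).
Proof.
have k_lt : (m.+1 < n.+2)%N by rewrite !ltnS ltnW.
pose k := Ordinal k_lt.
have fl l h h' : l <> k -> (h = g \/ h = rho m * g) -> (h' = g \/ h' = rho m * g) ->
    gface l h = gface l h'.
  move=> lk; have e : gface l (rho m * g) = gface l g.
    by apply: gface_rho => ml; apply: lk; apply: val_inj.
  by move=> [] -> [] ->.
have ne := @gface_rho_neq k m g erefl.
exists (gface k g), (gface k (rho m * g)).
split; apply/seteqP; split=> F /=.
- move=> [[l _ <-] nF]; have [->//|/eqP lk] := eqVneq l k.
  by case: nF; exists l => //; apply: fl; [|right|left].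
- move=> ->; split; first by exists k.
  by move=> [l _ e]; apply: ne; rewrite -e (gface_tag e).
- move=> [[l _ <-] nF]; have [->//|/eqP lk] := eqVneq l k.
  by case: nF; exists l => //; apply: fl; [|left|right].
- move=> ->; split; first by exists k.
  by move=> [l _ e]; apply: ne; rewrite -e (gface_tag e).
Qed.

(** The common faces of two flags have the labels of both as coset representatives, so
    the quotient of the labels lies in a parabolic subgroup that fixes these faces; a
    word for it in the generators is a path of adjacent flags. *)
Lemma gflag_connected g h : exists k (E : nat -> set (face rho)),
  [/\ E 0%N = gflag g, E k = gflag h,
      forall i, (i < k)%N -> adjacent_flags (E i) (E i.+1)
    & forall i, (i <= k)%N -> is_flag le (E i) /\ gflag g `&` gflag h `<=` E i].
Proof.
pose A := [set k | gface k h = gface k g].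
have : parabolic rho [set m : 'I_n | forall k, A k -> m.+1 <> k] (h * g^-1).
  by apply: stab_bigcap => k /gface_eq.
have -> : gflag h = gflag (h * g^-1 * g) by rewrite mulgVK.
suff P x : parabolic rho [set m : 'I_n | forall k, A k -> m.+1 <> k] x ->
    exists k (E : nat -> set (face rho)), [/\ E 0%N = gflag g, E k = gflag (x * g),
      forall i, (i < k)%N -> adjacent_flags (E i) (E i.+1)
    & forall i, (i <= k)%N -> exists y, E i = gflag y /\
        forall k, A k -> gface k y = gface k g].
  move=> /P[k [E [E0 Ek Eadj EA]]]; exists k, E; split=> // i /EA[y [-> yA]].
  split=> [|_ [[l _ <-] [l' _]]]; first by apply/gflagP; exists y.
  rewrite mulgVK => e; exists l => //; apply: yA.
  by rewrite /A /= -e (gface_tag e).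
move: x; apply: parabolic_ind => // [|m x mA _ [k [E [E0 Ek Eadj EA]]]].
  exists 0%N, (fun=> gflag g); split=> [//||//|i _]; first by rewrite mul1g.
  by exists g.
have [y [ey yA]] := EA k (leqnn k).
have Axg l : A l -> gface l (rho m * x * g) = gface l g.
  move=> Al; rewrite -mulgA gface_rho; last exact: mA.
  rewrite -(yA _ Al).
  have [l' _ e] : gflag y (gface l (x * g)) by rewrite -ey Ek; exists l.
  by rewrite -e (gface_tag e).
exists k.+1, (fun i => if (i <= k)%N then E i else gflag (rho m * x * g)).
split=> [||i|i].
- by rewrite leq0n.
- by rewrite ltnn.
- rewrite ltnS => ik; rewrite ik; case: (ltnP i k) => [/Eadj//|ki].
  have -> : i = k by apply/eqP; rewrite eqn_leq ik ki.
  by rewrite Ek -mulgA; exact: gflag_adjacent.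
- by case: (leqP i k) => [ik _|_ _]; [exact: EA | exists (rho m * x * g)].
Qed.

Lemma face_mul_gface k g h : face_mul (gface k g) h = gface k (g * h).
Proof. by rewrite /face_mul /gface /= coset_mulM. Qed.

Lemma face_mulK g : cancel (@face_mul n G rho ^~ g) (@face_mul n G rho ^~ g^-1).
Proof. by move=> F; have [h ->] := gfaceP F; rewrite !face_mul_gface mulgK. Qed.

Lemma face_mul_automorphism g : poset_automorphism le (@face_mul n G rho ^~ g).
Proof.
have mono h F F' : le F F' -> le (face_mul F h) (face_mul F' h).
  move=> /face_leP[t [x [-> ->]]]; rewrite !face_mul_gface /=.
  exact: gface_le.
split=> [|F F'].
  exists (@face_mul n G rho ^~ g^-1) => F; first exact: face_mulK.
  by have := face_mulK g^-1 F; rewrite invgK.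
by split=> [/(mono g^-1)|]; [rewrite !face_mulK | exact: mono].
Qed.

Lemma face_polytope : abstract_polytope le n.
Proof.
split.
- split=> [F|F F' FF' F'F|]; last exact: face_le_trans.
    by apply/face_leP; split=> //; have [g] := gfaceP F; exists g.
  by apply: face_le_eq => //; case: F'F.
- split; [exists (gface ord0 1) | exists (gface ord_max 1)] => F;
    have [g ->] := gfaceP F.
    by rewrite (@gface_improper _ _ g); [exact: gface_le | left].
  by rewrite (@gface_improper _ 1 g); [apply: gface_le; rewrite -ltnS | right].
- by move=> C /gflagP[g ->]; exact: gflag_card.
- exact: face_diamond.
- by move=> C D /gflagP[g ->] /gflagP[h ->]; exact: gflag_connected.
Qed.

Theorem face_regular : regular_polytope le n.
Proof.
split=> [|C D /gflagP[g ->] /gflagP[h ->]]; first exact: face_polytope.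
exists (@face_mul n G rho ^~ (g^-1 * h)); first exact: face_mul_automorphism.
have e k : face_mul (gface k g) (g^-1 * h) = gface k h.
  by rewrite face_mul_gface mulKVg.
apply/seteqP; split=> F; first by move=> [_ [k _ <-] <-]; exists k => //; rewrite e.
by move=> [k _ <-]; exists (gface k g) => //; exists k.
Qed.

(** An automorphism maps flags to flags and preserves their order, so this lemma
    shows that it preserves ranks. *)
Lemma ord_mono_id N (f : 'I_N -> 'I_N) :
  (forall i j : 'I_N, (i < j)%N -> (f i < f j)%N) -> f =1 id.
Proof.
move=> mono.
have ge : forall k (i : 'I_N), i = k :> nat -> (k <= f i)%N.
  elim=> [//|k IH] i ik; have kN : (k < N)%N by rewrite ltnW // -ik.
  by apply: leq_ltn_trans (IH (Ordinal kN) erefl) (mono _ _ _); rewrite ik /=.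
have le : forall k (i : 'I_N), (i + k).+1 = N -> (f i <= i)%N.
  elim=> [|k IH] i ik.
    by rewrite -ltnS; have := ltn_ord (f i); rewrite -[X in (_ < X)%N]ik addn0.
  have iN : (i.+1 < N)%N by rewrite (leq_trans _ (eq_leq ik)) // addnS !ltnS leq_addr.
  rewrite -ltnS; apply: leq_trans (mono i (Ordinal iN) _) (IH (Ordinal iN) _) => //=.
  by rewrite addSnnS.
move=> i; apply/val_inj/eqP; rewrite eqn_leq (ge i) // andbT.
by apply: (le (N - i.+1)%N); rewrite -addSn subnKC.
Qed.

Lemma automorphism_tag f : poset_automorphism le f -> forall F, tag (f F) = tag F.
Proof.
move=> [fB fle] F; have fI := bij_inj fB.
have [g ->] := gfaceP F; move: (tag F) => k.
apply: (ord_mono_id (f := fun k => tag (f (gface k g)))) => i j ij.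
have [l ne] := gface_lt g ij; apply: face_lt_tag; split; first exact/fle.
by move=> /fI.
Qed.

(** An automorphism fixing one flag fixes the adjacent flags, by the diamond
    property, hence by connectedness all of them. *)
Lemma automorphism_mul f : poset_automorphism le f ->
  exists g, forall F, f F = face_mul F g.
Proof.
move=> fA; have ftag := automorphism_tag fA; have [fB fle] := fA.
have fI := bij_inj fB.
have [h fh] : exists h, forall k, f (gface k 1) = gface k h.
  have [|h hC] := @chain_sub_gflag (f @` gflag 1).
    move=> _ _ [F CF <-] [F' CF' <-].
    by have [|] := gflag_chain CF CF'; [left | right]; apply/fle.
  exists h => k; have [l _ e] : gflag h (f (gface k 1)).
    by apply: hC; exists (gface k 1) => //; exists k.
  by rewrite -e; congr gface; rewrite -[k in RHS](ftag (gface k 1)) -e.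
suff P x : forall k, f (gface k x) = gface k (x * h).
  by exists h => F; have [x ->] := gfaceP F; rewrite P face_mul_gface.
have : parabolic rho setT x by rewrite rhoT.
move: x; apply: parabolic_ind => // [k|m x _ _ IH k]; first by rewrite mul1g.
rewrite -mulgA; have [mk|mk] := eqVneq m.+1 (k : nat); last first.
  by rewrite !gface_rho //; apply/eqP.
have i_lt : (m < n.+2)%N by rewrite ltnW // mk.
have l_lt : (m.+2 < n.+2)%N by rewrite !ltnS.
pose i := Ordinal i_lt; pose l := Ordinal l_lt.
have ei y : gface i (rho m * y) = gface i y.
  by apply: gface_rho => /= /eqP; rewrite eqn_leq ltnn.
have el y : gface l (rho m * y) = gface l y.
  by apply: gface_rho => /= /eqP; rewrite eqn_leq ltnn andbF.
have ik : (i < k)%N by rewrite -mk.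
have kl : (k < l)%N by rewrite -mk.
have [] := @gface_between m i k l (x * h) (f (gface k (rho m * x))).
- by [].
- by rewrite mk.
- by [].
- rewrite -IH -ei; have [lik ne] := gface_lt (rho m * x) ik.
  by split; [apply/fle | move/fI].
- rewrite -IH -el; have [lkl ne] := gface_lt (rho m * x) kl.
  by split; [apply/fle | move/fI].
- by rewrite -IH => /fI /gface_rho_neq; case.
- by [].
Qed.

Theorem face_automorphismP (f : face rho -> face rho) :
  poset_automorphism le f <-> exists! g : G, forall F, f F = face_mul F g.
Proof.
split=> [/automorphism_mul[g fg]|[g [fg _]]]; last first.
  have -> : f = @face_mul n G rho ^~ g by apply/funext.
  exact: face_mul_automorphism.
exists g; split=> // h fh.
suff : parabolic rho set0 (g * h^-1) by move/(parabolic0 rho2)/divg1_eq.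
have := @stab_bigcap setT (g * h^-1).
rewrite (_ : [set _ | _] = set0); first apply=> k _.
  apply/gface_eq; rewrite -[g]mul1g -[h]mul1g -!face_mul_gface.
  by rewrite -fg -fh.
apply/seteqP; split=> // m /=.
have k_lt : (m.+1 < n.+2)%N by rewrite !ltnS ltnW.
by move=> /(_ (Ordinal k_lt) I).
Qed.

End Polytope.

(** * Dihedral groups as Coxeter groups *)

Section Dihedral.
Variable s : nat.
Hypothesis s2 : (2 <= s)%N.

Definition dihedral_matrix (i j : bool) : nat := if j == i then 1%N else s.

Definition dihedral : groupType := coxeter dihedral_matrix.

Definition dih (b : bool) : dihedral := cox_gen dihedral_matrix b.

Lemma dih2 b : dih b * dih b = 1. Proof. exact: cox_gen2. Qed.

Let rot := dih false * dih true.

Let rot_s : rot ^+ s = 1. Proof. exact: (cox_genM dihedral_matrix false true). Qed.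

Let normal (k : 'I_s * bool) : dihedral := rot ^+ k.1 * dih false ^+ k.2.

Let s0 : (0 < s)%N. Proof. exact: ltnW. Qed.

Let rot_mod k : exists i : 'I_s, rot ^+ k = rot ^+ i.
Proof.
exists (Ordinal (ltn_pmod k s0)); rewrite /= {1}(divn_eq k s) expgnDr mulnC.
by rewrite expgnA rot_s expg1n mul1g.
Qed.

Let rotV : exists i : 'I_s, rot^-1 = rot ^+ i.
Proof.
have [i e] := rot_mod s.-1; exists i; rewrite -e; apply/mulg1_eq.
by rewrite -expgS prednK.
Qed.

Let dih_rot k : dih false * rot ^+ k = (rot^-1) ^+ k * dih false.
Proof.
elim: k => [|k IH]; first by rewrite !expg0 mulg1 mul1g.
rewrite expgSr mulgA IH expgSr -!mulgA; congr (_ * _).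
by rewrite /rot invgM !(involV (dih2 _)) mulgA dih2 mul1g -mulgA dih2 mulg1.
Qed.

(** Since each generator inverts the rotation, every element is a power of the rotation
    below [s], possibly followed by a reflection. *)
Lemma dihedral_normal d : exists k, d = normal k.
Proof.
have rotated k b : exists k', rot ^+ k * dih false ^+ (b : bool) = normal k'.
  by have [i ->] := rot_mod k; exists (i, b).
have flip k b : exists k', dih false * normal (k, b) = normal k'.
  have [j e] := rotV; rewrite /normal /= mulgA dih_rot e -expgnA -mulgA.
  case: b => /=; last by rewrite mulg1 -{1}[dih false]expg1; exact: (rotated _ true).
  by rewrite expg1 dih2; exact: (rotated _ false).
elim/cox_ind: d => [|b d [k ->]].
  by have [k e] := rotated 0%N false; exists k; rewrite -e mulg1.
case: b; last by case: k => k b; exact: flip.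
have -> : cox_gen dihedral_matrix true = dih false * rot.
  by rewrite /rot mulgA dih2 mul1g.
case: k => k b; rewrite -mulgA.
have -> : rot * normal (k, b) = rot ^+ k.+1 * dih false ^+ b.
  by rewrite /normal mulgA -expgS.
by have [[k' b'] ->] := rotated k.+1 b; exact: flip.
Qed.

(** The group ['D_(2s)] is generated by two involutions whose product has order [s], so
    it is an image of the Coxeter group. As it has as many elements as there are normal
    forms, the normal forms are distinct and the surjection is bijective. *)
Lemma dihedral_iso_exists :
  exists f : {multiplicative dihedral -> 'D_(s.*2)%type},
    bijective f /\ injective normal.
Proof.
have /isoGrp_hom/existsP[[u v] /= /eqP[uv u2 v2 uvs]] := Grp'_dihedral s2.
pose q b := if b then v else u.
have q2 b : q b * q b = 1 by case: b; rewrite /q -expg2.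
have qM b c : (q b * q c) ^+ dihedral_matrix b c = 1.
  case: b c => [] [] //=; rewrite /dihedral_matrix /= ?q2 ?expg1 ?q2 ?expg1n //.
    rewrite -[v in v * _](involV (q2 true)) -[u in _ * u](involV (q2 false)) -invgM.
    by rewrite expVgn uvs invg1.
pose f := cox_lift q2 qM.
have f_gen b : f (dih b) = q b by exact: cox_lift_gen.
have fS d : exists e, f e = d.
  have gH : group_set (finset (fun d => `[< exists e, f e = d >])).
    apply/group_setP; split; first by rewrite finset.in_set; apply/asboolP; exists 1; exact: hom1.
    move=> d1 d2; rewrite !finset.in_set => /asboolP e1 /asboolP e2.
    case: e1 e2 => e <- [e' <-].
    by apply/asboolP; exists (e * e'); exact: gmulfM.
  have : d \in <[u]> <*> <[v]> by rewrite uv finset.in_setT.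
  have /fintype.subsetP/[apply] : <[u]> <*> <[v]> \subset Group gH.
    rewrite join_subG !cycle_subG !finset.in_set; apply/andP; split; apply/asboolP.
      by exists (dih false); exact: f_gen.
    by exists (dih true); exact: f_gen.
  by rewrite finset.in_set => /asboolP.
have cardN : #|{: 'I_s * bool}| = #|{: 'D_(s.*2)}|.
  by rewrite card_prod card_ord card_bool -cardsT card_dihedral // muln2.
have fnI : injective (f \o normal).
  have : {in predT &, injective (f \o normal)}.
    apply/image_injP; rewrite cardN; apply/eqP/eq_card => d.
    have [e <-] := fS d; have [k ->] := dihedral_normal e.
    by rewrite finset.inE; apply/fintype.imageP; exists k.
  by move=> I k l; exact: I.
have fI : injective f.
  move=> d e; have [k ->] := dihedral_normal d; have [l ->] := dihedral_normal e.
  by move=> /fnI ->.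
exists f; split; first exact: inj_surj_bij fI fS.
by move=> k l e; apply: fnI; rewrite /= e.
Qed.

Lemma dih_neq1 b : dih b <> 1.
Proof.
have [_ [_ nI]] := dihedral_iso_exists.
have x1 : dih false <> 1.
  move=> e; have := @nI (Ordinal s0, true) (Ordinal s0, false).
  by rewrite /normal /= !expg0 expg1 e => /(_ erefl).
case: b => // y1; have := @nI (Ordinal s2, true) (Ordinal s0, false).
by rewrite /normal /rot /= y1 !expg1 mulg1 dih2 !expg0 mul1g => /(_ erefl).
Qed.

Lemma dih_neq : dih false <> dih true.
Proof.
move=> e; have [_ [_ nI]] := dihedral_iso_exists.
have := @nI (Ordinal s2, false) (Ordinal s0, false).
by rewrite /normal /rot /= e !expg0 !expg1 !mulg1 dih2 => /(_ erefl).
Qed.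

End Dihedral.

(** * Products of dihedral groups as Coxeter groups *)

Lemma prod_single (G : groupType) (T : eqType) (r : seq T) (F : T -> G) i :
  uniq r -> i \in r -> (forall k, k \in r -> k != i -> F k = 1) ->
  \prod_(k <- r) F k = F i.
Proof.
elim: r => [//|k r IH]; rewrite cons_uniq in_cons big_cons => /andP[kr ur] ikr Fk.
have Fr l : l \in r -> l != i -> F l = 1 by move=> lr; apply: Fk; rewrite in_cons lr orbT.
have [ik|ik] := eqVneq k i.
  rewrite ik in kr *; rewrite big1_seq ?mulg1 // => l /andP[_ lr].
  by apply: Fr => //; apply: contraNneq kr => <-.
rewrite Fk ?mem_head // mul1g IH //.
by move: ikr; rewrite eq_sym (negbTE ik).
Qed.

(** The Coxeter matrix is that of a matching: [i] is joined to [a i] only, by an edge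
    with label [s]. The involution [a] may have fixed points; these are isolated nodes,
    and contribute factors of order 2. *)
Section Matching.
Variables (I : choiceType) (a : I -> I) (s : nat) (m : I -> I -> nat).
Hypothesis aK : involutive a.
Hypothesis s2 : (2 <= s)%N.
Hypothesis mE : forall i j,
  m i j = if j == i then 1%N else if j == a i then s else 2%N.

Local Notation W := (coxeter m).
Local Notation sigma := (cox_gen m).
Local Notation D := (dihedral s).

(** The dihedral component at [i]: the nodes [i] and [a i] go to the two standard
    generators, in this order. *)
Definition proj_gen (i j : I) : D :=
  if j == i then dih s false else if j == a i then dih s true else 1.

Lemma proj_gen2 i j : proj_gen i j * proj_gen i j = 1.
Proof. by rewrite /proj_gen; do 2?case: ifP => _; rewrite ?dih2 ?mulg1. Qed.

Lemma proj_genM i j k : (proj_gen i j * proj_gen i k) ^+ m j k = 1.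
Proof.
have rot_s b : (dih s b * dih s (~~ b)) ^+ s = 1.
  by have := cox_genM (dihedral_matrix s) b (~~ b); case: b.
rewrite mE; case: (eqVneq k j) => [->|kj]; first by rewrite expg1 proj_gen2.
case: (eqVneq k (a j)) => [kaj|kaj]; rewrite /proj_gen.
  case: (eqVneq j i) => [ji|ji].
    by rewrite -ji (negbTE kj) kaj eqxx (rot_s false).
  case: (eqVneq j (a i)) => [jai|jai].
    by rewrite kaj jai aK eqxx (rot_s true).
  case: (eqVneq k i) => [ki|_].
    by case/eqP: jai; rewrite -ki kaj aK.
  case: (eqVneq k (a i)) => [kai|_]; last by rewrite mulg1 expg1n.
  by case/eqP: ji; rewrite -[i]aK -kai kaj aK.
case: (eqVneq j i) => [ji|ji].
  by rewrite -ji (negbTE kj) (negbTE kaj) mulg1 expg2 dih2.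
case: (eqVneq j (a i)) => [jai|jai]; last first.
  by rewrite mul1g expg2; have := proj_gen2 i k.
case: (eqVneq k i) => [ki|_]; first by case/eqP: kaj; rewrite jai aK ki.
by rewrite -jai (negbTE kj) mulg1 expg2 dih2.
Qed.

Definition proj (i : I) : {multiplicative W -> D} :=
  cox_lift (proj_gen2 i) (proj_genM i).

Lemma projE i j : proj i (sigma j) = proj_gen i j.
Proof. exact: cox_lift_gen. Qed.

Definition embed_gen (i : I) (b : bool) : W := if b then sigma (a i) else sigma i.

Lemma embed_gen2 i b : embed_gen i b * embed_gen i b = 1.
Proof. by case: b; exact: cox_gen2. Qed.

Lemma embed_genM i b c : (embed_gen i b * embed_gen i c) ^+ dihedral_matrix s b c = 1.
Proof.
have M j k : k = a j -> (sigma j * sigma k) ^+ s = 1.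
  move=> kj; have [->|ne] := eqVneq k j; first by rewrite cox_gen2 expg1n.
  by have := cox_genM m j k; rewrite mE (negbTE ne) kj eqxx.
by case: b c => [] []; rewrite ?expg1 ?cox_gen2 //=; apply: M; rewrite ?aK.
Qed.

Definition embed (i : I) : {multiplicative D -> W} :=
  cox_lift (embed_gen2 i) (embed_genM i).

Lemma embedE i b : embed i (dih s b) = embed_gen i b.
Proof. exact: cox_lift_gen. Qed.

Lemma sigma_commute i j : j != a i -> commute (sigma i) (sigma j).
Proof.
have [->|ji] := eqVneq j i; first by [].
move=> jai; have := cox_genM m i j; rewrite mE (negbTE ji) (negbTE jai).
by move/commute_invol; apply; exact: cox_gen2.
Qed.

Lemma embed_commute i j d e : j != i -> j != a i -> commute (embed i d) (embed j e).
Proof.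
move=> ji jai; have aji : a j != i by rewrite (inv_eq aK).
have ajai : a j != a i by rewrite (inj_eq (inv_inj aK)).
elim/cox_ind: d => [|b d IH]; first by rewrite hom1; exact/commute_sym/commute1.
rewrite gmulfM embedE; apply/commute_sym/commuteM; last exact: commute_sym.
apply/commute_sym; elim/cox_ind: e {IH} => [|c e IH]; first by rewrite hom1; exact: commute1.
rewrite gmulfM embedE; apply: commuteM IH.
by case: b c => [] []; apply: sigma_commute; rewrite ?aK.
Qed.

(** One index from every pair [{i, a i}]. *)
Definition pair_transversal (r : seq I) : Prop :=
  [/\ uniq r, forall j, exists2 i, i \in r & j = i \/ j = a i
    & forall i j, i \in r -> j \in r -> j = a i -> j = i].

Lemma pair_transversal_exists (e : seq I) :
  (forall j, j \in e) -> exists r, pair_transversal r.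
Proof.
move=> eT; suff [r [ur rP rA]] : exists r, [/\ uniq r,
    forall j, j \in e -> exists2 i, i \in r & j = i \/ j = a i
  & forall i j, i \in r -> j \in r -> j = a i -> j = i].
  by exists r; split=> // j; exact: rP.
elim: e {eT} => [|k e [r [ur rP rA]]]; first by exists [::].
have [[i ir ki]|no] := pselect (exists2 i, i \in r & k = i \/ k = a i).
  exists r; split=> // j; rewrite in_cons => /orP[/eqP->|/rP//].
  by exists i.
exists (k :: r); split=> [|j|i j].
- rewrite /= ur andbT; apply/negP => kr; apply: no; exists k => //; by left.
- rewrite in_cons => /orP[/eqP->|/rP[i ir ji]].
    by exists k; [exact: mem_head | left].
  by exists i => //; rewrite in_cons ir orbT.
rewrite !in_cons => /orP[/eqP->|ir] /orP[/eqP->//|jr] ja.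
- by case: no; exists j => //; right; rewrite ja aK.
- by case: no; exists i => //; right.
- exact: rA.
Qed.

(** Both sides are multiplicative in [w], because the images of the embeddings for
    different pairs commute; so it is enough to compare them on generators. *)
Lemma embed_proj (r : seq I) : pair_transversal r ->
  forall w, w = \prod_(i <- r) embed i (proj i w).
Proof.
move=> [ur rP rA]; elim/cox_ind => [|j w IH].
  by rewrite big1_seq // => i _; rewrite !hom1.
have -> : \prod_(i <- r) embed i (proj i (sigma j * w)) =
    (\prod_(i <- r) embed i (proj i (sigma j))) * (\prod_(i <- r) embed i (proj i w)).
  elim: r ur rA {rP IH} => [|i r IH]; first by rewrite !big_nil mulg1.
  rewrite cons_uniq => /andP[ir ur] rA; rewrite !big_cons IH //; last first.
    by move=> k l kr lr; apply: rA; rewrite in_cons ?kr ?lr orbT.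
  rewrite (@gmulfM _ _ (proj i)) (@gmulfM _ _ (embed i)) -!mulgA; congr (_ * _).
  rewrite !mulgA; congr (_ * _); rewrite big_seq; apply: (big_ind (commute (embed i (proj i w)))).
  - exact: commute1.
  - by move=> x y; exact: commuteM.
  move=> k kr; apply: embed_commute; first by apply: contraNneq ir => <-.
  apply: contraNneq ir => kai; rewrite -(rA i k) //; first exact: mem_head.
  by rewrite in_cons kr orbT.
rewrite -IH; congr (_ * _).
have [i ir ji] := rP j; rewrite (@prod_single _ _ _ _ i) // => [|k kr ki].
  rewrite projE /proj_gen; case: eqVneq => [->|/eqP ne]; first by rewrite embedE.
  by case: ji => // ->; rewrite eqxx embedE.
rewrite projE /proj_gen; case: eqVneq => [jk|ne].
  case: ji => [ji|ji]; first by case/eqP: ki; rewrite -jk.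
  by case/eqP: ki; apply: rA => //; rewrite -jk.
case: eqVneq => [jak|_]; last exact: hom1.
case: ji => [ji|ji]; last by case/eqP: ki; apply: (inv_inj aK); rewrite -jak.
by case/eqP: ki; apply/esym/(rA k) => //; rewrite -ji.
Qed.

Lemma proj_inj (r : seq I) : pair_transversal r -> forall w,
  (forall i, proj i w = 1) -> w = 1.
Proof.
move=> rT w w1; rewrite (embed_proj rT w) big1_seq // => i _.
by rewrite w1 hom1.
Qed.

Lemma sigma_neq1 i : sigma i <> 1.
Proof.
move/(congr1 (proj i)); rewrite projE hom1 /proj_gen eqxx.
exact: dih_neq1.
Qed.

Section FixedPointFree.
Hypothesis a_neq : forall i, a i <> i.

(** The letters of a reduced word for [w]: [i] occurs unless the dihedral component
    of [w] lies in the subgroup generated by the partner of [i]. *)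
Definition supp (w : W) : set I := [set i | ~ (proj i w = 1 \/ proj i w = dih s true)].

Let swap2 b : dih s (~~ b) * dih s (~~ b) = 1. Proof. exact: dih2. Qed.

Let swapM b c : (dih s (~~ b) * dih s (~~ c)) ^+ dihedral_matrix s b c = 1.
Proof. by have := cox_genM (dihedral_matrix s) (~~ b) (~~ c); case: b c => [] []. Qed.

Let swap : {multiplicative D -> D} := cox_lift swap2 swapM.

Let swap_gen b : swap (dih s b) = dih s (~~ b). Proof. exact: cox_lift_gen. Qed.

Let swapK d : swap (swap d) = d.
Proof.
elim/cox_ind: d => [|b d IH]; first by rewrite !hom1.
by rewrite !gmulfM IH !swap_gen negbK.
Qed.

Lemma proj_partner i w : proj (a i) w = swap (proj i w).
Proof.
move: w; apply: (@cox_hom_eq I m D (proj (a i)) (swap \o proj i)) => j.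
rewrite /= !projE /proj_gen aK; case: (eqVneq j (a i)) => [->|jai].
  by case: eqVneq => [/a_neq//|_]; rewrite swap_gen.
by case: eqVneq => _; rewrite ?swap_gen ?hom1.
Qed.

(** An element with support in [S] is the product of its dihedral components, each of
    which lies in the subgroup generated by the members of [S] in its pair; when only
    one member is in [S], this uses that the two reflections are different. *)
Lemma generated_supp (r : seq I) : pair_transversal r -> forall (S : set I) w,
  generated (sigma @` S) w <-> supp w `<=` S.
Proof.
move=> rT S w; have sS := generated_subgroup (sigma @` S).
split=> [Sw i wi|wS].
  apply: contrapT => nSi; apply: wi.
  suff : generated (sigma @` S) `<=` [set w | proj i w = 1 \/ proj i w = dih s true].
    by move/(_ w Sw).
  apply: generated_sub; last first.
    move=> _ [j Sj <-]; rewrite /= projE /proj_gen.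
    have [ji|_] := eqVneq j i; first by case: nSi; rewrite -ji.
    by case: eqVneq; [right | left].
  split=> [|x y x1 y1]; first by left; exact: hom1.
  rewrite /mkset (@gmulfM _ _ (proj i)) homV.
  by case: x1 y1 => -> [] ->; rewrite ?(involV (dih2 s _)) ?invg1 ?mulg1 ?mul1g ?dih2; auto.
have genS j : S j -> generated (sigma @` S) (sigma j).
  by move=> Sj; apply: sub_generated; exists j.
rewrite (embed_proj rT w); apply: (big_ind (generated (sigma @` S))).
- by case: sS.
- by move=> x y; exact: (subgroupM sS).
move=> i _; have [Si|nSi] := pselect (S i).
  have [Sai|nSai] := pselect (S (a i)).
    elim/cox_ind: (proj i w) => [|b d IH]; first by rewrite hom1; case: sS.
    rewrite (@gmulfM _ _ (embed i)) embedE; apply: (subgroupM sS) => //.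
    by case: b; exact: genS.
  have : proj (a i) w = 1 \/ proj (a i) w = dih s true.
    by apply: contrapT => /wS.
  rewrite proj_partner => ae.
  have -> : proj i w = swap (swap (proj i w)) by rewrite swapK.
  case: ae => ->; first by rewrite !hom1; case: sS.
  by rewrite swap_gen embedE; exact: genS.
have [->|e] : proj i w = 1 \/ proj i w = dih s true by apply: contrapT => /wS.
  by rewrite hom1; case: sS.
rewrite e embedE; apply: genS; apply: wS.
rewrite /supp /= proj_partner e swap_gen => -[|]; first exact: dih_neq1.
exact: dih_neq.
Qed.

Lemma proj_embed i d : proj i (embed i d) = d.
Proof.
elim/cox_ind: d => [|b d IH]; first by rewrite !hom1.
rewrite !gmulfM IH embedE; congr (_ * _).
case: b; rewrite /embed_gen projE /proj_gen eqxx //.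
by case: eqVneq => [/a_neq|].
Qed.

Lemma proj_embed_neq i j d : j != i -> j != a i -> proj i (embed j d) = 1.
Proof.
move=> ji jai; elim/cox_ind: d => [|b d IH]; first by rewrite !hom1.
rewrite !gmulfM IH embedE mulg1.
case: b; rewrite /embed_gen projE /proj_gen.
  by rewrite (inv_eq aK) (negbTE jai) (inj_eq (inv_inj aK)) (negbTE ji).
by rewrite (negbTE ji) (negbTE jai).
Qed.

Lemma matching_iso (r : seq I) N : pair_transversal r -> size r = N ->
  exists f : {multiplicative W -> {ffun 'I_N -> 'D_(s.*2)%type}}, bijective f.
Proof.
move=> rT rN; have [th [[th' thK th'K] _]] := dihedral_iso_exists s2.
case: N / rN; have [ur rP rA] := rT; pose r_ k := tnth (in_tuple r) k.
have r_in k : r_ k \in r by exact: mem_tnth.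
have r_inj k l : r_ k = r_ l -> k = l.
  by move: k l; apply/tuple_uniqP.
pose f (w : W) := [ffun k => th (proj (r_ k) w)].
have fM : {morph f : v w / v * w}.
  by move=> v w; apply/ffunP => k; rewrite !ffunE !gmulfM.
pose fH : {multiplicative W -> {ffun 'I_(size r) -> 'D_(s.*2)%type}} :=
  HB.pack f (isMultiplicative.Build _ _ f fM).
pose g (d : {ffun 'I_(size r) -> 'D_(s.*2)%type}) : W :=
  \prod_(k <- index_enum 'I_(size r)) embed (r_ k) (th' (d k)).
exists fH; exists g => [w|d].
  rewrite [RHS](embed_proj rT) /g (big_tnth _ _ r); apply: eq_bigr => k _.
  by rewrite ffunE thK.
apply/ffunP => k; rewrite ffunE /g (hom_prod (proj (r_ k))).
rewrite (@prod_single _ _ _ _ k) ?index_enum_uniq ?mem_index_enum //.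
  by rewrite proj_embed th'K.
move=> l _ lk; apply: proj_embed_neq; first by apply: contraNneq lk => /r_inj ->.
by apply: contraNneq lk => e; apply/eqP/r_inj/rA.
Qed.

End FixedPointFree.

End Matching.

(** * Semidirect products *)

Section Semidirect.
Variables (G W : groupType) (a : group_action G W).

HB.instance Definition _ := isMultiplicative.Build G (semidirect a) (@sd_inl G W a)
  (fun g h => congr1 (pair (g * h)) (esym (etrans (mulg1 _) (gact_one a h)))).

HB.instance Definition _ := isMultiplicative.Build W (semidirect a) (@sd_inr G W a)
  (fun v w => congr2 pair (esym (mulg1 1)) (congr1 (mulg^~ w) (esym (gact1 a v)))).

Lemma sd_inlM g h : sd_inl a (g * h) = sd_inl a g * sd_inl a h.
Proof. exact: (gmulfM (s := sd_inl a)). Qed.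

Lemma sd_inrM v w : sd_inr a (v * w) = sd_inr a v * sd_inr a w.
Proof. exact: (gmulfM (s := sd_inr a)). Qed.

Lemma sd_inrV w : sd_inr a w^-1 = (sd_inr a w)^-1.
Proof. exact: (homV (sd_inr a)). Qed.

Lemma sd_decomp (x : semidirect a) : x = sd_inl a x.1 * sd_inr a x.2.
Proof. by case: x => g w; congr pair; rewrite /= ?mulg1 ?gact_one ?mul1g. Qed.

Lemma sd_inr_conj w g : sd_inr a w ^ sd_inl a g = sd_inr a (a w g).
Proof.
apply: (mulgI (sd_inl a g)); rewrite -conjgC; congr pair.
  by rewrite /= mul1g mulg1.
by rewrite /= gact1 mulg1 mul1g.
Qed.

Lemma sd_inl_inj : injective (sd_inl a). Proof. by move=> g h []. Qed.

Lemma sd_inr_inj : injective (sd_inr a). Proof. by move=> g h []. Qed.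

Section Lift.
Variables (Q : groupType) (k : {multiplicative G -> Q}) (l : {multiplicative W -> Q}).
Hypothesis kl : forall w g, l (a w g) = l w ^ k g.

Definition sd_lift_fun (x : semidirect a) : Q := k x.1 * l x.2.

Lemma sd_lift_mul : {morph sd_lift_fun : x y / x * y}.
Proof.
move=> [g u] [h v]; rewrite /sd_lift_fun /= !gmulfM kl -!mulgA; congr (_ * _).
by rewrite mulVKg.
Qed.

HB.instance Definition _ :=
  isMultiplicative.Build (semidirect a) Q sd_lift_fun sd_lift_mul.

Definition sd_lift : {multiplicative semidirect a -> Q} := sd_lift_fun.

Lemma sd_lift_inl g : sd_lift (sd_inl a g) = k g.
Proof. by rewrite /= /sd_lift_fun /= hom1 mulg1. Qed.

Lemma sd_lift_inr w : sd_lift (sd_inr a w) = l w.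
Proof. by rewrite /= /sd_lift_fun /= hom1 mul1g. Qed.

End Lift.

End Semidirect.

(** * The groups of the polytopes 2^{P,G(s)} *)

Local Notation "F ^^ g" := (vertex_mul F g) (at level 40, left associativity).

Section Cubic.
Variables (n : nat) (G : groupType) (tau : 'I_n.+1 -> G) (alpha : G).
Hypothesis alpha_central : forall g, commute alpha g.
Variable s : nat.

Local Notation H := (vertex_stabilizer tau).
Local Notation F0 := (base_vertex tau).
Local Notation matrix := (vertex_matrix (tau := tau) alpha s).
Local Notation W := (vertex_coxeter tau alpha s).
Local Notation sigma := (cox_gen matrix).
Local Notation act := (vertex_action tau alpha_central s).
Local Notation C := (cubic_group tau alpha_central s).
Local Notation rho := (cubic_gen tau alpha_central s).
Local Notation inl := (sd_inl act).
Local Notation inr := (sd_inr act).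

Lemma vertexP (F : vertex tau) : exists g, F = F0 ^^ g.
Proof. by have [g ->] := cosetP F; exists g. Qed.

Lemma vertex_eq g h : F0 ^^ g = F0 ^^ h <-> H (g * h^-1).
Proof. exact: coset_eq (parabolic_subgroup _ _) _ _. Qed.

Lemma vertex_fix g : H g -> F0 ^^ g = F0.
Proof. by move=> Hg; rewrite -[RHS]vertex_mul1; apply/vertex_eq; rewrite invg1 mulg1. Qed.

Lemma vertex_act_gen F g : act (sigma F) g = sigma (F ^^ g).
Proof. exact: (vertex_act_word alpha_central s [:: F]). Qed.

Lemma cubic_gen0 : rho ord0 = inr (sigma F0).
Proof. by rewrite /cubic_gen unlift_none. Qed.

Lemma cubic_genS j : rho (lift ord0 j) = inl (tau j).
Proof. by rewrite /cubic_gen liftK. Qed.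

Lemma ord0_or_lift (i : 'I_n.+2) : i = ord0 \/ exists j, i = lift ord0 j.
Proof. by case: (unliftP ord0 i) => [j ->|->]; [right; exists j | left]. Qed.

Lemma sigma_vertex g : inr (sigma (F0 ^^ g)) = inr (sigma F0) ^ inl g.
Proof. by rewrite sd_inr_conj vertex_act_gen. Qed.

(** * Homomorphisms from the semidirect product *)

Section Twist.
Variables (Q : groupType) (k : {multiplicative G -> Q}) (q0 : Q).
Hypothesis q02 : q0 * q0 = 1.
Hypothesis q0_tau : forall j, j <> ord0 -> commute q0 (k (tau j)).
Hypothesis tau2 : forall j, tau j * tau j = 1.

Lemma twist_commute g : H g -> commute q0 (k g).
Proof.
move: g; apply: parabolic_ind => // [|j g j0 _ IH]; first by rewrite hom1; exact: commute1.
by rewrite gmulfM; apply: commuteM IH; exact: q0_tau.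
Qed.

Lemma twist_fix g : H g -> q0 ^ k g = q0.
Proof. by move=> /twist_commute e; rewrite conjgE e mulgA mulVg mul1g. Qed.

(** The relations between the generators [sigma F] are conjugate to relations
    between the base generator and the others, and these only depend on a double
    coset of the vertex stabilizer. *)
Lemma twist_double_coset (R : seq G) :
  (forall g, exists r u v, [/\ r \in R, H u, H v & g = u * r * v]) ->
  (forall r, r \in R -> (q0 * q0 ^ k r) ^+ matrix F0 (F0 ^^ r) = 1) ->
  forall g, (q0 * q0 ^ k g) ^+ matrix F0 (F0 ^^ g) = 1.
Proof.
move=> gR RM g; have [r [u [v [rR Hu Hv ->]]]] := gR g.
rewrite !vertex_mulM vertex_fix // -[X in matrix X _](vertex_fix Hv).
rewrite vertex_matrix_mul // !gmulfM !conjgM twist_fix //.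
by rewrite -[X in X * _](twist_fix Hv) -conjMg -conjXg RM // conj1g.
Qed.

Hypothesis q0M : forall g, (q0 * q0 ^ k g) ^+ matrix F0 (F0 ^^ g) = 1.

Let rep (F : vertex tau) : G := projT1 (cid (vertexP F)).

Let repE F : F = F0 ^^ rep F. Proof. exact: (projT2 (cid (vertexP F))). Qed.

(** The image of [sigma F]; it does not depend on the chosen representative, since the
    vertex stabilizer commutes with [q0]. *)
Definition twist_gen (F : vertex tau) : Q := q0 ^ k (rep F).

Lemma twist_genE g : twist_gen (F0 ^^ g) = q0 ^ k g.
Proof.
rewrite /twist_gen; set g' := rep _.
have /vertex_eq Hg : F0 ^^ g' = F0 ^^ g by rewrite -repE.
by rewrite -[g'](mulgVK g) gmulfM conjgM twist_fix.
Qed.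

Lemma twist_gen2 F : twist_gen F * twist_gen F = 1.
Proof. exact: involJ. Qed.

Lemma twist_genM F F' : (twist_gen F * twist_gen F') ^+ matrix F F' = 1.
Proof.
rewrite [F]repE [F']repE !twist_genE; move: (rep F) (rep F') => g h.
rewrite -[h](mulgVK g) gmulfM conjgM -conjMg -conjXg vertex_mulM.
by rewrite vertex_matrix_mul // q0M conj1g.
Qed.

Definition twist_vertex : {multiplicative W -> Q} := cox_lift twist_gen2 twist_genM.

Lemma twist_vertexJ w g : twist_vertex (act w g) = twist_vertex w ^ k g.
Proof.
elim/cox_ind: w => [|F w IH]; first by rewrite gact_one !hom1 conj1g.
rewrite gact_mul !gmulfM IH conjMg; congr (_ * _).
rewrite vertex_act_gen !cox_lift_gen [F]repE -vertex_mulM !twist_genE.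
by rewrite gmulfM conjgM.
Qed.

Definition twist : {multiplicative C -> Q} := sd_lift twist_vertexJ.

Lemma twist0 : twist (rho ord0) = q0.
Proof.
rewrite cubic_gen0 sd_lift_inr cox_lift_gen -[F0 in LHS]vertex_mul1 twist_genE.
by rewrite hom1 conjg1.
Qed.

Lemma twistS j : twist (rho (lift ord0 j)) = k (tau j).
Proof. by rewrite cubic_genS; exact: sd_lift_inl. Qed.

End Twist.

(** * The Coxeter relations of the semidirect product *)

Lemma cubic_gen2 (tau2 : forall j, tau j * tau j = 1) i : rho i * rho i = 1.
Proof.
case: (ord0_or_lift i) => [->|[j ->]].
  by rewrite cubic_gen0 -sd_inrM cox_gen2.
by rewrite cubic_genS -sd_inlM tau2.
Qed.

(** The reason why the product of the first two generators has order 4: its square is a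
    product of commuting involutions that belong to two vertices. *)
Lemma cubic_relation_square j : F0 ^^ tau j <> F0 -> F0 ^^ tau j <> F0 ^^ alpha ->
  tau j * tau j = 1 ->
  (rho ord0 * rho (lift ord0 j)) ^+ 2 = inr (sigma F0 * sigma (F0 ^^ tau j)) /\
  (sigma F0 * sigma (F0 ^^ tau j)) ^+ 2 = 1.
Proof.
move=> ne nea tau2; split.
  rewrite sd_inrM sigma_vertex -cubic_gen0 cubic_genS conjgE.
  have -> : (inl (tau j))^-1 = inl (tau j) by apply: involV; rewrite -sd_inlM tau2.
  by rewrite expg2 !mulgA.
have := cox_genM matrix F0 (F0 ^^ tau j).
by rewrite /vertex_matrix; case: eqP => // _; case: eqP.
Qed.

(** * The intersection property of the semidirect product *)

Hypothesis tauC : string_C_group tau.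
Hypothesis tauT : parabolic tau setT = setT.
Hypothesis alpha2 : alpha * alpha = 1.
Hypothesis alpha_free : ~ H alpha.
Hypothesis s2 : (2 <= s)%N.
Variable r : seq (vertex tau).
Hypothesis rT : pair_transversal (fun F : vertex tau => F ^^ alpha) r.

Let tau_ord j : has_order (tau j) 2. Proof. by case: tauC. Qed.

Let tau2 j : tau j * tau j = 1. Proof. by case: (tau_ord j). Qed.

Lemma vertex_alphaK : involutive (fun F : vertex tau => F ^^ alpha).
Proof. by move=> F; rewrite -vertex_mulM alpha2 vertex_mul1. Qed.

Lemma vertex_alpha_neq (F : vertex tau) : F ^^ alpha <> F.
Proof.
have [g ->] := vertexP F; rewrite -vertex_mulM -alpha_central vertex_mulM => /eqP.
rewrite vertex_mul_eq -{2}[F0]vertex_mul1 => /eqP/vertex_eq.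
by rewrite invg1 mulg1.
Qed.

Let matrixE F F' : matrix F F' =
  if F' == F then 1%N else if F' == F ^^ alpha then s else 2%N.
Proof. by []. Qed.

Let generated_suppP := generated_supp vertex_alphaK s2 matrixE vertex_alpha_neq rT.

Definition shift (J : set 'I_n.+2) : set 'I_n.+1 := [set j | J (lift ord0 j)].

(** When [J] is an initial segment of the nodes, these are the vertices of a face of the
    base flag; in general, of the face that belongs to the component of the first node
    in [J]. *)
Definition face_vertices (J : set 'I_n.+1) : set (vertex tau) :=
  [set F | exists2 c, parabolic tau J c & F = F0 ^^ c].

Definition cubic_vertices (J : set 'I_n.+2) : set (vertex tau) :=
  [set F | J ord0 /\ face_vertices (shift J) F].

(** The generators in [J] other than the first permute the vertices of the face.
    Conversely these vertices are images of the base vertex, so that the involutions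
    [sigma F] are conjugates of the first generator. *)
Lemma cubic_parabolic J (x : C) : parabolic rho J x <->
  parabolic tau (shift J) x.1 /\ generated (sigma @` cubic_vertices J) x.2.
Proof.
split=> [|[x1 x2]].
  move: x; apply: parabolic_ind => [||i x Ji _ [Jg Jw]]; first exact: (cubic_gen2 tau2).
    split; first exact: parabolic1.
    by case: (generated_subgroup (sigma @` cubic_vertices J)).
  case: (ord0_or_lift i) Ji => [->|[j ->]] Ji.
    have -> : rho ord0 * x = (x.1, sigma (F0 ^^ x.1) * x.2).
      by rewrite cubic_gen0 -vertex_act_gen; congr pair; exact: mul1g.
    split=> //=.
    apply: (subgroupM (generated_subgroup _)) Jw; apply: sub_generated.
    by exists (F0 ^^ x.1) => //; split=> //; exists x.1.
  have -> : rho (lift ord0 j) * x = (tau j * x.1, x.2).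
    rewrite cubic_genS; congr pair.
    by rewrite [LHS](congr1 (fun w => w * x.2) (gact_one act x.1)) mul1g.
  split=> //=; exact: parabolicM (parabolic_gen _) Jg.
have inlJ g : parabolic tau (shift J) g -> parabolic rho J (inl g).
  move: g; apply: parabolic_ind => // [|j g Jj _ Jg].
    exact: parabolic1.
  rewrite sd_inlM -cubic_genS; apply: parabolicM Jg; exact: parabolic_gen.
rewrite [x]sd_decomp; apply: parabolicM; first exact: inlJ.
suff : generated (sigma @` cubic_vertices J) `<=` [set w | parabolic rho J (inr w)].
  by move/(_ _ x2).
apply: generated_sub.
  split=> [|u v Ju Jv]; rewrite /mkset; first exact: parabolic1.
  by rewrite sd_inrM sd_inrV; apply: parabolicM Ju _; exact: parabolicV.
move=> _ [F [J0 [c Jc ->]] <-]; rewrite /mkset sigma_vertex conjgE -cubic_gen0.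
apply: parabolicM; first by apply: parabolicV; exact: inlJ.
by apply: parabolicM; [exact: (parabolic_gen J0) | exact: inlJ].
Qed.

Lemma cubic_parabolicT : parabolic rho setT = setT.
Proof.
apply/seteqP; split=> // x _; apply/cubic_parabolic.
rewrite (_ : shift setT = setT) ?tauT; last by apply/seteqP.
split=> //; apply/generated_suppP => F _; split=> //.
have [g ->] := vertexP F; exists g => //.
by rewrite (_ : shift setT = setT) ?tauT //; apply/seteqP.
Qed.

Hypothesis face_verticesI : forall J K,
  face_vertices J `&` face_vertices K `<=` face_vertices (J `&` K).

Theorem cubic_C_group : string_C_group rho.
Proof.
split=> [i|i j ij|J K].
- case: (ord0_or_lift i) => [->|[j ->]].
    apply: has_order2; last exact: (cubic_gen2 tau2).
    rewrite cubic_gen0 -[1]/(inr 1) => /sd_inr_inj.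
    exact: (sigma_neq1 vertex_alphaK s2 matrixE).
  rewrite cubic_genS; apply: (has_order_morph (f := inl)) => //.
  exact: sd_inl_inj.
- wlog {ij} ij : i j / (i.+1 < j)%N => [hyp|].
    case/orP: ij => ij; first exact: hyp.
    have /commute_invol := hyp _ _ ij; move=> /(_ (cubic_gen2 tau2 _) (cubic_gen2 tau2 _)).
    by move/commute_sym/commute_invol; apply; exact: (cubic_gen2 tau2).
  case: (ord0_or_lift j) ij => [->//|[j' ->]].
  case: (ord0_or_lift i) => [->|[i' ->]].
    rewrite /= ltnS => j'0; apply/commute_invol; [exact: (cubic_gen2 tau2)..|].
    rewrite cubic_gen0 cubic_genS.
    apply/commgP; rewrite -conjg_fix sd_inr_conj vertex_act_gen vertex_fix //.
    by apply: parabolic_gen => /= e; rewrite e in j'0.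
  rewrite /= !ltnS => ij; rewrite !cubic_genS -sd_inlM -(homX inl).
  by have [_ comm _] := tauC; rewrite comm ?ij.
apply/seteqP; split=> x.
  move=> [/cubic_parabolic[J1 /generated_suppP J2] /cubic_parabolic[K1 /generated_suppP K2]].
  apply/cubic_parabolic; split.
    have [_ _ int] := tauC.
    by have : (parabolic tau (shift J) `&` parabolic tau (shift K)) x.1 by []; rewrite int.
  apply/generated_suppP => F Fx; have [J0 JF] := J2 _ Fx; have [K0 KF] := K2 _ Fx.
  by split=> //; exact: (face_verticesI (conj JF KF)).
by move=> JKx; split; apply: parabolicS JKx => i [].
Qed.

Lemma cubic_order0 j : F0 ^^ tau j <> F0 -> F0 ^^ tau j <> F0 ^^ alpha ->
  has_order (rho ord0 * rho (lift ord0 j)) 4.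
Proof.
move=> ne nea.
have [sq y2] := cubic_relation_square ne nea (tau2 j).
have y1 : sigma F0 * sigma (F0 ^^ tau j) <> 1.
  move/(congr1 (proj vertex_alphaK matrixE F0)).
  rewrite gmulfM !projE hom1 /proj_gen eqxx; case: eqP => // _; case: eqP => // _.
  by rewrite mulg1; exact: dih_neq1.
set x := _ * _ in sq *.
have x2 : x ^+ 2 <> 1 by rewrite sq -[1]/(inr 1) => /sd_inr_inj.
have x4 : x ^+ 4 = 1 by rewrite (expgnA x 2 2) sq -(homX inr) y2.
split=> // -[|[|[|[|k]]]] //= _ xk; apply: x2 => //.
  by rewrite -[x]expg1 xk expg1n.
have -> : x = 1 by rewrite -x4 expgS xk mulg1.
by rewrite expg1n.
Qed.

End Cubic.

(** * Words in the Coxeter group of the 24-cell *)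

(** Words are sequences of indices of generators, so that the same words serve for
    the subdiagrams of the diagram. *)
Local Notation word := (seq nat).

Definition rule : Type := word * word.

Definition braids : seq rule := [::
  ([:: 0; 2], [:: 2; 0]); ([:: 0; 3], [:: 3; 0]); ([:: 1; 3], [:: 3; 1]);
  ([:: 0; 1; 0], [:: 1; 0; 1]); ([:: 2; 3; 2], [:: 3; 2; 3]);
  ([:: 1; 2; 1; 2], [:: 2; 1; 2; 1])]%N.

(** The other rules of a complete rewriting system for [3,4,3], with respect to the
    order of words by length and then lexicographically with 3 < 2 < 1 < 0. Each of
    them is given by a path from its left to its right hand side, along which braid
    relations and the previous rules are applied in either direction. *)
Definition derivations : seq (word * seq word) := [::
  ([:: 0;1;2;0], [:: [:: 0;1;0;2]; [:: 1;0;1;2]]);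
  ([:: 0;1;2;3;0], [:: [:: 0;1;2;0;3]; [:: 1;0;1;2;3]]);
  ([:: 0;1;2;1;0;1], [:: [:: 0;1;2;0;1;0]; [:: 1;0;1;2;1;0]]);
  ([:: 1;2;3;1;2;3], [:: [:: 1;2;1;3;2;3]; [:: 1;2;1;2;3;2]; [:: 2;1;2;1;3;2];
     [:: 2;1;2;3;1;2]]);
  ([:: 0;1;2;3;1;0;1], [:: [:: 0;1;2;3;0;1;0]; [:: 1;0;1;2;3;1;0]]);
  ([:: 0;1;2;3;1;2;0;1;2;1], [:: [:: 0;1;2;3;1;0;2;1;2;1];
     [:: 0;1;2;3;1;0;1;2;1;2]; [:: 0;1;2;3;0;1;0;2;1;2];
     [:: 1;0;1;2;3;1;0;2;1;2]; [:: 1;0;1;2;3;1;2;0;1;2]]);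
  ([:: 0;1;2;3;1;2;0;1;2;3;1], [:: [:: 0;1;2;3;1;2;0;1;2;1;3];
     [:: 1;0;1;2;3;1;2;0;1;2;3]]);
  ([:: 0;1;2;3;1;2;1;0;1;2;1;0], [:: [:: 0;1;2;3;1;2;0;1;0;2;1;0];
     [:: 0;1;2;3;1;2;0;1;2;0;1;0]; [:: 0;1;2;3;1;2;0;1;2;1;0;1];
     [:: 1;0;1;2;3;1;2;0;1;2;0;1]; [:: 1;0;1;2;3;1;2;0;1;0;2;1];
     [:: 1;0;1;2;3;1;2;1;0;1;2;1]]);
  ([:: 0;1;2;3;1;2;1;0;1;2;3;1;0], [:: [:: 0;1;2;3;1;2;1;0;1;2;1;3;0];
     [:: 0;1;2;3;1;2;1;0;1;2;1;0;3]; [:: 1;0;1;2;3;1;2;1;0;1;2;1;3];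
     [:: 1;0;1;2;3;1;2;1;0;1;2;3;1]]);
  ([:: 0;1;2;3;1;2;1;0;1;2;3;1;2;0], [:: [:: 0;1;2;3;1;2;1;0;1;2;3;1;0;2];
     [:: 1;0;1;2;3;1;2;1;0;1;2;3;1;2]]);
  ([:: 0;1;2;3;1;2;1;0;1;2;3;1;2;1;0;1],
     [:: [:: 0;1;2;3;1;2;1;0;1;2;3;1;2;0;1;0];
     [:: 1;0;1;2;3;1;2;1;0;1;2;3;1;2;1;0]])]%N.

Definition rewrites (rs : seq rule) (u : word) : seq word :=
  flatten [seq [seq take k u ++ r.2 ++ drop (k + size r.1) u
    | k <- iota 0 (size u) & prefix r.1 (drop k u)] | r <- rs].

Definition linked (rs : seq rule) (u v : word) : bool :=
  (v \in rewrites rs u) || (u \in rewrites rs v).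

Fixpoint derivable (rs : seq rule) (ds : seq (word * seq word)) : bool :=
  if ds is (u, us) :: ds' then
    path (linked rs) u us && derivable ((u, last u us) :: rs) ds'
  else true.

Definition rules : seq rule :=
  [seq (d.1, last d.1 d.2) | d <- derivations] ++ braids.

Definition all_rules : seq rule := [seq ([:: i; i], [::]) | i <- iota 0 4] ++ rules.

Definition starts_irreducible (w : word) : bool :=
  ~~ has (fun r => prefix r.1 w) all_rules.

(** Words are extended on the left, so that only their prefixes need be tested. *)
Definition extend (s : seq word) : seq word :=
  [seq w <- [seq i :: u | i <- iota 0 4, u <- s] | starts_irreducible w].

Definition normal_words : seq word :=
  flatten (traject extend [:: [::]] 25).


(** The order of the product of two generators, for [i < j]. *)
Definition f4_order (i j : nat) : nat :=
  if j == i.+1 then nth 0%N [:: 3; 4; 3] i else 2.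

Definition eval (G : groupType) (t : nat -> G) (w : word) : G :=
  \prod_(i <- w) t i.

Lemma eval_cat (G : groupType) (t : nat -> G) u v :
  eval t (u ++ v) = eval t u * eval t v.
Proof. exact: big_cat. Qed.

Lemma eval_nil (G : groupType) (t : nat -> G) : eval t [::] = 1.
Proof. exact: big_nil. Qed.

Lemma eval_cons (G : groupType) (t : nat -> G) i u :
  eval t (i :: u) = t i * eval t u.
Proof. exact: big_cons. Qed.

Lemma eval_nseq (G : groupType) (t : nat -> G) k u :
  eval t (flatten (nseq k u)) = eval t u ^+ k.
Proof.
elim: k => [|k IH]; first by rewrite /eval big_nil.
by rewrite /= eval_cat IH expgS.
Qed.

Definition below (n : nat) : pred word := all (fun i => i < n)%N.

Lemma below_cat n u v : below n (u ++ v) = below n u && below n v.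
Proof. exact: all_cat. Qed.

Section Braids.
Variables (G : groupType) (x y : G).
Hypotheses (x2 : x * x = 1) (y2 : y * y = 1).

Lemma braid3 : (x * y) ^+ 3 = 1 -> x * (y * x) = y * (x * y).
Proof.
rewrite !expgS expg0 mulg1 => e; apply/divg1_eq.
by rewrite !invgM !(involV x2) !(involV y2) -[RHS]e !mulgA.
Qed.

Lemma braid4 : (x * y) ^+ 4 = 1 -> x * (y * (x * y)) = y * (x * (y * x)).
Proof.
rewrite !expgS expg0 mulg1 => e; apply/divg1_eq.
by rewrite !invgM !(involV x2) !(involV y2) -[RHS]e !mulgA.
Qed.

End Braids.

(** Every rule makes a word smaller as a base 5 number with digits 1 to 4, so a
    smallest word for a given element admits no rule. *)
Definition digits (w : word) : N :=
  foldl (fun c i => 5 * c + N.of_nat (4 - i))%num 0%num w.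

Lemma digits_cat u v :
  digits (u ++ v) = (digits u * 5 ^ N.of_nat (size v) + digits v)%num.
Proof.
elim/last_ind: v => [|v i IH]; first by rewrite cats0 /digits /=; lia.
rewrite -rcons_cat /digits !foldl_rcons -!/(digits _) IH size_rcons.
by rewrite Nnat.Nat2N.inj_succ N.pow_succ_r'; lia.
Qed.

Definition decreasing (r : rule) : bool :=
  (size r.2 <= size r.1)%N && (N.ltb (digits r.2) (digits r.1)).

Lemma digits_decreasing x y r : decreasing r ->
  (digits (x ++ r.2 ++ y) < digits (x ++ r.1 ++ y))%num.
Proof.
move=> /andP[sz /N.ltb_lt dr]; rewrite !digits_cat !size_cat !Nnat.Nat2N.inj_add.
rewrite !N.pow_add_r.
have : (5 ^ N.of_nat (size r.2) <= 5 ^ N.of_nat (size r.1))%num.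
  by apply: N.pow_le_mono_r => //; have /leP := sz; lia.
have : (0 < 5 ^ N.of_nat (size y))%num.
  by have := N.pow_nonzero 5 (N.of_nat (size y)); lia.
move=> y0 rl.
have := N.mul_le_mono_l _ _ (digits x) (N.mul_le_mono_r _ _ (5 ^ N.of_nat (size y)) rl).
by have /(N.mul_lt_mono_pos_r _ _ _ y0) := dr; lia.
Qed.

Definition irreducible (w : word) : Prop :=
  forall x y, w = x ++ y -> starts_irreducible y.

Lemma irreducible_iter w : below 4 w -> irreducible w ->
  w \in iter (size w) extend [:: [::]].
Proof.
elim: w => [//|i w IH] /= /andP[i4 w4] irr.
rewrite mem_filter (irr [::]) // andTb; apply/allpairsPdep; exists i, w; split=> //.
  by rewrite mem_iota.
by apply: IH => // x y e; apply: (irr (i :: x)); rewrite e.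
Qed.

Lemma irreducible_normal w : below 4 w -> irreducible w -> w \in normal_words.
Proof.
move=> w4 irr; have [sz|sz] := ltnP (size w) 25.
  apply/flattenP; exists (iter (size w) extend [:: [::]]).
    by apply/trajectP; exists (size w).
  exact: irreducible_iter.
(* There is no irreducible word with 25 letters, as the longest element of the group
   has length 24. *)
have : drop (size w - 25) w \in iter 25 extend [:: [::]].
  rewrite -[X in iter X](_ : size (drop (size w - 25) w) = 25); last first.
    by rewrite size_drop subKn.
  apply: irreducible_iter.
    by move: w4; rewrite -{1}(cat_take_drop (size w - 25) w) below_cat => /andP[].
  move=> x y e; apply: (irr (take (size w - 25) w ++ x)).
  by rewrite -catA -e cat_take_drop.
by rewrite (_ : iter 25 extend [:: [::]] = [::]) //; vm_compute.
Qed.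

(** All the rules hold in any group whose generators [t i], for [i < n], satisfy
    the Coxeter relations that involve them; with [n = 3] this covers the
    octahedral group. *)
Section Soundness.
Variables (G : groupType) (t : nat -> G) (n : nat).
Hypothesis t2 : forall i, (i < n)%N -> t i * t i = 1.
Hypothesis tM : forall i j, (i < j < n)%N -> (t i * t j) ^+ f4_order i j = 1.

Let sound (r : rule) :=
  below n r.1 = below n r.2 /\ (below n r.1 -> eval t r.1 = eval t r.2).

Let sound2 i j : (i < j)%N -> f4_order i j = 2 -> sound ([:: i; j], [:: j; i])%N.
Proof.
move=> ij m; rewrite /sound /below /eval /= !big_cons big_nil !mulg1 !andbT.
split=> [|/andP[/t2 i2 jn]]; first exact: andbC.
by apply/commute_invol; rewrite ?i2 ?t2 // -m tM // ij.
Qed.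

Let sound3 i j : (i < j)%N -> f4_order i j = 3 ->
  sound ([:: i; j; i], [:: j; i; j])%N.
Proof.
move=> ij m; rewrite /sound /below /eval /= !big_cons big_nil !mulg1 !andbT.
split; first by case: (i < n)%N; case: (j < n)%N.
by move=> /and3P[/t2 i2 jn _]; apply: braid3; rewrite ?i2 ?t2 // -m tM // ij.
Qed.

Let sound4 i j : (i < j)%N -> f4_order i j = 4 ->
  sound ([:: i; j; i; j], [:: j; i; j; i])%N.
Proof.
move=> ij m; rewrite /sound /below /eval /= !big_cons big_nil !mulg1 !andbT.
split; first by case: (i < n)%N; case: (j < n)%N.
by move=> /and4P[/t2 i2 jn _ _]; apply: braid4; rewrite ?i2 ?t2 // -m tM // ij.
Qed.

Lemma braids_sound r : r \in braids -> sound r.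
Proof.
rewrite /braids !inE => /orP[/eqP->|/orP[/eqP->|/orP[/eqP->|]]].
- exact: sound2.
- exact: sound2.
- exact: sound2.
by move=> /orP[/eqP->|/orP[/eqP->|/eqP->]]; [exact: sound3.. | exact: sound4].
Qed.

Lemma rewrites_sound rs u v : (forall r, r \in rs -> sound r) ->
  v \in rewrites rs u -> below n u = below n v /\ (below n u -> eval t u = eval t v).
Proof.
move=> rsS /flatten_mapP[r /rsS[rb re]] /mapP[k].
rewrite mem_filter => /andP[/prefixP[w uw] _] ->.
have dw : drop (k + size r.1) u = w by rewrite addnC -drop_drop uw drop_size_cat.
rewrite dw; have := cat_take_drop k u; rewrite uw.
move: (take k u) => x <-; rewrite !below_cat rb.
by split=> // /and3P[_ rn _]; rewrite !eval_cat re // rb.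
Qed.

Lemma linked_sound rs u v : (forall r, r \in rs -> sound r) ->
  linked rs u v -> sound (u, v).
Proof.
move=> rsS /orP[/(rewrites_sound rsS)[]|/(rewrites_sound rsS)[b e]] //=.
by split=> //= un; rewrite e // b.
Qed.

(** A derived rule holds because it is a chain of equalities, and may then be used in
    the chains that follow. *)
Lemma derivable_sound rs ds : (forall r, r \in rs -> sound r) -> derivable rs ds ->
  forall r, r \in [seq (d.1, last d.1 d.2) | d <- ds] -> sound r.
Proof.
elim: ds rs => [//|[u us] ds IH] rs rsS /= /andP[pu dr] r.
have su : sound (u, last u us).
  elim: us {IH dr} u pu => [|v us IH] u /=; first by split.
  move=> /andP[/(linked_sound rsS)[/= b e] /IH[/= b' e']].
  by split=> /= [|un]; rewrite ?b // e // e' // -b.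
rewrite in_cons => /orP[/eqP-> //|]; apply: IH dr _ => r'.
by rewrite in_cons => /orP[/eqP-> //|]; exact: rsS.
Qed.

Lemma rules_sound r : r \in rules -> sound r.
Proof.
rewrite mem_cat => /orP[|/braids_sound//].
by apply: derivable_sound braids_sound _ _; vm_compute.
Qed.


Lemma all_rules_sound r : r \in all_rules -> below n r.1 ->
  below n r.2 /\ eval t r.1 = eval t r.2.
Proof.
rewrite mem_cat => /orP[/mapP[i _ ->] /= /andP[i_n _]|/rules_sound[<- e] rn].
  by rewrite /eval !big_cons big_nil mulg1 t2.
by rewrite rn e.
Qed.

Lemma irreducible_form u : below n u ->
  exists w, [/\ below n w, irreducible w & eval t w = eval t u].
Proof.
have [k] := ex_intro (fun k => digits u = k) _ erefl.
elim/(well_founded_ind N.lt_wf_0): k u => k IH u uk un.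
have [irr|nirr] := pselect (irreducible u); first by exists u.
have [x [y [uxy]]] : exists x y, u = x ++ y /\ ~ starts_irreducible y.
  apply: contrapT => none; apply: nirr => x y uxy; apply: contrapT => ny.
  by apply: none; exists x, y.
move=> /negP/negPn/hasP[r rR /prefixP[z yz]].
move: un; rewrite uxy yz !below_cat => /and3P[xn /(all_rules_sound rR)[r2n re] zn].
have [|||w [wn wI we]] := IH (digits (x ++ r.2 ++ z)) _ (x ++ r.2 ++ z).
- rewrite -uk uxy yz; apply: digits_decreasing; move: r rR {yz re r2n}.
  by apply/allP; vm_compute.
- by [].
- by rewrite !below_cat xn r2n.
by exists w; split=> //; rewrite we !eval_cat re.
Qed.

Lemma normal_form u : (n <= 4)%N -> below n u ->
  exists w, [/\ w \in normal_words, below n w & eval t w = eval t u].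
Proof.
move=> n4 /irreducible_form[w [wn wI we]]; exists w; split=> //.
apply: irreducible_normal => //; apply: sub_all wn => i i_n.
exact: leq_trans n4.
Qed.

End Soundness.

(** * The reflection representation *)

(** A vector is given by its coordinates on the simple roots, so that the [i]-th
    reflection changes the [i]-th coordinate only. *)
Definition weight : Type := (int * int * int * int)%type.

Definition coord (x : weight) (i : nat) : int :=
  let: (x0, x1, x2, x3) := x in nth x3 [:: x0; x1; x2] i.

Definition simple_refl (x : weight) (i : nat) : weight :=
  let: (x0, x1, x2, x3) := x in
  match i with
  | 0%N => (x1 - x0, x1, x2, x3)
  | 1%N => (x0, x0 + x2 - x1, x2, x3)
  | 2%N => (x0, x1, x1 + x1 + x3 - x2, x3)
  | 3%N => (x0, x1, x2, x2 - x3)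
  | _ => x
  end%R.

(** The fundamental weights: [omega i] is fixed by all the simple reflections but
    the [i]-th. *)
Definition omega (i : nat) : weight :=
  match i with
  | 0%N => (2, 3, 4, 2)
  | 1%N => (3, 6, 8, 4)
  | 2%N => (2, 4, 6, 3)
  | _ => (1, 2, 3, 2)
  end%Z.

(** The sum of the fundamental weights, whose stabilizer is trivial. *)
Definition delta : weight := (8, 15, 21, 11)%Z.

Definition opp_weight (x : weight) : weight :=
  let: (x0, x1, x2, x3) := x in (- x0, - x1, - x2, - x3)%R.

Definition weight_move (x : weight) (w : word) : weight := foldl simple_refl x w.

Lemma refl_refl x i : simple_refl (simple_refl x i) i = x.
Proof.
move: x => [[[x0 x1] x2] x3].
by case: i => [|[|[|[|i]]]] //=; do !congr pair; ring.
Qed.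

Lemma refl_omega i j : (i < 4)%N -> j != i -> simple_refl (omega i) j = omega i.
Proof. by case: i => [|[|[|[|i]]]] //; case: j => [|[|[|[|j]]]]. Qed.

Lemma coord_refl x i j : (i < 4)%N -> j != i -> coord (simple_refl x j) i = coord x i.
Proof.
by move: x => [[[x0 x1] x2] x3]; case: i => [|[|[|[|i]]]] //; case: j => [|[|[|[|j]]]].
Qed.

Lemma refl_opp x i : simple_refl (opp_weight x) i = opp_weight (simple_refl x i).
Proof.
move: x => [[[x0 x1] x2] x3].
by case: i => [|[|[|[|i]]]] //=; do !congr pair; ring.
Qed.

(** Descent to the dominant weight [delta] recovers the normal form of an element
    from its image: the first letter of the smallest word is the largest [i]
    whose reflection brings the vector closer to [delta]. *)
Definition lt_int (x y : int) : bool :=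
  match x, y with
  | Posz a, Posz b => (a < b)%N
  | Negz a, Negz b => (b < a)%N
  | Negz _, Posz _ => true
  | _, _ => false
  end.

Definition descent (x : weight) (i : nat) : bool :=
  lt_int (coord x i) (coord (simple_refl x i) i).

Fixpoint decode (k : nat) (x : weight) : word :=
  if k isn't k'.+1 then [::] else
  if [seq i <- [:: 3; 2; 1; 0]%N | descent x i] is i :: _ then
    i :: decode k' (simple_refl x i)
  else [::].

Lemma decode_normal w : w \in normal_words -> decode 24 (weight_move delta (rev w)) = w.
Proof.
move=> wN; apply/eqP; move: w wN; apply/allP.
by vm_compute.
Qed.

Lemma normal_words_uniq : uniq normal_words.
Proof. by vm_compute. Qed.

Lemma normal_words_size : size normal_words = 1152.
Proof. by vm_compute. Qed.

(** A finite check on which the theory of the group rests: it implies that the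
    reflection representation is faithful and that the stabilizers of fundamental
    weights are parabolic. *)
Lemma normal_moves w i : w \in normal_words -> i \in w -> weight_move (omega i) w <> omega i.
Proof.
move=> wN iw; apply/eqP; move: i iw; apply/allP; move: w wN; apply/allP.
by vm_compute.
Qed.

Lemma delta_order i k : (i < 3)%N -> (0 < k < nth 0%N [:: 3; 4; 3]%N i)%N ->
  weight_move delta (flatten (nseq k [:: i; i.+1])) <> delta.
Proof.
by move=> i3 ik; apply/eqP; case: i i3 ik => [|[|[|]]] // _; case: k => [|[|[|[|]]]].
Qed.

(** Words for the vertices. The first letter of a normal word is the largest index by
    which the element can be shortened on the left; so the words that start with 0, and
    the empty word, are shortest in their cosets of the stabilizer of [omega 0]. *)
Definition vertex_words : seq word :=
  [seq w <- normal_words | head 0%N w == 0%N].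

(** * Subdiagrams of the diagram of the 24-cell *)

(** The lemmas are applied to the 24-cell, with [p] equal to 3, 4, 3, and to its
    octahedral facet, with [p] equal to 3, 4. *)
Section Subdiagram.
Variable p : seq nat.
Hypothesis p_sub : prefix p [:: 3; 4; 3]%N.

Local Notation n := (size p).+1.
Local Notation C := (string_coxeter p).
Local Notation t := (string_gen p).
Local Notation gen := (cox_gen (@string_matrix p)).

Lemma subdiagram_size : (n <= 4)%N.
Proof.
by case/prefixP: p_sub => q /(congr1 size) /=; rewrite size_cat ltnS => ->; exact: leq_addr.
Qed.

Lemma subdiagram_nth i : (i < size p)%N -> nth 0%N p i = nth 0%N [:: 3; 4; 3] i.
Proof. by case/prefixP: p_sub => q -> ip; rewrite nth_cat ip. Qed.

Lemma string_genE (i : 'I_n) : t i = gen i.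
Proof. by rewrite /string_gen inord_val. Qed.

Lemma string_gen2 i : t i * t i = 1.
Proof. exact: cox_gen2. Qed.

Lemma string_matrix_f4 (i j : 'I_n) : string_matrix i j =
  if j == i :> nat then 1%N else if (i < j)%N then f4_order i j else f4_order j i.
Proof.
rewrite /string_matrix /f4_order -val_eqE /=; case: ltngtP => // ij.
  rewrite (ltn_eqF (leqW ij)); case: eqP => // e.
  by rewrite subdiagram_nth // -ltnS -e.
rewrite (ltn_eqF (leqW ij)); case: eqP => // e.
by rewrite subdiagram_nth // -ltnS -e.
Qed.

Lemma string_matrixE (i j : 'I_n) : (i < j)%N -> string_matrix i j = f4_order i j.
Proof. by move=> ij; rewrite string_matrix_f4 gtn_eqF // ij. Qed.

Lemma string_genM i j : (i < j < n)%N -> (t i * t j) ^+ f4_order i j = 1.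
Proof.
move=> /andP[ij jn]; have i_n := ltn_trans ij jn.
have := cox_genM (@string_matrix p) (inord i) (inord j).
by rewrite string_matrixE !inordK.
Qed.

Definition elt (w : word) : C := eval t w.

Lemma elt_cat u v : elt (u ++ v) = elt u * elt v. Proof. exact: eval_cat. Qed.

Lemma elt_cons i u : elt (i :: u) = t i * elt u. Proof. exact: eval_cons. Qed.

Lemma elt1 i : elt [:: i] = t i. Proof. exact: big_seq1. Qed.

Lemma elt_rev w : elt (rev w) = (elt w)^-1.
Proof.
elim: w => [|i w IH]; first by rewrite /elt /eval big_nil invg1.
by rewrite rev_cons -cats1 elt_cat elt1 IH elt_cons invgM (involV (string_gen2 i)).
Qed.

Lemma eltP g : exists w, [/\ w \in normal_words, below n w & g = elt w].
Proof.
suff [u [un ->]] : exists u, below n u /\ g = elt u.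
  have [|w [wN wn we]] := normal_form _ string_genM subdiagram_size un.
    by move=> i _; exact: string_gen2.
  by exists w; rewrite /elt we.
elim/cox_ind: g => [|i g [u [un ->]]].
  by exists [::]; rewrite /elt /eval big_nil.
by exists (val i :: u); rewrite elt_cons string_genE /= ltn_ord.
Qed.

Let act_refl (x : weight) (i : 'I_n) : weight := simple_refl x i.

Let act_refl2 x i : act_refl (act_refl x i) i = x. Proof. exact: refl_refl. Qed.

Let act_reflM (i j : 'I_n) x :
  iter (string_matrix i j) (fun y => act_refl (act_refl y i) j) x = x.
Proof.
rewrite string_matrix_f4 /act_refl.
move: (leq_trans (ltn_ord i) subdiagram_size) (leq_trans (ltn_ord j) subdiagram_size).
move: (val i) (val j) => {}i {}j; move: x => [[[x0 x1] x2] x3].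
case: i => [|[|[|[|i]]]] // _; case: j => [|[|[|[|j]]]] // _ /=;
  do !congr pair; ring.
Qed.

Definition weight_act : weight -> C -> weight := cox_act (m := @string_matrix p) act_refl.

Lemma weight_act_gen x (i : 'I_n) : weight_act x (gen i) = simple_refl x i.
Proof. exact: (cox_act_gen act_refl2 act_reflM). Qed.

Lemma weight_actM x g h : weight_act x (g * h) = weight_act (weight_act x g) h.
Proof. exact: (cox_actM act_refl2 act_reflM). Qed.

Lemma weight_act1 x : weight_act x 1 = x.
Proof. exact: (cox_act1 act_refl2 act_reflM). Qed.

Lemma weight_act_elt x w : below n w -> weight_act x (elt w) = weight_move x w.
Proof.
elim: w x => [|i w IH] x; first by rewrite /elt /eval big_nil weight_act1.
move=> /andP[i_n wn]; rewrite elt_cons weight_actM IH //.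
by rewrite -[i]/(val (Ordinal i_n)) string_genE weight_act_gen.
Qed.

Lemma weight_act_opp x g : weight_act (opp_weight x) g = opp_weight (weight_act x g).
Proof.
elim/cox_ind: g x => [|i g IH] x; first by rewrite !weight_act1.
by rewrite !weight_actM !weight_act_gen refl_opp IH.
Qed.

(** Parabolic subgroups are the pointwise stabilizers of sets of fundamental
    weights, which makes the intersection property evident. *)
Lemma parabolic_stab (J : set 'I_n) g : parabolic gen J g <->
  forall i : 'I_n, ~ J i -> weight_act (omega i) g = omega i.
Proof.
have gen2 i : gen i * gen i = 1 by exact: cox_gen2.
split=> [Jg i nJi|fix_g].
  move: g Jg; apply: parabolic_ind => // [|j g Jj _ IH]; first exact: weight_act1.
  rewrite weight_actM weight_act_gen refl_omega ?IH //.
    exact: leq_trans (ltn_ord i) subdiagram_size.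
  by apply/eqP => /val_inj ji; apply: nJi; rewrite -ji.
have [w [wN wn gw]] := eltP g.
apply/(parabolicP gen2); exists (map inord w) => [i /mapP[k kw ->]|].
  apply: contrapT => /fix_g; rewrite gw weight_act_elt //.
  have kn : (k < n)%N by move/allP: wn; apply.
  by rewrite inordK //; exact: normal_moves.
by rewrite gw /elt /eval big_map.
Qed.

Lemma elt_faithful g : (forall i : 'I_n, weight_act (omega i) g = omega i) -> g = 1.
Proof.
move=> fix_g; apply/(parabolic0 (rho := gen) (fun i => cox_gen2 _ i)).
by apply/parabolic_stab.
Qed.

Lemma parabolic_elt (J : set 'I_n) w : below n w ->
  (forall i : 'I_n, val i \in w -> J i) -> parabolic gen J (elt w).
Proof.
elim: w => [_ _|i w IH /andP[i_n wn] wJ].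
  by rewrite /elt /eval big_nil; exact: parabolic1.
rewrite elt_cons; apply: parabolicM.
  rewrite -[i]/(val (Ordinal i_n)) string_genE; apply: parabolic_gen.
  by apply: wJ; exact: mem_head.
by apply: IH => // j jw; apply: wJ; rewrite in_cons jw orbT.
Qed.

Lemma subdiagram_C_group : string_C_group gen.
Proof.
split=> [i|i j ij|J K].
- apply: has_order2; last exact: cox_gen2.
  move/(congr1 (weight_act (omega i))); rewrite weight_act_gen weight_act1.
  by have := leq_trans (ltn_ord i) subdiagram_size; case: (val i) => [|[|[|[|k]]]].
- wlog {ij} ij : i j / (i.+1 < j)%N => [H|].
    case/orP: ij => ij; first exact: H.
    have /commute_invol := H _ _ ij; move=> /(_ (cox_gen2 _ _) (cox_gen2 _ _)).
    by move/commute_sym/commute_invol; apply; exact: cox_gen2.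
  rewrite -[2]/(if false then 1 else 2)%N.
  have := cox_genM (@string_matrix p) i j.
  by rewrite string_matrixE ?(ltnW ij) // /f4_order gtn_eqF.
apply/seteqP; split=> g.
  move=> [/parabolic_stab Jg /parabolic_stab Kg]; apply/parabolic_stab => i nJK.
  have [Ji|/Jg//] := pselect (J i); have [Ki|/Kg//] := pselect (K i).
  by case: nJK.
by move=> JKg; split; apply: parabolicS JKg => i [].
Qed.

Lemma subdiagram_order (i j : 'I_n) : j = i.+1 :> nat ->
  has_order (gen i * gen j) (nth 0%N p i).
Proof.
move=> ji; have ip : (i < size p)%N by rewrite -ltnS -ji.
have m : string_matrix i j = nth 0%N p i.
  by rewrite string_matrixE ?ji // /f4_order eqxx subdiagram_nth.
rewrite -m; split; [|exact: cox_genM|].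
- rewrite m subdiagram_nth //; move: (leq_trans ip (subdiagram_size : (size p <= 3)%N)).
  by move: (nat_of_ord i) => [|[|[|]]].
- move=> k; rewrite m subdiagram_nth // => km /(congr1 (weight_act delta)).
  have -> : (gen i * gen j) ^+ k = elt (flatten (nseq k [:: val i; val j])).
    elim: k {km} => [|k IH]; first by rewrite /elt /eval big_nil.
    by rewrite expgS IH /= elt_cons elt_cons !string_genE mulgA.
  rewrite weight_act1 weight_act_elt; last by elim: (k) => //= k' ->; rewrite !ltn_ord.
  rewrite (ji : val j = (val i).+1); apply: delta_order => //.
  exact: leq_trans ip (subdiagram_size : (size p <= 3)%N).
Qed.

End Subdiagram.

Definition point (w : word) : weight := weight_move (omega 0) w.

Definition vertices_below (n : nat) : seq word := [seq c <- vertex_words | below n c].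

(** The orbit of the base vertex under the first [n] reflections is closed, so the words
    for vertices with letters below [n] represent all of it. *)
Lemma vertices_closed n : (0 < n <= 4)%N ->
  forall c i, c \in vertices_below n -> (i < n)%N ->
  exists2 c', c' \in vertices_below n & point c' = point (rcons c i).
Proof.
have all_n : all (fun n => all (fun c => all (fun i =>
    has (fun c' => point c' == point (rcons c i)) (vertices_below n))
    (iota 0 n)) (vertices_below n)) (iota 1 4) by vm_compute.
move=> n4 c i cn i_n; move/allP: all_n => /(_ n); rewrite mem_iota => /(_ n4).
move=> /allP/(_ c cn)/allP/(_ i); rewrite mem_iota => /(_ i_n)/hasP[c' c'n /eqP e].
by exists c'.
Qed.

(** A shortest word for a vertex changes every coordinate whose index occurs in it;
    therefore the vertices of the face with a given parabolic stabilizer are cut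
    out by coordinates. *)
Lemma vertex_word_coord c i : c \in vertex_words -> i \in c ->
  coord (point c) i <> coord (omega 0) i.
Proof.
by move=> cN ic; apply/eqP; move: i ic; apply/allP; move: c cN; apply/allP; vm_compute.
Qed.

Lemma vertex_words_point_inj : {in vertex_words &, injective point}.
Proof.
have inj : all (fun c => all (fun d => (point c == point d) ==> (c == d)) vertex_words)
  vertex_words by vm_compute.
by move=> c d /(allP inj)/allP cP /cP/implyP cd /eqP/cd/eqP.
Qed.

Lemma vertex_words_size : size vertex_words = 24.
Proof. by vm_compute. Qed.

Lemma vertex_words_below c : c \in vertex_words -> below 4 c.
Proof. by move: c; apply/allP; vm_compute. Qed.

(** [double_cosets n rs] asserts that each vertex of the subdiagram on [n] nodes is
    the image of one of the vertices given by [rs] under the stabilizer of the base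
    vertex. *)
Definition double_cosets (n : nat) (rs : seq word) : bool :=
  let us := [seq u <- normal_words | below n u & 0%N \notin u] in
  all (fun c => has (fun r => has (fun u => point (r ++ u) == point c) us) rs)
    (vertices_below n).

Section Vertices.
Variable p : seq nat.
Hypothesis p_sub : prefix p [:: 3; 4; 3]%N.

Local Notation n := (size p).+1.
Local Notation C := (string_coxeter p).
Local Notation t := (string_gen p).
Local Notation gen := (cox_gen (@string_matrix p)).
Local Notation F0 := (base_vertex gen).

Lemma vertex_stabilizerP g : vertex_stabilizer gen g <-> weight_act (omega 0) g = omega 0.
Proof.
split=> [/(parabolic_stab p_sub)|] e; first by apply: (e ord0).
by apply/(parabolic_stab p_sub) => i /contrapT ->.
Qed.

Lemma vertex_pointP g h :
  F0 ^^ g = F0 ^^ h <-> weight_act (omega 0) g = weight_act (omega 0) h.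
Proof.
rewrite vertex_eq vertex_stabilizerP weight_actM //; split=> e.
  by rewrite -[in RHS]e -!weight_actM // mulVg mulg1.
by rewrite e -weight_actM // mulgV weight_act1.
Qed.

Lemma vertex_word g : exists2 c, c \in vertices_below n &
  weight_act (omega 0) g = point c /\ F0 ^^ g = F0 ^^ elt p c.
Proof.
suff [c cn e] : exists2 c, c \in vertices_below n & weight_act (omega 0) g = point c.
  exists c => //; split=> //; apply/vertex_pointP; rewrite weight_act_elt //.
  by move: cn; rewrite mem_filter => /andP[].
have [w [_ wn ->]] := eltP p_sub g; rewrite weight_act_elt //.
elim/last_ind: w wn => [|w i IH].
  by exists [::] => //; rewrite mem_filter; apply/andP; split=> //; vm_compute.
rewrite /below all_rcons => /andP[i_n /IH[c cn e]].
have [|c' c'n e'] := vertices_closed _ cn i_n; first by rewrite (subdiagram_size p_sub).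
by exists c' => //; rewrite e' /point /weight_move !foldl_rcons -!/(weight_move _ _) e.
Qed.

Lemma face_verticesP (J : set 'I_n) g : face_vertices (tau := gen) J (F0 ^^ g) <->
  forall i : 'I_n, ~ J i -> coord (weight_act (omega 0) g) i = coord (omega 0) i.
Proof.
have n4 := subdiagram_size p_sub; split=> [[c Jc /vertex_pointP ->] i nJi|Jg].
  move: c Jc (omega 0); apply: parabolic_ind => [j|x|j c Jj _ IH x].
  - exact: cox_gen2.
  - by rewrite weight_act1.
  rewrite weight_actM // weight_act_gen // IH coord_refl //.
    exact: leq_trans (ltn_ord i) n4.
  by apply/eqP => /val_inj ji; apply: nJi; rewrite -ji.
have [c cn [ec ->]] := vertex_word g; move: cn; rewrite mem_filter => /andP[cn cV].
exists (elt p c) => //; apply: parabolic_elt => // i ic.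
by apply: contrapT => /Jg; rewrite ec; exact: vertex_word_coord.
Qed.

Lemma face_verticesI (J K : set 'I_n) :
  face_vertices (tau := gen) J `&` face_vertices K `<=` face_vertices (J `&` K).
Proof.
move=> F; have [g ->] := vertexP F => -[/face_verticesP Jg /face_verticesP Kg].
apply/face_verticesP => i nJK; have [Ji|/Jg//] := pselect (J i).
by apply: Kg => Ki; apply: nJK.
Qed.

Lemma double_cosetsP rs : double_cosets n rs -> all (below n) rs ->
  forall g, exists r u v, [/\ r \in map (elt p) rs, vertex_stabilizer gen u,
    vertex_stabilizer gen v & g = u * r * v].
Proof.
move=> /allP dc /allP rsn g; have [c cn [ec _]] := vertex_word g.
have /hasP[r rR /hasP[u]] := dc c cn.
rewrite mem_filter => /andP[/andP[un u0] uN] /eqP e.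
exists (elt p r), (g * (elt p r * elt p u)^-1), (elt p u); split.
- exact: map_f.
- apply/vertex_stabilizerP; rewrite weight_actM // ec -e.
  rewrite -elt_cat /point -(weight_act_elt p_sub) ?below_cat ?(rsn r rR) //.
  by rewrite -weight_actM // mulgV weight_act1.
- rewrite /vertex_stabilizer; apply: parabolic_elt => // i /= iu i0.
  by rewrite i0 in iu; rewrite iu in u0.
by rewrite -mulgA mulgVK.
Qed.

Lemma vertices_finite (a : vertex gen -> vertex gen) :
  involutive a -> exists r, pair_transversal a r.
Proof.
move=> aK; pose vs := [seq F0 ^^ elt p c | c <- vertices_below n].
apply: (pair_transversal_exists aK (e := vs)) => F.
have [g ->] := vertexP F; have [c cn [_ e]] := vertex_word g.
by apply/mapP; exists c.
Qed.

Lemma vertex_matrixE (a w : word) s : below n a -> below n w ->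
  vertex_matrix (tau := gen) (elt p a) s F0 (F0 ^^ elt p w) =
  if point w == point [::] then 1%N else if point w == point a then s else 2%N.
Proof.
move=> an wn.
have eqE u v : below n u -> below n v ->
    (F0 ^^ elt p u == F0 ^^ elt p v) = (point u == point v).
  move=> un vn; rewrite /point -!(weight_act_elt p_sub) //.
  by apply/eqP/eqP => /vertex_pointP.
by rewrite /vertex_matrix -{2}[F0]vertex_mul1 -(eval_nil (string_gen p)) !eqE.
Qed.

End Vertices.

(** * Presentations *)

(** If [f x = 1] then [x] is trivial in the quotient by any normal subgroup [N]
    containing the relators, because the projection to this quotient factors through
    [f]. *)
Lemma quotient_by_cover (p : seq nat) (R : set (string_coxeter p)) (G : groupType)
    (rho : 'I_(size p).+1 -> G) (f : {multiplicative string_coxeter p -> G}) :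
  (forall i, f (cox_gen (@string_matrix p) i) = rho i) ->
  (forall x, R x -> f x = 1) ->
  (forall N (nN : normal_subgroup N), R `<=` N ->
    exists u : {multiplicative G -> quo nN},
      forall i, u (rho i) = quo_pi nN (cox_gen (@string_matrix p) i)) ->
  is_quotient_by R rho.
Proof.
move=> fE fR cover; exists f; split=> //; apply/seteqP; split=> x.
  move=> fx N [nN RN]; have [u uE] := cover N nN RN.
  apply/(quo_pi1 nN); rewrite -(cox_hom_eq (f := u \o f)); first by rewrite /= fx hom1.
  by move=> i; rewrite /= fE uE.
by apply; split; [exact: kernel_normal | exact: fR].
Qed.

Lemma quotient_by_inj (p : seq nat) (R : set (string_coxeter p)) (G G' : groupType)
    (rho : 'I_(size p).+1 -> G) (h : {multiplicative G -> G'}) :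
  injective h -> is_quotient_by R rho -> is_quotient_by R (h \o rho).
Proof.
move=> hI [f [fE fK]]; exists (h \o f); split=> [i|]; first by rewrite /= fE.
rewrite -fK; apply/seteqP; split=> x /=; last by move=> ->; rewrite hom1.
by rewrite -(hom1 h) => /hI.
Qed.

Section CubicPresentation.
Variable p : seq nat.
Hypothesis p_sub : prefix p [:: 3; 4; 3]%N.
Variable alpha : string_coxeter p.
Hypothesis alpha_central : forall g, commute alpha g.
Variable s : nat.

Local Notation n := (size p).+1.
Local Notation C := (string_coxeter p).
Local Notation gen := (cox_gen (@string_matrix p)).
Local Notation F0 := (base_vertex gen).
Local Notation matrix := (vertex_matrix (tau := gen) alpha s).
Local Notation cubic := (cubic_group gen alpha_central s).
Local Notation rho := (cubic_gen gen alpha_central s).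
Local Notation cgen := (cox_gen (@string_matrix (4 :: p)%N)).

Lemma string_matrix_lift (i j : 'I_n) :
  @string_matrix (4 :: p)%N (lift ord0 i) (lift ord0 j) = string_matrix i j.
Proof.
rewrite /string_matrix (inj_eq lift_inj) /= /bump /= !add1n !eqSS.
by do !case: eqP.
Qed.

Lemma string_matrix0 (j : 'I_n) : @string_matrix (4 :: p)%N ord0 (lift ord0 j) =
  if j == ord0 then 4 else 2%N.
Proof. by rewrite /string_matrix -!val_eqE /= /bump /= add1n !eqSS. Qed.

Lemma string_matrixC q (i j : 'I_(size q).+1) : string_matrix i j = string_matrix j i.
Proof.
rewrite /string_matrix -!val_eqE /= eq_sym; case: eqP => // _.
by case: eqP => [->|//]; rewrite [i == _.+2 :> nat]ltn_eqF.
Qed.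

Let gen2 i : gen i * gen i = 1. Proof. exact: cox_gen2. Qed.

Hypothesis adjacent : F0 ^^ gen ord0 <> F0 /\ F0 ^^ gen ord0 <> F0 ^^ alpha.

Lemma cubic_relation i j : (rho i * rho j) ^+ @string_matrix (4 :: p)%N i j = 1.
Proof.
have rel0 k : (rho ord0 * rho (lift ord0 k))
    ^+ @string_matrix (4 :: p)%N ord0 (lift ord0 k) = 1.
  rewrite string_matrix0; case: eqVneq => [->|/eqP k0].
    have [sq y2] := cubic_relation_square alpha_central s adjacent.1 adjacent.2 (gen2 ord0).
    by rewrite (expgnA _ 2 2) sq -(homX (sd_inr _)) y2.
  apply/commute_invol; [exact: (cubic_gen2 alpha_central s gen2)..|].
  rewrite cubic_gen0 cubic_genS; apply/commgP; rewrite -conjg_fix sd_inr_conj vertex_act_gen.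
  by rewrite vertex_fix //; exact: parabolic_gen.
case: (ord0_or_lift i) (ord0_or_lift j) => [->|[i' ->]] [->|[j' ->]].
- by rewrite cubic_gen2 ?expg1n //.
- exact: rel0.
- rewrite string_matrixC; have := rel0 i'; move: (string_matrix _ _) => m e.
  have rhoV k : (rho k)^-1 = rho k by exact/involV/cubic_gen2.
  rewrite -[rho ord0]rhoV -[rho (lift _ _)]rhoV.
  by rewrite -invgM expVgn e invg1.
by rewrite string_matrix_lift !cubic_genS -sd_inlM -(homX (sd_inl _)) cox_genM.
Qed.

Definition cubic_cover : {multiplicative string_coxeter (4 :: p)%N -> cubic} :=
  cox_lift (cubic_gen2 alpha_central s gen2) cubic_relation.

Lemma cubic_coverE i : cubic_cover (cgen i) = rho i.
Proof. exact: cox_lift_gen. Qed.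

Lemma cubic_cover_tail w : below n w ->
  cubic_cover (eval (string_gen (4 :: p)%N) (map S w)) = sd_inl _ (elt p w).
Proof.
elim: w => [|i w IH]; first by rewrite /elt /eval !big_nil hom1.
move=> /andP[i_n wn]; rewrite elt_cons -[map S _]/(i.+1 :: map S w).
rewrite eval_cons (@gmulfM _ _ cubic_cover) IH // sd_inlM.
congr (_ * _); rewrite -[i in RHS]/(val (Ordinal i_n)) string_genE -cubic_genS.
rewrite -cubic_coverE; congr (cubic_cover _).
by rewrite /string_gen; congr cox_gen; apply: val_inj; rewrite /= inordK.
Qed.

Lemma cubic_conj_order g :
  (rho ord0 * rho ord0 ^ sd_inl _ g) ^+ matrix F0 (F0 ^^ g) = 1.
Proof.
rewrite cubic_gen0 -sigma_vertex -sd_inrM -(homX (sd_inr _)).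
by rewrite cox_genM.
Qed.

Section Quotient.
Variables (N : set (string_coxeter (4 :: p)%N)).
Hypothesis nN : normal_subgroup N.

Let q i := quo_pi nN (cgen i).

Let q2 i : q i * q i = 1.
Proof. by rewrite /q -gmulfM cox_gen2 hom1. Qed.

Let qM i j : (q i * q j) ^+ string_matrix i j = 1.
Proof. by rewrite /q -gmulfM -homX cox_genM hom1. Qed.

Let qS2 i : q (lift ord0 i) * q (lift ord0 i) = 1. Proof. exact: q2. Qed.

Let qSM i j : (q (lift ord0 i) * q (lift ord0 j)) ^+ string_matrix i j = 1.
Proof. by rewrite -string_matrix_lift qM. Qed.

(** The generators of [4, p] after the first satisfy the relations of [p]. *)
Definition tail_hom : {multiplicative C -> quo nN} := cox_lift qS2 qSM.

Lemma tail_homE w : below n w ->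
  tail_hom (elt p w) = quo_pi nN (eval (string_gen (4 :: p)%N) (map S w)).
Proof.
elim: w => [|i w IH]; first by rewrite /elt /eval !big_nil !hom1.
move=> /andP[i_n wn]; rewrite elt_cons /= eval_cons !gmulfM IH //; congr (_ * _).
rewrite -[i in LHS]/(val (Ordinal i_n)) string_genE cox_lift_gen /q; congr (quo_pi nN _).
by rewrite /string_gen; congr cox_gen; apply: val_inj; rewrite /= inordK.
Qed.

Let q0_tail j : j <> ord0 -> commute (q ord0) (tail_hom (gen j)).
Proof.
move=> /eqP j0; rewrite cox_lift_gen.
by have := qM ord0 (lift ord0 j); rewrite string_matrix0 (negbTE j0) => /commute_invol; apply.
Qed.

Lemma cubic_quotient (rs : seq word) :
  double_cosets n rs -> all (below n) rs ->
  (forall r, r \in rs -> (quo_pi nN (cgen ord0) * quo_pi nN (cgen ord0) ^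
     quo_pi nN (eval (string_gen (4 :: p)%N) (map S r)))
     ^+ matrix F0 (F0 ^^ elt p r) = 1) ->
  exists u : {multiplicative cubic -> quo nN}, forall i, u (rho i) = quo_pi nN (cgen i).
Proof.
move=> dc rsn rsM.
have Mg := twist_double_coset alpha_central (s := s) q0_tail gen2
  (double_cosetsP p_sub dc rsn).
have {}Mg : forall g, (q ord0 * q ord0 ^ tail_hom g) ^+ matrix F0 (F0 ^^ g) = 1.
  apply: Mg => _ /mapP[r rR ->]; rewrite tail_homE ?rsM //.
  by move/allP: rsn; apply.
exists (twist alpha_central (q2 ord0) q0_tail gen2 Mg) => i.
case: (ord0_or_lift i) => [->|[j ->]]; first exact: twist0.
by rewrite twistS cox_lift_gen.
Qed.

Lemma quotient_adjacent : (quo_pi nN (cgen ord0) * quo_pi nN (cgen ord0) ^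
     quo_pi nN (eval (string_gen (4 :: p)%N) [:: 1%N])) ^+ 2 = 1.
Proof.
rewrite -/(q ord0) /eval big_seq1.
have -> : string_gen (4 :: p)%N 1 = cgen (lift ord0 ord0).
  by rewrite /string_gen; congr cox_gen; apply: val_inj; rewrite /= inordK.
rewrite -/(q _) conjgE (involV (q2 _)) mulgA -expg2 -expgnA.
by have := qM ord0 (lift ord0 ord0); rewrite string_matrix0 eqxx.
Qed.

End Quotient.

End CubicPresentation.

(** * The 24-cell *)

(** With [x] the first generator, the relator of the toroid has the form of the left hand
    side, and the right hand side says that two conjugates of [x] commute. *)
Lemma conj_invol_power (G : groupType) (x w : G) : w * w = 1 ->
  (x * w) ^+ 4 = (x * x ^ w) ^+ 2.
Proof.
move=> w2; rewrite (expgnA _ 2 2) conjgE involV //; congr (_ ^+ 2).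
by rewrite expg2 !mulgA.
Qed.

Section Cell24.

Local Notation p := [:: 3; 4; 3]%N.
Local Notation T := (string_coxeter p).
Local Notation gen := cell24_gen.
Local Notation alpha := cell24_alpha.
Local Notation F0 := (base_vertex gen).

Let p_sub : prefix p p. Proof. by []. Qed.

(** The Coxeter element, as a word; [alpha] is its sixth power, and acts as [-1]. *)
Definition coxeter_word : word := [:: 0; 1; 2; 3]%N.

Definition coxeter_power (k : nat) : word := flatten (nseq k coxeter_word).

Lemma coxeter_power_below k : below 4 (coxeter_power k).
Proof. by elim: k => [|k IH] /=; last exact: IH. Qed.

Lemma eval_coxeter_word (G : groupType) (t : nat -> G) :
  eval t coxeter_word = t 0%N * t 1%N * t 2%N * t 3%N.
Proof. by rewrite /eval !big_cons big_nil mulg1 !mulgA. Qed.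

Lemma cell24_alphaE : alpha = elt p (coxeter_power 6).
Proof. by rewrite /elt eval_nseq eval_coxeter_word. Qed.

Lemma act_alpha (i : 'I_4) : weight_act (omega i) alpha = opp_weight (omega i).
Proof.
rewrite cell24_alphaE weight_act_elt ?coxeter_power_below //.
by case: i => -[|[|[|[|]]]].
Qed.

Lemma opp_weightK x : opp_weight (opp_weight x) = x.
Proof. by case: x => [[[? ?] ?] ?] /=; rewrite !GRing.opprK. Qed.

Lemma cell24_alpha2 : alpha * alpha = 1.
Proof.
apply: (elt_faithful p_sub) => i.
by rewrite weight_actM // act_alpha weight_act_opp // act_alpha opp_weightK.
Qed.

Lemma act_alpha_mul g :
  weight_act (omega 0) (alpha * g) = opp_weight (weight_act (omega 0) g).
Proof. by rewrite weight_actM // (act_alpha ord0) weight_act_opp. Qed.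

Lemma cell24_alpha_free : ~ vertex_stabilizer gen alpha.
Proof. by move/(vertex_stabilizerP p_sub); rewrite (act_alpha ord0). Qed.

Lemma cell24_generated : parabolic gen setT = setT.
Proof.
apply/seteqP; split=> // g _; have [w [_ wn ->]] := eltP p_sub g.
exact: parabolic_elt.
Qed.

Lemma cell24_alphaK : involutive (fun F : vertex gen => F ^^ alpha).
Proof. exact: vertex_alphaK cell24_alpha2. Qed.

Lemma cell24_alpha_neq (F : vertex gen) : F ^^ alpha <> F.
Proof. exact: (vertex_alpha_neq cell24_alpha_central cell24_alpha_free). Qed.

(** The vertices of a transversal and their opposites are the 24 vertices. *)
Lemma cell24_transversal : exists r : seq (vertex gen),
  pair_transversal (fun F => F ^^ alpha) r /\ size r = 12.
Proof.
have [r rT] := vertices_finite p_sub cell24_alphaK; exists r; split=> //.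
have [ur rP rA] := rT; pose a F := vertex_mul (tau := gen) F alpha.
pose e := [seq F0 ^^ elt p c | c <- vertex_words].
have ue : uniq e.
  rewrite map_inj_in_uniq => [|c d cV dV /(vertex_pointP p_sub)].
    exact: filter_uniq normal_words_uniq.
  by rewrite !weight_act_elt ?vertex_words_below //; exact: vertex_words_point_inj.
have ura : uniq (r ++ map a r).
  rewrite cat_uniq ur (map_inj_uniq (inv_inj cell24_alphaK)) ur andbT.
  apply/hasPn => F /mapP[F' F'r FF'] /=; apply/negP => Fr.
  apply: (@cell24_alpha_neq F'); rewrite -[LHS]/(a F') -FF'.
  exact: (rA F' F F'r Fr FF').
have /eqP : size (r ++ map a r) = size e.
  apply/perm_size/uniq_perm => // F; rewrite mem_cat.
  have -> : F \in e.
    have [g ->] := vertexP F; have [c cn [_ eF]] := vertex_word p_sub g.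
    apply/mapP; exists c => //; move: cn; rewrite mem_filter => /andP[] //.
  have [F' F'r [->|->]] := rP F; first by rewrite F'r.
  by rewrite (map_f a F'r) orbT.
by rewrite size_cat !size_map vertex_words_size addnn -[24]/(12.*2) (inj_eq double_inj) => /eqP.
Qed.

Lemma cell24_adjacent :
  F0 ^^ gen ord0 <> F0 /\ F0 ^^ gen ord0 <> F0 ^^ alpha.
Proof.
split; last first.
  by move/(vertex_pointP p_sub); rewrite (act_alpha ord0) (weight_act_gen p_sub).
rewrite -[X in _ <> X]vertex_mul1 => /(vertex_pointP p_sub).
by rewrite weight_act1 // (weight_act_gen p_sub).
Qed.

Lemma normal_words_below w : w \in normal_words -> below 4 w.
Proof. by move: w; apply/allP; vm_compute. Qed.

Lemma cell24_order_bij :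
  bijective (fun k : 'I_1152 => elt p (nth [::] normal_words k)).
Proof.
have rev_act u : u \in normal_words ->
    weight_move delta (rev u) = weight_act delta (elt p u)^-1.
  by move=> /normal_words_below un; rewrite -elt_rev weight_act_elt // /below all_rev.
apply: nth_bij normal_words_uniq normal_words_size _ _ => [v w vN wN e|g].
  by rewrite -(decode_normal vN) -(decode_normal wN) (rev_act v vN) (rev_act w wN) e.
by have [w [wN _ ->]] := eltP p_sub g; exists w.
Qed.

End Cell24.

Section Cell24Cubic.
Variable s : nat.
Hypothesis s2 : (2 <= s)%N.

Local Notation p := [:: 3; 4; 3]%N.
Local Notation gen := cell24_gen.
Local Notation F0 := (base_vertex gen).
Local Notation rho := (cell24_cubic_gen s).
Local Notation inl := (sd_inl (vertex_action gen cell24_alpha_central s)).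
Local Notation inr := (sd_inr (vertex_action gen cell24_alpha_central s)).

Let p_sub : prefix p p. Proof. by []. Qed.

Let genC : string_C_group gen. Proof. exact: subdiagram_C_group p_sub. Qed.

Lemma cell24_cubic_C_group : string_C_group rho.
Proof.
have [r [rT _]] := cell24_transversal.
apply: (cubic_C_group cell24_alpha_central genC cell24_alpha2 cell24_alpha_free s2 rT).
exact: face_verticesI p_sub.
Qed.

Lemma cell24_cubic_generated : parabolic rho setT = setT.
Proof.
have [r [rT _]] := cell24_transversal.
exact: (cubic_parabolicT cell24_alpha_central genC cell24_generated
  cell24_alpha2 cell24_alpha_free s2 rT).
Qed.

Lemma cell24_cubic_type : has_schlafli_type rho [:: 4; 3; 4; 3].
Proof.
split=> // i j; have [->//|[j' ->]] := ord0_or_lift j.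
have [->|[i' ->]] := ord0_or_lift i => ji; have {}ji := succn_inj ji.
  have -> : j' = ord0 by apply: val_inj.
  apply: (cubic_order0 cell24_alpha_central genC cell24_alpha2 s2).
    exact: cell24_adjacent.1.
  exact: cell24_adjacent.2.
rewrite /cell24_cubic_gen !cubic_genS -sd_inlM; apply: (has_order_morph (f := inl)).
  exact: sd_inl_inj.
exact: subdiagram_order p_sub _ _ ji.
Qed.

Lemma cell24_W_iso :
  exists f : {multiplicative cell24_W s -> dihedral_power12 s}, bijective f.
Proof.
have [r [rT r12]] := cell24_transversal.
exact: (matching_iso cell24_alphaK s2 (fun _ _ => erefl) cell24_alpha_neq rT r12).
Qed.

Lemma cell24_cubic_order :
  [set: cell24_cubic_group s] #= `I_(1152 * (2 * s) ^ 12)%N.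
Proof.
have [f [f' fK f'K]] := cell24_W_iso; have [g gK g'K] := cell24_order_bij.
have h_bij : bijective (fun kd : 'I_1152 * {ffun 'I_12 -> 'D_(s.*2)%type} =>
    (elt p (nth [::] normal_words kd.1), f' kd.2) : cell24_cubic_group s).
  exists (fun x => (g x.1, f x.2)) => [[k d]|[x w]] /=; first by rewrite gK f'K.
  by rewrite g'K fK.
have := card_bij_fin h_bij.
by rewrite card_prod card_ord card_ffun card_ord -cardsT card_dihedral // -mul2n.
Qed.

(** The vertex stabilizer has five orbits on vertices, according to the inner product
    with the base vertex. For unit vectors its values at the representatives are 1 for
    the empty word, 1/2 for the word 0, and 0, -1/2, -1 for the powers 3, 4, 6 of the
    Coxeter element. *)
Definition cell24_cosets : seq word :=
  [:: [::]; [:: 0%N]; coxeter_power 3; coxeter_power 4; coxeter_power 6].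

Lemma cell24_double_cosets : double_cosets 4 cell24_cosets.
Proof. by vm_compute. Qed.

Lemma cell24_presentation :
  let r := string_gen [:: 4; 3; 4; 3] in
  let beta := r 1%N * r 2%N * r 3%N * r 4%N in
  @is_quotient_by [:: 4; 3; 4; 3]
    [set x | (exists2 i : nat, i = 3 \/ i = 4 &
               x = (r 0%N * (beta ^+ i)^-1 * r 0%N * beta ^+ i) ^+ 2)
             \/ x = (r 0%N * beta ^+ 6 * r 0%N * beta ^+ 6) ^+ s] _ rho.
Proof.
move=> r beta; have r0 : r 0%N = cox_gen (@string_matrix (4 :: p)%N) ord0.
  by rewrite /r /string_gen; congr cox_gen; apply: val_inj; rewrite /= inordK.
have betaE k : eval r (map S (coxeter_power k)) = beta ^+ k.
  by rewrite /coxeter_power map_flatten map_nseq eval_nseq /eval !big_cons big_nil mulg1 !mulgA.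
pose f := cubic_cover cell24_alpha_central s cell24_adjacent.
have f0 : f (r 0%N) = rho ord0 by rewrite r0; exact: cubic_coverE.
have fbeta k : f (beta ^+ k) = inl (elt p (coxeter_power k)).
  by rewrite -betaE; apply: cubic_cover_tail; exact: coxeter_power_below.
have matrix_power k : vertex_matrix (tau := gen) cell24_alpha s F0
    (F0 ^^ elt p (coxeter_power k)) = if point (coxeter_power k) == point [::] then 1%N
    else if point (coxeter_power k) == point (coxeter_power 6) then s else 2%N.
  by rewrite cell24_alphaE; apply: (vertex_matrixE p_sub); exact: coxeter_power_below.
apply: (quotient_by_cover (f := f)).
- exact: cubic_coverE.
- move=> _ [[i i34 ->]|->].
    have -> : r 0%N * (beta ^+ i)^-1 * r 0%N * beta ^+ i =
        r 0%N * r 0%N ^ (beta ^+ i) by rewrite conjgE !mulgA.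
    rewrite homX gmulfM homJ f0 fbeta.
    have := cubic_conj_order cell24_alpha_central s (elt p (coxeter_power i)).
    by rewrite matrix_power; case: i34 => ->.
  have fb2 : (f (beta ^+ 6))^-1 = f (beta ^+ 6).
    by apply: involV; rewrite fbeta -sd_inlM -cell24_alphaE cell24_alpha2.
  have -> : f ((r 0%N * beta ^+ 6 * r 0%N * beta ^+ 6) ^+ s) =
      (rho ord0 * rho ord0 ^ f (beta ^+ 6)) ^+ s.
    rewrite homX; move: (beta ^+ 6) fb2 => b fb2.
    by rewrite !gmulfM f0 conjgE fb2 !mulgA.
  have := cubic_conj_order cell24_alpha_central s (elt p (coxeter_power 6)).
  by rewrite matrix_power fbeta.
move=> N nN RN.
apply: (cubic_quotient p_sub cell24_alpha_central (s := s) (nN := nN)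
  cell24_double_cosets) => // w.
set q := quo_pi nN; rewrite -r0 => wR.
have q02 : q (r 0%N) * q (r 0%N) = 1 by rewrite -gmulfM r0 cox_gen2 hom1.
have qR x : (exists2 i : nat, i = 3 \/ i = 4 &
    x = (r 0%N * (beta ^+ i)^-1 * r 0%N * beta ^+ i) ^+ 2)
    \/ x = (r 0%N * beta ^+ 6 * r 0%N * beta ^+ 6) ^+ s -> q x = 1.
  by move=> Rx; apply/quo_pi1/RN.
have q34 i : i = 3 \/ i = 4 ->
    (q (r 0%N) * q (r 0%N) ^ q (eval r (map S (coxeter_power i)))) ^+ 2 = 1.
  move=> i34; rewrite betaE -homJ -gmulfM -homX conjgE !mulgA.
  by apply: qR; left; exists i.
have alpha2 : q (beta ^+ 6) * q (beta ^+ 6) = 1.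
  rewrite -betaE -(tail_homE nN) ?coxeter_power_below //.
  by rewrite -gmulfM -cell24_alphaE cell24_alpha2 hom1.
move: wR; rewrite !inE => /orP[/eqP->|/orP[/eqP->|/orP[/eqP->|/orP[/eqP->|/eqP->]]]].
- rewrite cell24_alphaE (vertex_matrixE p_sub) ?coxeter_power_below // eqxx expg1.
  by rewrite eval_nil hom1 conjg1.
- rewrite cell24_alphaE (vertex_matrixE p_sub) ?coxeter_power_below //.
  by rewrite r0; exact: quotient_adjacent.
- by rewrite matrix_power; apply: q34; left.
- by rewrite matrix_power; apply: q34; right.
rewrite matrix_power betaE.
have : q ((r 0%N * beta ^+ 6 * r 0%N * beta ^+ 6) ^+ s) = 1 by apply: qR; right.
move: (beta ^+ 6) alpha2 => b b2.
by rewrite homX !gmulfM conjgE (involV b2) !mulgA.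
Qed.

End Cell24Cubic.

(** * The toroidal residue *)

Section Toroid.
Variable s : nat.
Hypothesis s2 : (2 <= s)%N.

Local Notation p := [:: 3; 4; 3]%N.
Local Notation po := [:: 3; 4]%N.
Local Notation gen := cell24_gen.
Local Notation geno := (cox_gen (@string_matrix po)).
Local Notation F0 := (base_vertex gen).
Local Notation Fo := (base_vertex geno).
Local Notation rho := (cell24_cubic_gen s).
Local Notation inl := (sd_inl (vertex_action gen cell24_alpha_central s)).
Local Notation inr := (sd_inr (vertex_action gen cell24_alpha_central s)).

Let p_sub : prefix p p. Proof. by []. Qed.
Let po_sub : prefix po p. Proof. by []. Qed.

Let one_central (g : string_coxeter po) : commute 1 g.
Proof. exact/commute_sym/commute1. Qed.

(** The construction for the octahedron, with [alpha = 1]: then no two vertices are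
    paired, and all the involutions [sigma F] commute. *)
Local Notation octa := (cubic_group geno one_central s).
Local Notation rhoo := (cubic_gen geno one_central s).

Let widen (i : 'I_3) : 'I_4 := widen_ord (leqnSn 3) i.

Lemma octa_matrix (i j : 'I_3) :
  @string_matrix po i j = @string_matrix p (widen i) (widen j).
Proof. by rewrite !string_matrix_f4. Qed.

Let gen2 (i : 'I_3) : gen (widen i) * gen (widen i) = 1. Proof. exact: cox_gen2. Qed.

Let genM (i j : 'I_3) : (gen (widen i) * gen (widen j)) ^+ @string_matrix po i j = 1.
Proof. by rewrite octa_matrix; exact: cox_genM. Qed.

(** The octahedral facet of the 24-cell. *)
Definition octa_incl : {multiplicative string_coxeter po -> string_coxeter p} :=
  cox_lift gen2 genM.

Lemma octa_incl_gen i : octa_incl (geno i) = gen (widen i).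
Proof. exact: cox_lift_gen. Qed.

Lemma octa_inclE w : below 3 w -> octa_incl (elt po w) = elt p w.
Proof.
elim: w => [|i w IH]; first by rewrite /elt !eval_nil hom1.
move=> /andP[i3 w3]; rewrite !elt_cons (@gmulfM _ _ octa_incl) IH //; congr (_ * _).
rewrite -[i in LHS]/(val (Ordinal i3)) string_genE octa_incl_gen.
by rewrite /string_gen; congr cox_gen; apply: val_inj; rewrite /= inordK // ltnW.
Qed.

Lemma octa_act x g : weight_act x (octa_incl g) = weight_act x g.
Proof.
have [w [_ w3 ->]] := eltP po_sub g; rewrite octa_inclE // !weight_act_elt //.
by apply: sub_all w3 => i i3; exact: ltnW.
Qed.

Lemma octa_incl_inj : injective octa_incl.
Proof.
apply: hom_inj => g g1; apply: (elt_faithful po_sub) => i.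
by rewrite -octa_act g1 weight_act1.
Qed.

Lemma octa_vertex g h :
  F0 ^^ octa_incl g = F0 ^^ octa_incl h <-> Fo ^^ g = Fo ^^ h.
Proof. by rewrite (vertex_pointP p_sub) (vertex_pointP po_sub) !octa_act. Qed.

(** The third coordinate is constant, and positive, on the vertices of the facet;
    so no two of them are opposite in the 24-cell. *)
Lemma octa_not_opposite g h : F0 ^^ octa_incl g <> F0 ^^ octa_incl h ^^ cell24_alpha.
Proof.
have coord3 k : coord (weight_act (omega 0) (octa_incl k)) 3 = coord (omega 0) 3.
  rewrite octa_act; have [w [_ w3 ->]] := eltP po_sub k; rewrite weight_act_elt //.
  elim: w w3 (omega 0) => [//|i w IH] /andP[i3 w3] x; rewrite /= IH //.
  by rewrite coord_refl // ltn_eqF.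
rewrite -vertex_mulM -cell24_alpha_central => /(vertex_pointP p_sub).
rewrite act_alpha_mul => /(congr1 (coord^~ 3)); rewrite coord3.
by move: (weight_act _ _) (coord3 h) => [[[x0 x1] x2] x3] /= ->.
Qed.

Lemma octa_adjacent : Fo ^^ geno ord0 <> Fo /\ Fo ^^ geno ord0 <> Fo ^^ 1.
Proof.
suff ne : Fo ^^ geno ord0 <> Fo by rewrite vertex_mul1.
rewrite -[X in _ <> X]vertex_mul1 => /(vertex_pointP po_sub).
by rewrite weight_act1 // (weight_act_gen po_sub).
Qed.

Let tau2 (i : 'I_3) : geno i * geno i = 1. Proof. exact: cox_gen2. Qed.

Let rho2 i : rho i * rho i = 1.
Proof. by apply: cubic_gen2 => j; exact: cox_gen2. Qed.

Let inlo : {multiplicative string_coxeter po -> cell24_cubic_group s} := inl \o octa_incl.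

Let rho0_tau (j : 'I_3) : j <> ord0 -> commute (rho ord0) (inlo (geno j)).
Proof.
move=> j0; rewrite [inlo _]/(inl (octa_incl _)) octa_incl_gen.
rewrite /cell24_cubic_gen cubic_gen0; apply/commgP.
rewrite -conjg_fix sd_inr_conj vertex_act_gen vertex_fix ?eqxx //.
by apply: parabolic_gen => /(congr1 val) /= e; apply: j0; apply: val_inj.
Qed.

Let rho0M g : (rho ord0 * rho ord0 ^ inlo g) ^+
  vertex_matrix (tau := geno) 1 s Fo (Fo ^^ g) = 1.
Proof.
have := cubic_conj_order cell24_alpha_central s (octa_incl g).
rewrite /vertex_matrix vertex_mul1.
have base : F0 = F0 ^^ octa_incl 1 by rewrite hom1 vertex_mul1.
have -> : (F0 ^^ octa_incl g == F0) = (Fo ^^ g == Fo).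
  rewrite [X in _ == X]base -[X in _ = (_ == X)]vertex_mul1.
  by apply/eqP/eqP => /octa_vertex.
case: eqP => // _; case: eqP => // /esym e; case: (@octa_not_opposite g 1).
by rewrite -base e.
Qed.

(** The homomorphism that shows that the facet subgroup is the group of the octahedral
    construction. *)
Definition facet_hom : {multiplicative octa -> cell24_cubic_group s} :=
  twist one_central (rho2 ord0) rho0_tau tau2 rho0M.

Lemma facet_homE (i : 'I_4) : facet_hom (rhoo i) = rho (widen_ord (leqnSn 4) i).
Proof.
case: (ord0_or_lift i) => [->|[j ->]].
  rewrite [LHS]twist0; congr (rho _); exact: val_inj.
transitivity (inl (gen (widen j))).
  by rewrite [LHS]twistS; exact: (congr1 inl (octa_incl_gen j)).
transitivity (rho (lift ord0 (widen j))); first exact/esym/cubic_genS.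
by congr (rho _); exact: val_inj.
Qed.

Let psi := twist_vertex one_central (rho2 ord0) rho0_tau tau2 rho0M.

Let octa_oneK : involutive (fun F : vertex geno => F ^^ 1).
Proof. by move=> F; rewrite !vertex_mul1. Qed.

Let projo := proj octa_oneK (m := vertex_matrix (tau := geno) 1 s) (fun _ _ => erefl).

Let proj24 := proj cell24_alphaK (m := vertex_matrix (tau := gen) cell24_alpha s)
  (fun _ _ => erefl).

Lemma facet_vertex_gen h :
  psi (cox_gen _ (Fo ^^ h)) = inr (cox_gen _ (F0 ^^ octa_incl h)).
Proof.
rewrite [LHS]cox_lift_gen twist_genE; last exact: tau2; last exact: rho0_tau.
by rewrite sigma_vertex -cubic_gen0.
Qed.

(** The homomorphism preserves the dihedral components at the vertices of the
    facet, which determine an element of the group of the octahedron. *)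
Lemma facet_vertex_proj w : (psi w).1 = 1 /\
  forall g, proj24 (F0 ^^ octa_incl g) (psi w).2 = projo (Fo ^^ g) w.
Proof.
elim/cox_ind: w => [|F w [IH1 IH2]]; first by rewrite hom1; split=> // g; rewrite !hom1.
have [h ->] := vertexP F; rewrite (@gmulfM _ _ psi) facet_vertex_gen; split=> [|g].
  by rewrite [LHS](congr1 (fun x => 1 * x) IH1) mul1g.
have -> : (inr (cox_gen _ (F0 ^^ octa_incl h)) * psi w).2 =
    cox_gen _ (F0 ^^ octa_incl h) * (psi w).2.
  by rewrite [LHS](congr1 (fun x => vertex_action gen cell24_alpha_central s _ x * _) IH1) gact1.
rewrite (@gmulfM _ _ (proj24 _)) (@gmulfM _ _ (projo _)) IH2; congr (_ * _).
rewrite !projE /proj_gen vertex_mul1.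
have -> : (F0 ^^ octa_incl h == F0 ^^ octa_incl g) = (Fo ^^ h == Fo ^^ g).
  by apply/eqP/eqP => /octa_vertex.
case: eqP => // _; case: eqP => // /octa_not_opposite; case.
Qed.

Lemma facet_hom_inj : injective facet_hom.
Proof.
apply: hom_inj => -[g w].
have -> : facet_hom (g, w) = inl (octa_incl g) * psi w by [].
have [psi1 psi2] := facet_vertex_proj w => e.
have g1 : octa_incl g = 1.
  by have := congr1 fst e; rewrite /= psi1 mulg1.
have w1 : psi w = 1 by move: e; rewrite g1 => e; rewrite -e; exact/esym/mul1g.
have -> : g = 1 by apply: octa_incl_inj; rewrite g1 hom1.
have [r rT] := vertices_finite po_sub octa_oneK.
suff -> : w = 1 by [].
apply: (proj_inj (aK := octa_oneK) (mE := fun _ _ => erefl) rT) => F.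
have [h ->] := vertexP F.
by have := psi2 h; rewrite w1 => <-; exact: hom1.
Qed.

Let r := string_gen [:: 4; 3; 4].

(** It maps the base vertex to the opposite vertex of the octahedron. *)
Let opposite : word := [:: 0; 1; 2; 1; 0]%N.

Lemma octa_double_cosets : double_cosets 3 [:: [::]; [:: 0%N]; opposite].
Proof. by vm_compute. Qed.

Lemma octa_presentation : @is_quotient_by [:: 4; 3; 4]
  [set (r 0%N * r 1%N * r 2%N * r 3%N * r 2%N * r 1%N) ^+ 4] octa rhoo.
Proof.
have r0 : r 0%N = cox_gen (@string_matrix (4 :: po)%N) ord0.
  by rewrite /r /string_gen; congr cox_gen; apply: val_inj; rewrite /= inordK.
pose w := eval r (map S opposite).
have relE : r 0%N * r 1%N * r 2%N * r 3%N * r 2%N * r 1%N = r 0%N * w.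
  by rewrite /w /eval !big_cons big_nil mulg1 !mulgA.
have w2 : w * w = 1.
  rewrite /w /eval !big_cons big_nil mulg1 -!mulgA.
  have rr i : r i * r i = 1 by exact: cox_gen2.
  have rK i x : r i * (r i * x) = x by rewrite mulgA rr mul1g.
  by rewrite !rK rr.
have matrixE u : below 3 u -> vertex_matrix (tau := geno) 1 s Fo (Fo ^^ elt po u) =
    if point u == point [::] then 1%N else if point u == point [::] then s else 2%N.
  by move=> u3; rewrite -(vertex_matrixE po_sub) // /elt eval_nil.
pose f := cubic_cover one_central s octa_adjacent.
have f0 : f (r 0%N) = rhoo ord0 by rewrite r0; exact: cubic_coverE.
rewrite relE; apply: (quotient_by_cover (f := f)).
- exact: cubic_coverE.
- move=> _ ->; rewrite conj_invol_power // homX gmulfM homJ f0 /w.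
  have -> : f (eval r (map S opposite)) = sd_inl _ (elt po opposite) by exact: cubic_cover_tail.
  have := cubic_conj_order one_central s (elt po opposite).
  by rewrite matrixE.
move=> N nN RN.
apply: (cubic_quotient po_sub one_central (s := s) (nN := nN) octa_double_cosets) => // u.
set q := quo_pi nN; rewrite -r0 => uR.
have q02 : q (r 0%N) * q (r 0%N) = 1 by rewrite -gmulfM r0 cox_gen2 hom1.
move: uR; rewrite !inE => /orP[/eqP->|/orP[/eqP->|/eqP->]].
- by rewrite matrixE // eqxx expg1 eval_nil hom1 conjg1.
- by rewrite matrixE // r0; exact: quotient_adjacent.
rewrite matrixE // -/w -homJ -gmulfM -homX -conj_invol_power //.
by apply/quo_pi1/RN.
Qed.

Theorem cell24_toroid :
  is_cubic_toroid_400 (fun i : 'I_4 => rho (widen_ord (leqnSn 4) i)).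
Proof.
split; first exact: (string_C_group_widen (leqnSn 4) (cell24_cubic_C_group s2)).
have -> : (fun i : 'I_4 => rho (widen_ord (leqnSn 4) i)) = facet_hom \o rhoo.
  by apply/funext => i; rewrite -facet_homE.
exact: (quotient_by_inj (p := [:: 4; 3; 4]%N) facet_hom_inj octa_presentation).
Qed.

End Toroid.

Theorem corollary4p5 (s : nat) (hs : (2 <= s)%N) :
  let G := cell24_cubic_group s in
  let rho : 'I_5 -> G := cell24_cubic_gen s in
  let r := string_gen [:: 4; 3; 4; 3] in
  let beta := r 1%N * r 2%N * r 3%N * r 4%N in
  (* a regular 5-polytope of type {4,3,4,3} with automorphism group G *)
  [/\ string_C_group rho,
      parabolic rho setT = setT,
      has_schlafli_type rho [:: 4; 3; 4; 3],
      regular_polytope (@face_le 5 G rho) 5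
    & forall f : face rho -> face rho,
        poset_automorphism (@face_le 5 G rho) f <->
        exists! g : G, forall F, f F = face_mul F g]
  /\
  (* G, by definition the semidirect product of W by [3,4,3], is
     D_s^12 >< [3,4,3], of order 1152 (2s)^12 *)
  ((exists f : {multiplicative cell24_W s -> dihedral_power12 s}, bijective f)
   /\ [set: G] #= `I_(1152 * (2 * s) ^ 12)%N)
  /\
  @is_quotient_by [:: 4; 3; 4; 3]
    [set x | (exists2 i : nat, i = 3 \/ i = 4 &
               x = (r 0%N * (beta ^+ i)^-1 * r 0%N * beta ^+ i) ^+ 2)
             \/ x = (r 0%N * beta ^+ 6 * r 0%N * beta ^+ 6) ^+ s] G rho
  /\
  (* the toroidal residue *)
  is_cubic_toroid_400 (fun i : 'I_4 => rho (widen_ord (leqnSn 4) i)).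
Proof.
split; last split; last split; last exact: cell24_toroid hs.
- split; [exact: cell24_cubic_C_group hs | exact: cell24_cubic_generated hs
    | exact: cell24_cubic_type hs | |].
    exact: face_regular (cell24_cubic_C_group hs) (cell24_cubic_generated hs).
  exact: face_automorphismP (cell24_cubic_C_group hs) (cell24_cubic_generated hs).
- by split; [exact: cell24_W_iso | exact: cell24_cubic_order].
- exact: cell24_presentation.
Qed.
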